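(* Let $W=W(\Gamma,\mathbf m)$ be a graph product of primary cyclic groups. If $W$ is one-ended with isolated flats and the outer automorphism group $\operatorname{Aut}W/\operatorname{Inn}W$ is infinite, then $W$ splits as a free product with amalgamation $W=A\ast_CB$ where (1) $A$ and $B$ are special subgroups; and (2) $C$ is an infinite virtually abelian special subgroup.
   Context: $\Gamma$ is a finite simplicial graph with non-empty vertex set $V=\{v_1,\dots,v_N\}$. Each index $i$ is given a label $\mathbf m(i)$ which is a prime power $p^\alpha$, $\alpha\ge1$. The graph product of primary cyclic groups $W=W(\Gamma,\mathbf m)$ is the group with generators $V$ and relations $v_i^{\mathbf m(i)}=1$ and $v_jv_k=v_kv_j$ whenever $v_j,v_k$ are adjacent in $\Gamma$. A special subgroup is a subgroup $W(\Delta)$ generated by the vertices of a full subgraph $\Delta$ of $\Gamma$. ''Splits as $A\ast_CB$'' has its usual meaning ($C$ a proper subgroup of both $A$ and $B$). $W$ has isolated flats if there is a geometric action (properly discontinuous, cocompact, by isometries) of $W$ on a CAT(0) space $X$ with isolated flats in the sense of Hruska and Kleiner: writing ''flat'' for an isometrically embedded copy of a Euclidean space of dimension at least $2$, there is a $W$-invariant collection $\mathcal F$ of flats in $X$ such that (A) there is a constant $D$ such that each flat in $X$ lies in the $D$-neighbourhood of some member of $\mathcal F$; and (B) for each $\rho>0$ there is $\kappa(\rho)$ such that for any two distinct $F,F'\in\mathcal F$ the intersection of their $\rho$-neighbourhoods has diameter at most $\kappa(\rho)$. *)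

(* Defs.v *)
From HB Require Import structures.
From Stdlib Require Import Relation_Operators.
From mathcomp Require Import all_boot all_order all_algebra.
From mathcomp Require Import all_classical all_reals.
From mathcomp Require Import topology.

Set Implicit Arguments.
Unset Strict Implicit.
Unset Printing Implicit Defensive.

Import Order.TTheory GRing.Theory Num.Theory.

Local Open Scope quotient_scope.
Local Open Scope classical_set_scope.

Section Presentation.
Variable X : choiceType.

(* The letter (x, true) stands for x and (x, false) for its inverse. *)
Definition word := seq (X * bool).

Implicit Types (u v w : word).

Definition word_inv w : word := rev [seq (l.1, ~~ l.2) | l <- w].

Variable rels : set (word * word).

(* The least congruence on words containing free cancellation and rels. *)
Inductive pres_eq : word -> word -> Prop :=
| pres_eq_refl w : pres_eq w w
| pres_eq_sym u v : pres_eq u v -> pres_eq v u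
| pres_eq_trans u v w : pres_eq u v -> pres_eq v w -> pres_eq u w
| pres_eq_cat u u' v v' :
    pres_eq u u' -> pres_eq v v' -> pres_eq (u ++ v) (u' ++ v')
| pres_eq_cancel x b : pres_eq [:: (x, b); (x, ~~ b)] [::]
| pres_eq_rel u v : rels (u, v) -> pres_eq u v.

Definition pres_eqb : rel word := fun u v => `[< pres_eq u v >].

Lemma pres_eqb_refl : reflexive pres_eqb.
Proof. by move=> w; apply/asboolP; exact: pres_eq_refl. Qed.

Lemma pres_eqb_sym : symmetric pres_eqb.
Proof.
by move=> u v; apply/asboolP/asboolP => uv; exact: pres_eq_sym.
Qed.

Lemma pres_eqb_trans : transitive pres_eqb.
Proof.
move=> v u w /asboolP uv /asboolP vw; apply/asboolP.
exact: pres_eq_trans uv vw.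
Qed.

Canonical pres_equiv := EquivRel pres_eqb pres_eqb_refl pres_eqb_sym
  pres_eqb_trans.

Definition pres_group := {eq_quot pres_equiv}.

HB.instance Definition _ := EqQuotient.on pres_group.
HB.instance Definition _ := Choice.on pres_group.

Definition pres_class w : pres_group := \pi_(pres_group) w.

Lemma pres_classP u v : pres_class u = pres_class v <-> pres_eq u v.
Proof.
rewrite /pres_class; split=> [/eqmodP/asboolP//|uv].
by apply/eqmodP/asboolP.
Qed.

Lemma pres_repr w : pres_eq (repr (pres_class w)) w.
Proof. by apply/pres_classP; rewrite /pres_class reprK. Qed.

Lemma pres_class_repr (x : pres_group) : pres_class (repr x) = x.
Proof. exact: reprK. Qed.

Lemma word_inv_cat u v : word_inv (u ++ v) = word_inv v ++ word_inv u.
Proof. by rewrite /word_inv map_cat rev_cat. Qed.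

Lemma word_invK : involutive word_inv.
Proof.
move=> w; rewrite /word_inv map_rev revK -map_comp map_id_in//.
by move=> [x b] _ /=; rewrite negbK.
Qed.

Lemma pres_eq_mulV w : pres_eq (w ++ word_inv w) [::].
Proof.
elim: w => [|[x b] w IHw]; first exact: pres_eq_refl.
rewrite -cat1s word_inv_cat -!catA.
apply: pres_eq_trans (pres_eq_cancel x b); rewrite -[in X in pres_eq _ X]cat1s.
apply: pres_eq_cat; first exact: pres_eq_refl.
rewrite catA -[in X in pres_eq _ X](cat0s [:: _]).
by apply: pres_eq_cat => //; exact: pres_eq_refl.
Qed.

Lemma pres_eq_Vmul w : pres_eq (word_inv w ++ w) [::].
Proof. by rewrite -{2}(word_invK w); exact: pres_eq_mulV. Qed.

Lemma pres_eq_inv u v : pres_eq u v -> pres_eq (word_inv u) (word_inv v).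
Proof.
move=> uv; rewrite -[word_inv u]cats0.
apply: (@pres_eq_trans _ (word_inv u ++ (v ++ word_inv v))).
  apply: pres_eq_cat (pres_eq_refl _) _; exact/pres_eq_sym/pres_eq_mulV.
rewrite catA -[X in pres_eq _ X]cat0s.
apply: pres_eq_cat (pres_eq_refl _).
apply: pres_eq_trans (pres_eq_Vmul u).
by apply: pres_eq_cat (pres_eq_refl _) _; exact: pres_eq_sym.
Qed.

Definition pres_one : pres_group := pres_class [::].
Definition pres_mul (x y : pres_group) : pres_group :=
  pres_class (repr x ++ repr y).
Definition pres_inv (x : pres_group) : pres_group :=
  pres_class (word_inv (repr x)).

Lemma pres_mulE u v :
  pres_mul (pres_class u) (pres_class v) = pres_class (u ++ v).
Proof. by apply/pres_classP; apply: pres_eq_cat; exact: pres_repr. Qed.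

Lemma pres_invE u : pres_inv (pres_class u) = pres_class (word_inv u).
Proof. by apply/pres_classP; apply: pres_eq_inv; exact: pres_repr. Qed.

Lemma pres_mulA : associative pres_mul.
Proof.
move=> x y z.
rewrite -(pres_class_repr x) -(pres_class_repr y) -(pres_class_repr z).
by rewrite !pres_mulE catA.
Qed.

Lemma pres_mul1 : left_id pres_one pres_mul.
Proof. by move=> x; rewrite -(pres_class_repr x) pres_mulE. Qed.

Lemma pres_mulr1 : right_id pres_one pres_mul.
Proof. by move=> x; rewrite -(pres_class_repr x) pres_mulE cats0. Qed.

Lemma pres_mulV : left_inverse pres_one pres_inv pres_mul.
Proof.
move=> x; rewrite -(pres_class_repr x) pres_invE pres_mulE.
by apply/pres_classP; exact: pres_eq_Vmul.
Qed.

Lemma pres_mulrV : right_inverse pres_one pres_inv pres_mul.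
Proof.
move=> x; rewrite -(pres_class_repr x) pres_invE pres_mulE.
by apply/pres_classP; exact: pres_eq_mulV.
Qed.

HB.instance Definition _ := isGroup.Build pres_group
  pres_mulA pres_mul1 pres_mulr1 pres_mulV pres_mulrV.

Definition pres_gen (x : X) : pres_group := pres_class [:: (x, true)].

End Presentation.

Section Groups.
Variable G : groupType.
Implicit Types (A B C K S : set G).
Local Open Scope group_scope.

Definition is_subgroup A :=
  [/\ A 1, forall x y, A x -> A y -> A (x * y) & forall x, A x -> A x^-1].

Definition generated S : set G := smallest is_subgroup S.

Definition Aut : set (G -> G) :=
  [set phi | bijective phi /\ {morph phi : x y / x * y}].

Definition Inn : set (G -> G) :=
  [set phi | exists g, phi = fun x => g * x * g^-1].

Definition Out : set (set (G -> G)) :=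
  [set [set phi \o iota | iota in Inn] | phi in Aut].

Definition left_coset x A : set G := [set x * a | a in A].

Definition virtually_abelian A :=
  exists B, [/\ is_subgroup B, B `<=` A,
    forall x y, B x -> B y -> x * y = y * x &
    finite_set [set left_coset x B | x in A]].

Definition cayley_adj S (x y : G) :=
  exists2 s, S s & y = x * s \/ x = y * s.

(* The vertex set of the connected component of x in the Cayley graph
   with the vertices in K deleted. *)
Definition cayley_component S K (x : G) : set G :=
  [set y | clos_refl_trans G
     (fun a b => [/\ ~ K a, ~ K b & cayley_adj S a b]) x y].

(* Not depending on the finite generating set, which is hence quantified
   existentially. *)
Definition one_ended :=
  exists S, [/\ finite_set S, generated S = setT &
    forall K, finite_set K ->
      exists! U : set G, infinite_set U /\
        exists2 x, ~ K x & U = cayley_component S K x].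

(* The universal property of A *_C B, as the pushout of the inclusions of C
   in A and in B, for G. *)
Definition is_amalgam A B C :=
  [/\ is_subgroup A, is_subgroup B, is_subgroup C, C `<=` A /\ C `<=` B &
    forall (H : groupType) (f g : G -> H),
      (forall x y, A x -> A y -> f (x * y) = f x * f y) ->
      (forall x y, B x -> B y -> g (x * y) = g x * g y) ->
      (forall x, C x -> f x = g x) ->
      exists! h : G -> H,
        [/\ {morph h : x y / x * y},
            forall x, A x -> h x = f x &
            forall x, B x -> h x = g x]].

Definition splits_as A B C := [/\ is_amalgam A B C, C `<` A & C `<` B].

End Groups.

Arguments Aut : clear implicits.
Arguments Inn : clear implicits.
Arguments Out : clear implicits.

Section Metric.
Variable R : realType.
Local Open Scope ring_scope.

(* The library's norm on matrices is the sup norm. *)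
Definition edist n (u v : 'rV[R]_n) : R :=
  Num.sqrt (\sum_(i < n) (u ord0 i - v ord0 i) ^+ 2).

Variable X : metricType R.
Implicit Types (F : set X).

Definition geodesic (x y : X) (c : R -> X) :=
  [/\ c 0 = x, c (mdist x y) = y &
    forall s t, 0 <= s <= mdist x y -> 0 <= t <= mdist x y ->
      mdist (c s) (c t) = `|s - t|].

(* Side i of a triangle with vertices p joins p i to p (ordS i), where
   ordS is the cyclic successor. *)
Definition geodesic_triangle (p : 'I_3 -> X) (c : 'I_3 -> R -> X) :=
  forall i, geodesic (p i) (p (ordS i)) (c i).

Definition comparison_triangle (p : 'I_3 -> X) (q : 'I_3 -> 'rV[R]_2) :=
  forall i j, edist (q i) (q j) = mdist (p i) (p j).

(* u is the point at distance s from q i on side i of the Euclidean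
   triangle q. *)
Definition comparison_point (q : 'I_3 -> 'rV[R]_2) (i : 'I_3) (s : R)
    (u : 'rV[R]_2) :=
  edist (q i) u = s /\
  exists2 k : R, 0 <= k <= 1 & u = (1 - k) *: q i + k *: q (ordS i).

Definition CAT0 :=
  (forall x y : X, exists c, geodesic x y c) /\
  forall p c q, geodesic_triangle p c -> comparison_triangle p q ->
    forall (i j : 'I_3) (s t : R) (u v : 'rV[R]_2),
      0 <= s <= mdist (p i) (p (ordS i)) ->
      0 <= t <= mdist (p j) (p (ordS j)) ->
      comparison_point q i s u -> comparison_point q j t v ->
      mdist (c i s) (c j t) <= edist u v.

Definition flat F :=
  exists n (f : 'rV[R]_n -> X),
    [/\ (2 <= n)%N, forall u v, mdist (f u) (f v) = edist u v & F = range f].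

Definition neighbourhood (rho : R) F : set X :=
  [set x | exists2 y, F y & mdist x y < rho].

Variable G : groupType.

Definition is_action (act : G -> X -> X) :=
  (forall x, act 1%g x = x) /\
  (forall g h x, act (g * h)%g x = act g (act h x)).

Definition properly_discontinuous (act : G -> X -> X) :=
  forall K : set X, compact K -> finite_set [set g | act g @` K `&` K !=set0].

Definition cocompact (act : G -> X -> X) :=
  exists2 K : set X, compact K & \bigcup_g (act g @` K) = setT.

Definition geometric_action (act : G -> X -> X) :=
  [/\ is_action act, forall g x y, mdist (act g x) (act g y) = mdist x y,
      properly_discontinuous act & cocompact act].

Definition isolated_flats (act : G -> X -> X) :=
  exists FF : set (set X),
    [/\ FF `<=` flat,
        forall g F, FF F -> FF (act g @` F),
        exists D : R, forall F, flat F ->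
          exists2 F', FF F' & F `<=` neighbourhood D F' &
        forall rho : R, 0 < rho -> exists kappa : R,
          forall F F', FF F -> FF F' -> F <> F' ->
            forall x y,
              (neighbourhood rho F `&` neighbourhood rho F') x ->
              (neighbourhood rho F `&` neighbourhood rho F') y ->
              mdist x y <= kappa].

End Metric.

(* Every group acts geometrically on the empty space, so X has a point. *)
Definition has_isolated_flats (R : realType) (G : groupType) :=
  exists (X : metricType R) (act : G -> X -> X),
    [/\ inhabited X, CAT0 X, geometric_action act & isolated_flats act].

Section GraphProduct.
Variables (V : finType) (e : rel V) (m : V -> nat).

Definition graph_product_rels : set (word V * word V) :=
  [set (nseq (m v) (v, true), [::]) | v in setT] `|`
  [set ([:: (jk.1, true); (jk.2, true)], [:: (jk.2, true); (jk.1, true)])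
    | jk in [set jk | e jk.1 jk.2]].

Definition graph_product : groupType := pres_group graph_product_rels.

Definition special_subgroup (D : {set V}) : set graph_product :=
  generated [set pres_gen graph_product_rels v | v in [set` D]].

End GraphProduct.

Arguments special_subgroup {V} e m D.

Definition prime_power (n : nat) :=
  exists p a, [/\ prime p, (0 < a)%N & n = (p ^ a)%N].

(* Main.v *)
From Stdlib Require Import Relation_Operators.
Require Import Defs.
From mathcomp Require Import all_boot all_order all_algebra.
From mathcomp Require Import all_classical all_reals.
From mathcomp Require Import topology.
From mathcomp Require Import zify lra.

(* If Out W is infinite, some nonadjacent v and w have a common link C whose
   complement has a component avoiding v and w: otherwise every automorphism
   mapping each generator to a conjugate becomes inner after composition with
   one of finitely many products of partial conjugations, and such
   automorphisms have finite index in Aut W because W, which acts geometrically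
   on a CAT(0) space, has finitely many conjugacy classes of torsion elements.
   The component splits W over W(C), and C is not a clique as W is one-ended.
   Finally W(C) commutes with the element vw of infinite order. For c in W(C)
   of infinite order, vw and c span a flat; isolation makes the whole of W(C)
   preserve one flat near it. By polynomial growth W(C) contains no free
   monoid, which forces it to be a product of finite cyclic and infinite
   dihedral groups.

   The combinatorics of W rests on cocycles instead of normal forms: for a
   vertex v the function sector v on W, with values in Z/m(v), changes under
   right multiplication by a generator s only if s = v and the argument lies in
   W(star v). *)

Set Implicit Arguments.
Unset Strict Implicit.
Unset Printing Implicit Defensive.

Import Order.TTheory GRing.Theory Num.Theory.

Local Open Scope classical_set_scope.


(** * Graph products *)

(** [W] is a quotient of words, so its elements can be told apart only by letting [W] act on sets.
    Homomorphisms, sectors and the sides of a splitting all arise from one criterion for such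
    actions, and an element all of whose sectors vanish is trivial. An automorphism mapping
    generators to conjugates moves the wall of each v to a coset of W(star v). It is inner once, for
    each v, the walls of all vertices outside star v lie in one piece of the wall of v. A partial
    conjugation by powers of v achieves this at v. It does no harm at v' because a vertex outside
    both stars is joined to v' off star v or to v off star v'; a failure of this dichotomy is a
    separating link. The space X is not known to be proper. Finiteness is therefore propagated along
    geodesics, and curvature enters only through an inequality at midpoints. *)

Section GroupLemmas.
Variable G : groupType.
Implicit Types (S T : set G) (x y z : G).
Local Open Scope group_scope.

Lemma sub_generated S : S `<=` generated S.
Proof. by move=> x Sx T [_ ST]; apply: ST. Qed.

Lemma generated_subgroup S : is_subgroup (generated S).
Proof.
split=> [T [[]]//|x y Sx Sy T TS|x Sx T TS].
- by have [[_ TM _] _] := TS; apply: TM; [apply: Sx|apply: Sy].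
- by have [[_ _ TV] _] := TS; apply: TV; apply: Sx.
Qed.

Lemma generated_min S T : is_subgroup T -> S `<=` T -> generated S `<=` T.
Proof. by move=> Tg ST x; apply. Qed.

Lemma subgroupX T x n : is_subgroup T -> T x -> T (x ^+ n).
Proof.
move=> [T1 TM _] Tx; elim: n => [|n IHn]; first by rewrite expg0.
by rewrite expgS; apply: TM.
Qed.

Lemma subgroup_mull T x y : is_subgroup T -> T x -> T (x * y) <-> T y.
Proof.
move=> [_ TM TV] Tx; split=> [Txy|]; last exact: TM.
by rewrite -(mulKg x y); apply: TM => //; apply: TV.
Qed.

Lemma subgroup_mulr T x y : is_subgroup T -> T y -> T (x * y) <-> T x.
Proof.
move=> [_ TM TV] Ty; split=> [Txy|Tx]; last exact: TM.
by rewrite -(mulgK y x); apply: TM => //; apply: TV.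
Qed.

End GroupLemmas.

Section Morphisms.
Variables (G H : groupType) (h : G -> H).
Local Open Scope group_scope.
Hypothesis hM : {morph h : x y / x * y}.

Lemma morph_g1 : h 1 = 1.
Proof. by apply: (@mulgI _ (h 1)); rewrite -hM !mulg1. Qed.

Lemma morph_gV x : h x^-1 = (h x)^-1.
Proof. by apply: (@mulgI _ (h x)); rewrite -hM !mulgV morph_g1. Qed.

Lemma morph_gX x n : h (x ^+ n) = h x ^+ n.
Proof.
elim: n => [|n IHn]; first by rewrite !expg0 morph_g1.
by rewrite !expgS hM IHn.
Qed.

End Morphisms.

Section GraphProductBasics.
Variables (V : finType) (e : rel V) (m : V -> nat).
Hypothesis m_gt1 : forall v, (1 < m v)%N.
Local Open Scope group_scope.

Notation W := (graph_product e m).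
Notation gen := (pres_gen (graph_product_rels e m)).
Notation rels := (graph_product_rels e m).
Implicit Types (g h x y z : W).

Lemma pres_class_cat (u v : word V) :
  pres_class rels (u ++ v) = pres_class rels u * pres_class rels v :> W.
Proof. exact/esym/pres_mulE. Qed.

Lemma gen_nseq v n : gen v ^+ n = pres_class rels (nseq n (v, true)) :> W.
Proof.
elim: n => [|n IHn]; first exact: erefl.
by rewrite expgS IHn -pres_class_cat.
Qed.

Lemma gen_order v : gen v ^+ m v = 1 :> W.
Proof.
rewrite gen_nseq; apply/pres_classP/pres_eq_rel; left; by exists v.
Qed.

Lemma gen_commute u v : e u v -> gen u * gen v = gen v * gen u :> W.
Proof.
move=> uv; rewrite -!pres_class_cat; apply/pres_classP/pres_eq_rel; right.
by exists (u, v).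
Qed.

Lemma gen_inv v : (gen v)^-1 = gen v ^+ (m v).-1 :> W.
Proof.
apply: mulg1_eq; rewrite -expgS prednK ?gen_order//.
exact: ltn_trans (m_gt1 v).
Qed.

Lemma gen_false v : pres_class rels [:: (v, false)] = (gen v)^-1 :> W.
Proof. exact/esym/pres_invE. Qed.

Lemma graph_product_ind (P : W -> Prop) :
  P 1 -> (forall x v, P x -> P (x * gen v)) -> forall x, P x.
Proof.
move=> P1 PM x; rewrite -(pres_class_repr x); move: (repr x) => w.
have PX y v n : P y -> P (y * gen v ^+ n).
  move=> Py; elim: n => [|n IHn]; first by rewrite expg0 mulg1.
  by rewrite expgSr mulgA; apply: PM.
elim/last_ind: w => [//|w [v b] IHw].
rewrite -cats1 pres_class_cat; case: b; first exact: PM.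
by rewrite gen_false gen_inv; apply: PX.
Qed.

(** An inverse letter acts as the [(m v).-1]-st iterate of [op v], so all words act and congruent
    words act alike. Words are read from the left, which makes this a right action. *)
Lemma graph_product_action (S : Type) (op : V -> S -> S) :
  (forall v s, iter (m v) (op v) s = s) ->
  (forall u v s, e u v -> op v (op u s) = op u (op v s)) ->
  exists R : W -> S -> S,
    [/\ forall s, R 1 s = s, forall x y s, R (x * y) s = R y (R x s) &
        forall v s, R (gen v) s = op v s].
Proof.
move=> opm opC.
pose lop (l : V * bool) := if l.2 then op l.1 else iter (m l.1).-1 (op l.1).
pose F (w : word V) s := foldl (fun s l => lop l s) s w.
have Fcat u v s : F (u ++ v) s = F v (F u s) by rewrite /F foldl_cat.
have m_gt0 v : (0 < m v)%N by apply: ltn_trans (m_gt1 v).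
have FE u v : pres_eq rels u v -> forall s, F u s = F v s.
  elim=> {u v} [w|u v _ IH|u v w _ IH1 _ IH2|u u' v v' _ IH1 _ IH2|v b|u v uv] s.
  - by [].
  - by rewrite IH.
  - by rewrite IH1.
  - by rewrite !Fcat IH1 IH2.
  - by case: b; rewrite /F /lop /= -?iterS -?iterSr prednK.
  - case: uv => [[v' _]|[[j k] /= jk]] [<- <-].
      rewrite -[RHS](opm v'); elim: (m v') s => [//|n IHn] s.
      by rewrite iterSr /= -IHn.
    exact: opC.
exists (fun x s => F (repr x) s); split.
- by move=> s; rewrite (FE _ _ (pres_repr rels [::])).
- by move=> x y s; rewrite (FE _ _ (pres_repr rels _)) Fcat.
- by move=> v s; rewrite (FE _ _ (pres_repr rels [:: (v, true)])).
Qed.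

Lemma graph_product_lift (H : groupType) (j : V -> H) :
  (forall v, j v ^+ m v = 1) ->
  (forall u v, e u v -> j u * j v = j v * j u) ->
  exists h : W -> H, {morph h : x y / x * y} /\ forall v, h (gen v) = j v.
Proof.
move=> jm jC.
have [||R [R1 RM Rg]] := @graph_product_action H (fun v s => s * j v).
- move=> v s; rewrite -[RHS]mulg1 -(jm v).
  elim: (m v) s => [|n IHn] s; first by rewrite expg0 mulg1.
  by rewrite iterSr IHn expgS mulgA.
- by move=> u v s uv; rewrite -!mulgA jC.
have RE x s : R x s = s * R x 1.
  elim/graph_product_ind: x s => [|x v IH] s; first by rewrite !R1 mulg1.
  by rewrite !RM !Rg IH mulgA.
exists (fun x => R x 1); split=> [x y|v]; first by rewrite RM RE.
by rewrite Rg mul1g.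
Qed.

Lemma morph_gen_ext (H : groupType) (h h' : W -> H) :
  {morph h : x y / x * y} -> {morph h' : x y / x * y} ->
  (forall v, h (gen v) = h' (gen v)) -> h = h'.
Proof.
move=> hM h'M hh'; apply/funext; elim/graph_product_ind => [|x v IH].
  by rewrite !morph_g1.
by rewrite hM h'M IH hh'.
Qed.

Notation special := (special_subgroup e m).

Lemma special_is_subgroup D : is_subgroup (special D).
Proof. exact: generated_subgroup. Qed.

Lemma special1 D : special D 1.
Proof. by have [] := special_is_subgroup D. Qed.

Lemma specialM D x y : special D x -> special D y -> special D (x * y).
Proof. by have [_ + _] := special_is_subgroup D; apply. Qed.

Lemma specialV D x : special D x -> special D x^-1.
Proof. by have [_ _] := special_is_subgroup D; apply. Qed.

Lemma specialX D x n : special D x -> special D (x ^+ n).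
Proof. by apply: subgroupX; exact: special_is_subgroup. Qed.

Lemma special_gen (D : {set V}) v : v \in D -> special D (gen v).
Proof. by move=> Dv; apply: sub_generated; exists v. Qed.

Lemma specialS (D D' : {set V}) : D \subset D' -> special D `<=` special D'.
Proof.
move=> /fintype.subsetP DD'; apply: generated_min.
  exact: special_is_subgroup.
by move=> _ [v /DD' vD' <-]; apply: special_gen.
Qed.

Lemma special_ind (D : {set V}) (P : W -> Prop) :
  P 1 -> (forall x v, special D x -> v \in D -> P x -> P (x * gen v)) ->
  forall x, special D x -> P x.
Proof.
move=> P1 PM.
have PX x v n : special D x -> v \in D -> P x -> P (x * gen v ^+ n).
  move=> Dx Dv Px; elim: n => [|n IHn]; first by rewrite expg0 mulg1.
  rewrite expgSr mulgA; apply: PM => //; apply: specialM => //.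
  by apply: specialX; exact: special_gen.
suff sub : special D `<=` [set x | special D x /\
    forall y, special D y -> P y -> P (y * x)].
  by move=> x /sub[_] /(_ 1); rewrite mul1g; apply=> //; exact: special1.
(* A subgroup is closed under inverses, so right multiplication by both [x] and [x^-1] has to
   preserve [P]. *)
pose Q := [set x | special D x /\
    ((forall y, special D y -> P y -> P (y * x)) /\
    forall y, special D y -> P y -> P (y * x^-1))].
suff sub : special D `<=` Q by move=> x /sub[? []].
apply: generated_min.
  split=> [|x y [Dx [Px PVx]] [Dy [Py PVy]]|x [Dx [Px PVx]]].
  - by split; [exact: special1|split=> y Dy; rewrite ?invg1 mulg1].
  - split; first exact: specialM.
    split=> z Dz Pz; rewrite ?invgM mulgA.
      by apply: Py; [exact: specialM|exact: Px].
    by apply: PVx; [apply: specialM => //; exact: specialV|exact: PVy].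
  - by split; [exact: specialV|rewrite invgK].
move=> _ [v Dv <-]; split; first exact: special_gen.
by split=> y Dy Py; [exact: PM|rewrite gen_inv; exact: PX].
Qed.

Lemma retraction (D : {set V}) : exists r : W -> W,
  [/\ {morph r : x y / x * y}, forall v, v \in D -> r (gen v) = gen v,
      forall v, v \notin D -> r (gen v) = 1, forall x, special D (r x) &
      forall x, special D x -> r x = x].
Proof.
pose j v := if v \in D then gen v else 1 : W.
have [||r [rM rg]] := @graph_product_lift W j.
- by move=> v; rewrite /j; case: ifP; rewrite ?expg1n ?gen_order.
- move=> u v uv; rewrite /j; case: ifP; case: ifP; rewrite ?mulg1 ?mul1g//.
  by rewrite gen_commute.
have rD v : v \in D -> r (gen v) = gen v by rewrite rg /j => ->.
exists r; split=> // [v /negbTE vD|x|x]; first by rewrite rg /j vD.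
  elim/graph_product_ind: x => [|x v IH].
    by rewrite (morph_g1 rM); exact: special1.
  rewrite rM; apply: specialM => //; rewrite rg /j.
  by case: ifP => vD; [exact: special_gen|exact: special1].
elim/special_ind => [|y v _ vD IH]; first exact: morph_g1.
by rewrite rM IH rD.
Qed.

Lemma special_commute (D D' : {set V}) x y :
  (forall u v, u \in D -> v \in D' -> e u v || (u == v)) ->
  special D x -> special D' y -> commute x y.
Proof.
move=> DD' Dx D'y; elim/special_ind: x / Dx => [|x u _ uD IH].
  exact/commute_sym/commute1.
apply/commute_sym/commuteM; first exact/commute_sym.
elim/special_ind: y / D'y {IH} => [|y v _ vD IH].
  exact/commute_sym/commute1.
apply/commute_sym/commuteM; first exact/commute_sym.
by have /orP[/gen_commute//|/eqP->] := DD' u v uD vD.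
Qed.

End GraphProductBasics.

(** * Sectors of the walls of a graph product *)

Section Sectors.
Variables (V : finType) (e : rel V) (m : V -> nat).
Hypothesis e_irr : irreflexive e.
Hypothesis e_sym : symmetric e.
Hypothesis m_gt1 : forall v, (1 < m v)%N.
Local Open Scope group_scope.

Notation W := (graph_product e m).
Notation gen := (pres_gen (graph_product_rels e m)).
Notation special := (special_subgroup e m).
Implicit Types (g h x y z : W) (u v : V).

Definition star v : {set V} := [set u | (u == v) || e v u].

Lemma star_self v : v \in star v. Proof. by rewrite inE eqxx. Qed.

Lemma star_sym u v : (u \in star v) = (v \in star u).
Proof. by rewrite !inE eq_sym e_sym. Qed.

Lemma star_commute v x : special (star v) x -> commute x (gen v).
Proof.
move=> vx; apply: (@special_commute _ _ _ m_gt1 (star v) [set v]) => //.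
  by move=> u w; rewrite !inE => /orP[/eqP-> /eqP->|vu /eqP->];
    rewrite ?eqxx ?orbT// e_sym vu.
by apply: special_gen; rewrite inE.
Qed.

(* Removing the wall W(star v) cuts the Cayley graph into m v pieces, numbered
   by sector v: the edge from x to x * gen u joins two different pieces only if
   u is v and x lies on the wall. *)
Definition sector v : W -> 'Z_(m v) := xget (fun=> 0%R) [set f : W -> 'Z_(m v) |
  f 1 = 0%R /\ forall x u, f (x * gen u) =
    (f x + (if (u == v) && `[< special (star v) x >] then 1 else 0))%R].

Lemma natr_order v : ((m v)%:R = 0 :> 'Z_(m v))%R.
Proof. by apply/val_inj; rewrite /= val_Zp_nat// modnn. Qed.

(** Existence: [W] acts on pairs of an element and a running count of crossings. Right
    multiplication by a generator in [star v] keeps the element on or off the wall. Hence [m v]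
    steps along [v] add [m v] times the same 0 or 1, and commuting generators add the same in either
    order. *)
Lemma sector_spec v : sector v 1 = 0%R /\ forall x u, sector v (x * gen u) =
    (sector v x + (if (u == v) && `[< special (star v) x >] then 1 else 0))%R.
Proof.
rewrite /sector; case: xgetP => [f _ //|] nof; exfalso.
pose d u (x : W) : 'Z_(m v) :=
  (if (u == v) && `[< special (star v) x >] then 1 else 0)%R.
pose op u (s : W * 'Z_(m v)) := (s.1 * gen u, (s.2 + d u s.1)%R).
have dM u w x : u \in star v -> d w (x * gen u) = d w x.
  move=> uv; rewrite /d; congr (if (w == v) && _ then _ else _).
  apply/asboolP/asboolP => vx; last first.
    by apply: specialM => //; exact: special_gen.
  rewrite -(mulgK (gen u) x); apply: specialM => //; apply: specialV.
  exact: special_gen.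
have dN u x : u != v -> d u x = 0%R by rewrite /d => /negbTE->.
have [||R [R1 RM Rg]] := @graph_product_action _ e _ m_gt1 _ op.
- move=> u [x a]; have opn n : iter n (op u) (x, a) =
      (x * gen u ^+ n, (a + d u x *+ n)%R).
    elim: n => [|n IHn]; first by rewrite expg0 mulg1 addr0.
    rewrite iterS IHn /op /= expgSr mulgA mulrSr addrA; congr (_, (_ + _)%R).
    have [uv|] := eqVneq u v; last by move=> /dN uv; rewrite !uv.
    have {uv} uv : u \in star v by rewrite inE uv eqxx.
    elim: n {IHn} => [|n IHn]; first by rewrite expg0 mulg1.
    by rewrite expgSr mulgA dM.
  rewrite opn gen_order mulg1; congr (_, _).
  have [->|/dN->] := eqVneq u v; last by rewrite mul0rn addr0.
  by rewrite /d; case: ifP; rewrite ?mul0rn ?natr_order addr0.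
- move=> u w [x a] uw; rewrite /op /= -!mulgA (gen_commute _ uw) -!addrA.
  congr (_, (_ + _)%R).
  have [uv|uv] := eqVneq u v.
    rewrite (dM u w); last by rewrite uv star_self.
    have [wv|wv] := eqVneq w v; first by move: uw; rewrite uv wv e_irr.
    by rewrite !(dN w)// addr0 add0r (dM w)// inE -uv uw orbT.
  rewrite !(dN u)// addr0 add0r; have [wv|wv] := eqVneq w v.
    by rewrite (dM u)// inE -wv e_sym uw orbT.
  by rewrite !dN.
pose f x := (R x (1, 0%R)).2.
have R_fst x : (R x (1, 0%R)).1 = x.
  elim/(@graph_product_ind _ e _ m_gt1): x => [|x u IH]; first by rewrite R1.
  by rewrite RM Rg /= IH.
apply: (nof f); split=> [|x u]; first by rewrite /f R1.
by rewrite /f RM Rg /= R_fst.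
Qed.

Lemma sector1 v : sector v 1 = 0%R.
Proof. by have [] := sector_spec v. Qed.

Lemma sectorM_gen v x u : sector v (x * gen u) =
  (sector v x + (if (u == v) && `[< special (star v) x >] then 1 else 0))%R.
Proof. by have [_] := sector_spec v. Qed.

Lemma sectorM_gen_neq v x u : u != v -> sector v (x * gen u) = sector v x.
Proof. by move=> /negbTE uv; rewrite sectorM_gen uv addr0. Qed.

Lemma sectorM_genT v x : special (star v) x ->
  sector v (x * gen v) = (sector v x + 1)%R.
Proof. by move=> vx; rewrite sectorM_gen eqxx asboolT. Qed.

Lemma sectorM_star v x y : special (star v) x ->
  sector v (x * y) = (sector v x + sector v y)%R.
Proof.
move=> vx; elim/(@graph_product_ind _ e _ m_gt1): y => [|y u IH].
  by rewrite mulg1 sector1 addr0.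
rewrite mulgA !sectorM_gen IH addrA.
suff -> : `[< special (star v) (x * y) >] = `[< special (star v) y >] by [].
by apply: asbool_equiv_eq; apply: subgroup_mull => //; exact: special_is_subgroup.
Qed.

Lemma sectorM_special (D : {set V}) v x y : v \notin D -> special D y ->
  sector v (x * y) = sector v x.
Proof.
move=> vD; elim/(@special_ind _ e _ m_gt1) => [|z u _ uD IH]; first by rewrite mulg1.
by rewrite mulgA sectorM_gen_neq ?IH//; apply: contraNneq vD => <-.
Qed.

Lemma sector_special (D : {set V}) v y : v \notin D -> special D y ->
  sector v y = 0%R.
Proof. by move=> vD Dy; rewrite -(mul1g y) (sectorM_special _ vD Dy) sector1. Qed.

Lemma sectorV_star v x : special (star v) x -> sector v x^-1 = (- sector v x)%R.
Proof.
move=> vx; apply/eqP; rewrite -addr_eq0 addrC.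
by rewrite -sectorM_star// mulgV sector1.
Qed.

Definition vpow v (a : 'Z_(m v)) : W := gen v ^+ a.

Lemma expg_modm v n : gen v ^+ (n %% m v) = gen v ^+ n.
Proof.
by rewrite {2}(divn_eq n (m v)) expgnDr mulnC expgnA gen_order expg1n mul1g.
Qed.

Lemma vpow_nat v n : vpow (n%:R%R : 'Z_(m v)) = gen v ^+ n.
Proof. by rewrite /vpow val_Zp_nat// expg_modm. Qed.

Lemma vpow0 v : vpow (0%R : 'Z_(m v)) = 1.
Proof. by []. Qed.

Lemma vpow1 v : vpow (1%R : 'Z_(m v)) = gen v.
Proof. by rewrite -[1%R]/(1%:R%R) vpow_nat expg1. Qed.

Lemma vpowD v (a b : 'Z_(m v)) : vpow (a + b)%R = vpow a * vpow b.
Proof. by rewrite -(natr_Zp a) -(natr_Zp b) -natrD !vpow_nat expgnDr. Qed.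

Lemma vpowN v (a : 'Z_(m v)) : vpow (- a)%R = (vpow a)^-1.
Proof. by apply/esym/mulg1_eq; rewrite -vpowD subrr. Qed.

Lemma special_vpow (D : {set V}) v (a : 'Z_(m v)) : v \in D ->
  special D (vpow a).
Proof. by move=> vD; apply: specialX; exact: special_gen. Qed.

Lemma star_vpow v (a : 'Z_(m v)) : special (star v) (vpow a).
Proof. by apply: special_vpow; exact: star_self. Qed.

Lemma star_commute_vpow v x (a : 'Z_(m v)) :
  special (star v) x -> commute x (vpow a).
Proof. by move=> /star_commute; exact: commuteX. Qed.

Lemma sector_vpow v (a : 'Z_(m v)) : sector v (vpow a) = a.
Proof.
rewrite -[RHS]natr_Zp /vpow; move: (nat_of_ord a) => {a} n.
elim: n => [|n IHn]; first by rewrite expg0 sector1.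
rewrite expgSr sectorM_genT ?IHn ?mulrSr//.
by apply: specialX; apply: special_gen; exact: star_self.
Qed.

Lemma sector_gen v : sector v (gen v) = 1%R.
Proof. by rewrite -vpow1 sector_vpow. Qed.

Lemma oner_neq0_Zm v : (1%R : 'Z_(m v)) != 0%R.
Proof. exact: oner_neq0. Qed.

Lemma sector_vpowM v (a : 'Z_(m v)) x :
  sector v (vpow a * x) = (a + sector v x)%R.
Proof. by rewrite sectorM_star ?sector_vpow//; exact: star_vpow. Qed.

Lemma sectorM_vpow_neq u v (a : 'Z_(m u)) x : u != v ->
  sector v (x * vpow a) = sector v x.
Proof.
move=> uv; apply: (@sectorM_special [set u]); first by rewrite inE eq_sym.
by apply: special_vpow; rewrite inE.
Qed.

Lemma sector_lkM u v x : e u v -> sector v (gen u * x) = sector v x.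
Proof.
move=> uv; rewrite sectorM_star.
  rewrite -[gen u]mul1g sectorM_gen_neq ?sector1 ?add0r//.
  by apply/eqP => uv'; move: uv; rewrite uv' e_irr.
by apply: special_gen; rewrite inE e_sym uv orbT.
Qed.

Lemma sector_lk_vpowM u v (a : 'Z_(m u)) x :
  e u v -> sector v (vpow a * x) = sector v x.
Proof.
rewrite /vpow => uv; elim: (nat_of_ord a) => [|n IHn].
  by rewrite expg0 mul1g.
by rewrite expgS -mulgA sector_lkM.
Qed.

Lemma star_sectorM_vpow v x (a : 'Z_(m v)) : special (star v) x ->
  sector v (x * vpow a) = (sector v x + a)%R.
Proof. by move=> vx; rewrite sectorM_star// sector_vpow. Qed.

Lemma nstar_sectorM_vpow v x (a : 'Z_(m v)) : ~ special (star v) x ->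
  sector v (x * vpow a) = sector v x.
Proof.
rewrite /vpow => vx; elim: (nat_of_ord a) => [|n IHn].
  by rewrite expg0 mulg1.
rewrite expgSr mulgA sectorM_gen eqxx asboolF ?addr0// => vx'; apply: vx.
move: vx'; rewrite subgroup_mulr//; first exact: special_is_subgroup.
by apply: specialX; apply: special_gen; exact: star_self.
Qed.

Lemma centralizer_gen v x : commute x (gen v) -> special (star v) x.
Proof.
move=> xv; apply: contrapT => vx.
have := sectorM_gen v x v; rewrite xv sectorM_star ?sector_gen; last first.
  by apply: special_gen; exact: star_self.
rewrite eqxx asboolF//= addrC => /addrI/eqP.
by rewrite (negbTE (oner_neq0_Zm v)).
Qed.

Lemma sector_cross u v g h x : u \notin star v ->
  sector u (g^-1 * x) = sector u (g^-1 * h) \/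
  sector v (h^-1 * x) = sector v (h^-1 * g).
Proof.
move=> uv; have vu : v \notin star u by rewrite star_sym.
have uv' : u != v by apply: contraNneq uv => ->; rewrite star_self.
rewrite -(mulVKg h x) mulKg (mulgA g^-1 h); move: (h^-1 * x) => y.
elim/(@graph_product_ind _ e _ m_gt1): y => [|y w IH]; first by rewrite mulg1; left.
rewrite mulgA.
have [wu|wu] := eqVneq w u.
  subst w; have [sx|sx] := pselect (special (star u) (g^-1 * h * y)).
    right; rewrite -[y](mulKg (g^-1 * h)) sectorM_gen_neq//.
    by rewrite (sectorM_special _ vu)// invgM invgK.
  case: IH => IH; [left|right]; last by rewrite sectorM_gen_neq.
  by rewrite sectorM_gen (asboolF sx) andbF addr0.
have [wv|wv] := eqVneq w v.
  subst w; have [sx|sx] := pselect (special (star v) y).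
    left; rewrite sectorM_gen_neq 1?eq_sym//.
    by rewrite (sectorM_special _ uv).
  case: IH => IH; [left|right]; first by rewrite sectorM_gen_neq 1?eq_sym.
  by rewrite sectorM_gen (asboolF sx) andbF addr0.
by rewrite !sectorM_gen_neq.
Qed.

Lemma sector_sep u v x : u \notin star v -> sector u x != 0%R -> sector v x = 0%R.
Proof.
move=> uv; have [] := sector_cross 1 1 x uv; rewrite !invg1 !mul1g !sector1 => ->//.
Qed.

End Sectors.

(** * Folding along walls and the triviality criterion *)

Section Folding.
Variables (V : finType) (e : rel V) (m : V -> nat).
Hypothesis e_irr : irreflexive e.
Hypothesis e_sym : symmetric e.
Hypothesis m_gt1 : forall v, (1 < m v)%N.
Local Open Scope group_scope.

Notation W := (graph_product e m).
Notation gen := (pres_gen (graph_product_rels e m)).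
Notation special := (special_subgroup e m).
Notation sector := (@sector V e m).
Notation vpow := (@vpow V e m _).
Notation star := (star e).
Implicit Types (g h x y z : W) (u v : V).

(** Balls for the length in syllables [v^a] instead of letters, because a fold keeps or deletes a
    whole syllable. *)
Fixpoint sball n (x : W) : Prop := if n is k.+1 then
  sball k x \/ exists y v (a : 'Z_(m v)), sball k y /\ x = y * vpow a
  else x = 1.

Lemma sball_leq n k x : (n <= k)%N -> sball n x -> sball k x.
Proof.
move=> /subnK <-; elim: (k - n)%N => [//|d IH] /IH.
by rewrite addSn /=; left.
Qed.

Lemma sball_exists x : exists n, sball n x.
Proof.
elim/(@graph_product_ind _ e _ m_gt1): x => [|x v [n xn]]; first by exists 0.
by exists n.+1; right; exists x, v, 1%R; rewrite vpow1.
Qed.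

Lemma sballSl n x : sball n.+1 x ->
  sball n x \/ exists y v (a : 'Z_(m v)), sball n y /\ x = vpow a * y.
Proof.
elim: n x => [x [->|[_ [v [a [-> ->]]]]]|n IHn x].
- by left.
- by right; exists 1, v, a; rewrite mulg1 mul1g.
- case=> [|[y [v [a [/IHn[yn|[z [w [b [zn ->]]]]] ->]]]]].
  + by left.
  + by left; right; exists y, v, a.
  + right; exists (z * vpow a), w, b; rewrite mulgA; split=> //.
    by right; exists z, v, a.
Qed.

(* Folding W onto the sector 0 of the wall of h v h^-1 shortens the paths
   crossing this wall. *)
Definition fold v h x : W := h * vpow (- sector v (h^-1 * x))%R * h^-1 * x.

(** A syllable that crosses the wall starts on its coset. There it commutes past an element of
    W(star v) and is cancelled by the change of exponent in [fold]. *)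
Lemma fold_step v h x s (a : 'Z_(m s)) :
  (sector v (h^-1 * (x * vpow a)) = sector v (h^-1 * x) /\
   fold v h (x * vpow a) = fold v h x * vpow a) \/
  fold v h (x * vpow a) = fold v h x.
Proof.
have same : sector v (h^-1 * (x * vpow a)) = sector v (h^-1 * x) ->
    fold v h (x * vpow a) = fold v h x * vpow a.
  by rewrite /fold => ->; rewrite !mulgA.
have [sv|sv] := eqVneq s v; last first.
  suff sE : sector v (h^-1 * (x * vpow a)) = sector v (h^-1 * x).
    by left; split => //; exact: same.
  by rewrite mulgA sectorM_vpow_neq.
subst s; have [sx|sx] := pselect (special (star v) (h^-1 * x)); last first.
  suff sE : sector v (h^-1 * (x * vpow a)) = sector v (h^-1 * x).
    by left; split => //; exact: same.
  by rewrite mulgA nstar_sectorM_vpow.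
right; rewrite /fold (mulgA h^-1 x (vpow a)) star_sectorM_vpow// opprD vpowD//.
rewrite -!mulgA; congr (h * _); rewrite (mulgA h^-1 x).
rewrite (star_commute_vpow e_sym m_gt1 a sx) !vpowN//.
by rewrite mulKg.
Qed.

(** The path from [x] to [x * y] is folded syllable by syllable. If its ends lie in different
    sectors, some syllable crosses the wall and disappears. *)
Lemma fold_sball v h n x y : sball n y ->
  sball n ((fold v h x)^-1 * fold v h (x * y)) /\
  (sector v (h^-1 * x) <> sector v (h^-1 * (x * y)) ->
   sball n.-1 ((fold v h x)^-1 * fold v h (x * y))).
Proof.
elim: n y => [y ->|n IHn y]; first by rewrite mulg1 mulVg; split.
case=> [/IHn[yn xyn]|].
  by split=> [|/xyn]; [left|apply: sball_leq; exact: leq_pred].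
case=> [z [s [a [zn ->]]]]; have [xzn xzn'] := IHn _ zn; rewrite (mulgA x z).
have [[sE ->]|->] := fold_step v h (x * z) a; last by split => [|_]; [left|].
rewrite sE mulgA; split=> [|xz].
  by right; exists ((fold v h x)^-1 * fold v h (x * z)), s, a.
case: n {IHn xzn} zn xzn' => [/= z1|n zn /(_ xz) xzn].
  by case: xz; rewrite z1 mulg1.
by right; exists ((fold v h x)^-1 * fold v h (x * z)), s, a.
Qed.

Lemma fold_id v h x : sector v (h^-1 * x) = 0%R -> fold v h x = x.
Proof. by rewrite /fold => ->; rewrite oppr0 vpow0 mulg1 mulgV mul1g. Qed.

Lemma sball_reduce v n x : sball n x -> sector v x <> 0%R ->
  sball n.-1 (vpow (- sector v x)%R * x).
Proof.
move=> xn vx; have [_] := fold_sball v 1 1 xn.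
rewrite !mul1g invg1 !mul1g sector1// fold_id ?mulg1 ?invg1 ?sector1//.
by rewrite /fold invg1 !mul1g mulg1; apply => /esym.
Qed.

(** This replaces the uniqueness of normal forms. If [x = v^a y] has sector 0 at [v], then [a] is
    minus the sector of [y]; so [x] is [y] itself or the fold of [y], which is shorter. *)
Lemma sector_eq0 x : (forall v, sector v x = 0%R) -> x = 1.
Proof.
have [n] := sball_exists x; elim/ltn_ind: n x => -[_ x ->//|n IHn x].
move=> /sballSl[xn|[y [v [a [yn ->]]]]] x0; first exact: (IHn n).
have [yv|/eqP yv] := eqVneq (sector v y) 0%R.
  have := x0 v; rewrite sector_vpowM// yv addr0 => a0.
  rewrite a0 vpow0 mul1g; apply: (IHn n) => // w.
  by have := x0 w; rewrite a0 vpow0 mul1g.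
have := x0 v; rewrite sector_vpowM// => /eqP; rewrite addr_eq0 => /eqP aE.
have := sball_reduce yn yv; rewrite -aE => ayn.
by apply: (IHn n.-1) => //; rewrite ltnS leq_pred.
Qed.

(* Reduced factorisations: the syllable v^a cannot be merged with y. *)
Lemma sball_split n x : sball n x -> x <> 1 -> exists y v (a : 'Z_(m v)),
  [/\ sball n.-1 y, a != 0%R, sector v y = 0%R & x = vpow a * y].
Proof.
move=> xn x1; have [v vx] : exists v, sector v x <> 0%R.
  by apply: contrapT => nx; apply/x1/sector_eq0 => v; apply: contrapT => vx;
    apply: nx; exists v.
exists (vpow (- sector v x)%R * x), v, (sector v x); split.
- exact: sball_reduce.
- exact/eqP.
- by rewrite sector_vpowM// addrC subrr.
- by rewrite vpowN// mulVKg.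
Qed.

(* The walls of two commuting conjugates of adjacent vertices cross. *)
Lemma crossing u v g h : e u v ->
  commute (g * gen u * g^-1) (h * gen v * h^-1) ->
  exists x, special (star u) (g^-1 * x) /\ special (star v) (h^-1 * x).
Proof.
move=> uv C; pose a := h^-1 * (g * gen u * g^-1) * h.
have av : special (star v) a.
  apply: centralizer_gen => //; rewrite /commute /a.
  move: C; set A := g * _ * _ => C; apply: (@mulgI _ h).
  apply: (@mulIg _ h^-1); move: C; rewrite /commute !mulgA mulgV mul1g => ->.
  by rewrite mulgK.
have [r [rM rin _ rs rid]] := @retraction V e m m_gt1 (star v).
(* Both [a] and [gen u] lie in W(star v), so retracting [h^-1 * g] to this subgroup does not change
   the conjugate [a] of [gen u]. *)
pose k := r (h^-1 * g); exists (h * k); split; last by rewrite mulKg; exact: rs.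
have ru : r (gen u) = gen u by apply: rin; rewrite inE e_sym uv orbT.
have aE : a = k * gen u * k^-1.
  rewrite -(rid _ av); have -> : a = (h^-1 * g) * gen u * (h^-1 * g)^-1.
    by rewrite /a invgM invgK !mulgA.
  by rewrite rM (rM _ (gen u)) ru (morph_gV rM).
apply: centralizer_gen => //.
have : h * a * h^-1 = g * gen u * g^-1 by rewrite /a !mulgA mulgV mul1g mulgK.
rewrite aE => E; rewrite /commute.
apply: (@mulgI _ g); apply: (@mulIg _ (h * k)^-1).
by rewrite !mulgA mulgV mul1g -(mulgA _ h k) mulgK; move: E; rewrite invgM !mulgA => ->.
Qed.

End Folding.

(** * Conjugating automorphisms *)

Section ConjugatingAutomorphisms.
Variables (V : finType) (e : rel V) (m : V -> nat).
Hypothesis e_irr : irreflexive e.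
Hypothesis e_sym : symmetric e.
Hypothesis m_gt1 : forall v, (1 < m v)%N.
Local Open Scope group_scope.

Notation W := (graph_product e m).
Notation gen := (pres_gen (graph_product_rels e m)).
Notation special := (special_subgroup e m).
Notation sector := (@sector V e m).
Notation vpow := (@vpow V e m _).
Notation star := (star e).
Notation sball := (@sball V e m).
Notation fold := (@fold V e m).
Implicit Types (x y z : W) (u v : V).

Definition conjugating (phi : W -> W) (g : V -> W) :=
  {morph phi : x y / x * y} /\
  forall v, phi (gen v) = g v * gen v * (g v)^-1.

Section Conjugating.
Variables (phi : W -> W) (g : V -> W).
Hypothesis phi_g : conjugating phi g.

Let phiM : {morph phi : x y / x * y}. Proof. by case: phi_g. Qed.
Let phi_gen v : phi (gen v) = g v * gen v * (g v)^-1.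
Proof. by case: phi_g. Qed.

Lemma conjugating_vpow v (a : 'Z_(m v)) :
  phi (vpow a) = g v * vpow a * (g v)^-1.
Proof.
rewrite /vpow (morph_gX phiM); elim: (nat_of_ord a) => [|n IHn].
  by rewrite !expg0 mulg1 mulgV.
by rewrite !expgS IHn phi_gen !mulgA mulgVK.
Qed.

Lemma conjugating_cross u v : e u v ->
  exists x, special (star u) ((g u)^-1 * x) /\ special (star v) ((g v)^-1 * x).
Proof.
move=> uv; apply: crossing => //.
by rewrite /commute -!phi_gen -!phiM gen_commute.
Qed.

Lemma conjugating_self v (a : 'Z_(m v)) :
  (g v)^-1 * phi (vpow a) * g v = vpow a.
Proof. by rewrite conjugating_vpow !mulgA mulVg mul1g mulgVK. Qed.

(** At a common point [x] of the two walls, [phi (vpow a)] is the conjugate of [vpow a] by [x]. Seen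
    from [g v] the conjugator lies in W(star v), where [sector v] is additive, so it contributes
    nothing. *)
Lemma conjugating_lk u v (a : 'Z_(m u)) : e u v ->
  special (star v) ((g v)^-1 * phi (vpow a) * g v) /\
  sector v ((g v)^-1 * phi (vpow a) * g v) = 0%R.
Proof.
move=> uv; have [x [xu xv]] := conjugating_cross uv.
have phiE : phi (vpow a) = x * vpow a * x^-1.
  have := star_commute_vpow e_sym m_gt1 a xu; rewrite conjugating_vpow.
  rewrite -{2 3}(mulVKg (g u) x); move: ((g u)^-1 * x) => p pa.
  by rewrite -(mulgA _ p) pa invgM !mulgA mulgK.
have -> : (g v)^-1 * phi (vpow a) * g v =
    ((g v)^-1 * x) * vpow a * ((g v)^-1 * x)^-1.
  by rewrite phiE invgM invgK !mulgA.
have av : special (star v) (vpow a).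
  by apply: special_vpow; rewrite inE e_sym uv orbT.
move: ((g v)^-1 * x) xv => q qv.
split; first by apply: specialM; [exact: specialM|exact: specialV].
rewrite !sectorM_star//; last exact: specialM.
rewrite sectorV_star// addrAC subrr add0r.
by rewrite -[vpow a]mulg1 sector_lk_vpowM// sector1.
Qed.

Lemma conjugating_star u v (a : 'Z_(m u)) : u \in star v ->
  special (star v) ((g v)^-1 * phi (vpow a) * g v).
Proof.
rewrite inE => /orP[/eqP uv|vu].
  by subst u; rewrite conjugating_self; exact: star_vpow.
by have [] := conjugating_lk a (etrans (e_sym u v) vu).
Qed.

(* The wall of phi (gen v) is the coset g v * W(star v). *)
Definition wall_sector v x := sector v ((g v)^-1 * x).

Lemma wall_sector_self v (a : 'Z_(m v)) x :
  wall_sector v (phi (vpow a) * x) = (a + wall_sector v x)%R.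
Proof.
rewrite /wall_sector conjugating_vpow -!mulgA mulKg.
by rewrite sector_vpowM.
Qed.

Lemma wall_sector_lk u v (a : 'Z_(m u)) x : e u v ->
  wall_sector v (phi (vpow a) * x) = wall_sector v x.
Proof.
move=> uv; have [sp s0] := conjugating_lk a uv; rewrite /wall_sector.
have -> : (g v)^-1 * (phi (vpow a) * x) =
    (g v)^-1 * phi (vpow a) * g v * ((g v)^-1 * x) by rewrite !mulgA mulgK.
by rewrite sectorM_star// s0 add0r.
Qed.

Lemma wall_sector_coset u v x : u \notin star v ->
  special (star u) ((g u)^-1 * x) -> wall_sector v x = wall_sector v (g u).
Proof.
move=> uv xu; rewrite /wall_sector -{1}(mulVKg (g u) x) mulgA.
by rewrite (sectorM_special e_irr e_sym m_gt1 _ _ xu)// -star_sym.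
Qed.

Lemma wall_sector_adj u u' v : u \notin star v -> u' \notin star v ->
  e u u' -> wall_sector v (g u) = wall_sector v (g u').
Proof.
move=> uv u'v /conjugating_cross[x [xu xu']].
by rewrite -(wall_sector_coset uv xu) (wall_sector_coset u'v xu').
Qed.

Definition offstar v : rel V :=
  [rel a b | [&& e a b, a \notin star v & b \notin star v]].

Lemma wall_sector_connect u u' v : connect (offstar v) u u' ->
  wall_sector v (g u) = wall_sector v (g u').
Proof.
move=> /connectP[p pp ->]; elim: p u pp => [//|w p IH] u /= /andP[].
by move=> /and3P[uw uv wv] /IH <-; exact: wall_sector_adj.
Qed.

(** For [u] outside [star v], the wall of [u] lies entirely in the piece [wall_sector v (g u)] of
    the wall of [v]. *)
Definition aligned v := forall u u', u \notin star v -> u' \notin star v ->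
  wall_sector v (g u) = wall_sector v (g u').

Definition wall_dist u x n :=
  `[< exists2 y, sball n y & special (star u) ((g u)^-1 * (x * y)) >].

Lemma wall_dist_ex u x : exists n, wall_dist u x n.
Proof.
have [n xn] := sball_exists m_gt1 (x^-1 * g u); exists n; apply/asboolP.
by exists (x^-1 * g u); rewrite // mulVKg mulVg; exact: special1.
Qed.

Definition wall_distance u x := ex_minn (wall_dist_ex u x).

(** Descent on the sum of the distances from [x] to all walls. If [x] lies in a wrong piece of the
    wall of [v], a power of [phi (gen v)] rotates it into the right one. This power preserves the
    walls of [star v]. All other walls lie in the target piece, so paths from [x] to them cross the
    wall of [v] and are shortened by folding. *)
Lemma aligned_point : (forall v, aligned v) ->
  exists x, forall u v, u \notin star v ->
    wall_sector v x = wall_sector v (g u).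
Proof.
move=> al; have [n] := ubnP (\sum_u wall_distance u 1).
move: (1 : W) => x; elim: n x => [//|n IHn] x xn.
have [ok|] := pselect (forall u v, u \notin star v ->
    wall_sector v x = wall_sector v (g u)); first by exists x.
move=> /existsNP[u0 /existsNP[v /not_implyP[u0v xv]]].
set t := wall_sector v (g u0) in xv.
pose y := phi (vpow t) * fold v (g v) x; apply: (IHn y).
have foldE z : fold v (g v) z = phi (vpow (- wall_sector v z)%R) * z.
  by rewrite conjugating_vpow.
have le_star u k : u \in star v -> wall_dist u x k -> wall_dist u y k.
  rewrite (star_sym e_sym) => uv /asboolP[z kz xz]; apply/asboolP; exists z => //.
  have -> : (g u)^-1 * (y * z) = ((g u)^-1 *
      phi (vpow (t - wall_sector v x)%R) * g u) * ((g u)^-1 * (x * z)).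
    rewrite /y foldE vpowD// phiM !mulgA; congr (_ * _ * _).
    by rewrite mulgK.
  by apply: specialM => //; apply: conjugating_star.
have lt_nstar u k : u \notin star v -> wall_dist u x k ->
    wall_dist u y k.-1 /\ (0 < k)%N.
  move=> uv /asboolP[z kz xz].
  have xzv : wall_sector v (x * z) = t.
    by rewrite (wall_sector_coset uv xz) /t; exact: al.
  have xxz : wall_sector v x <> wall_sector v (x * z) by rewrite xzv.
  split; last first.
    case: k kz => //= z1; case: xxz; congr wall_sector.
    by rewrite z1 mulg1.
  apply/asboolP; exists (y^-1 * (x * z)); last by rewrite mulVKg.
  have [_ /(_ xxz)] := fold_sball e_irr e_sym m_gt1 v (g v) x kz.
  rewrite (foldE (x * z)) xzv vpowN// (morph_gV phiM) /y [(phi _ * _)^-1]invgM.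
  by rewrite -!mulgA.
rewrite ltnS in xn; apply: (leq_trans _ xn).
rewrite (bigD1 u0)//= [ltnRHS](bigD1 u0)//=.
have dP u z k : wall_dist u z k -> (wall_distance u z <= k)%N.
  by rewrite /wall_distance; case: ex_minnP => i _; apply.
have dE u z : wall_dist u z (wall_distance u z).
  by rewrite /wall_distance; case: ex_minnP.
rewrite -addSn leq_add//.
  have [/dP yk k0] := lt_nstar _ _ u0v (dE u0 x).
  by rewrite -(prednK k0) ltnS.
apply: leq_sum => u _; have [uv|uv] := boolP (u \in star v).
  exact/dP/le_star.
have [/dP yk _] := lt_nstar _ _ uv (dE u x).
exact: leq_trans (leq_pred _).
Qed.

End Conjugating.

(** By induction on length, [psi x] has the same number with respect to the walls of [psi] as [x]
    has with respect to the standard ones. By surjectivity some wall of [psi] separates 1 from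
    [gen v0]. It can only be that of [v0], and it passes through 1, so [h v0] commutes with
    [gen v0]. *)
Lemma normalised_id psi h : conjugating psi h -> (forall y, exists x, psi x = y) ->
  (forall v, wall_sector h v 1 = 0%R) ->
  (forall u v, u \notin star v -> wall_sector h v (h u) = 0%R) ->
  psi = id.
Proof.
move=> psi_h psi_surj h1 hh.
have [psiM psi_gen] := psi_h.
have secE n : forall x, sball n x ->
    forall v, wall_sector h v (psi x) = sector v x.
  elim/ltn_ind: n => n IHn x xn v.
  have [->|/eqP x1] := eqVneq x 1; first by rewrite (morph_g1 psiM) h1 sector1.
  have n0 : (n.-1 < n)%N by case: n {IHn} xn.
  have [y [s [a [yn a0 ys xE]]]] := sball_split e_irr e_sym m_gt1 xn x1.
  have {IHn} IH w := IHn _ n0 y yn w.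
  have [sv|sv] := eqVneq s v.
    by subst s; rewrite xE psiM (wall_sector_self psi_h) IH sector_vpowM.
  have [sv'|sv'] := boolP (e s v).
    by rewrite xE psiM (wall_sector_lk psi_h)// IH sector_lk_vpowM.
  have sNv : s \notin star v by rewrite inE (negbTE sv) e_sym.
  have xs : sector s x = a by rewrite xE sector_vpowM// ys addr0.
  rewrite [RHS](sector_sep e_irr e_sym m_gt1 sNv) ?xs//.
  (* [psi x] lies in piece [a] of the wall of [s], whereas the wall of [v] lies in piece 0. Hence
     [psi x] lies in the piece of the wall of [v] that contains the wall of [s], and this is piece
     0. *)
  have [] := sector_cross e_irr e_sym m_gt1 (h s) (h v) (psi x) sNv.
    rewrite -![sector s _]/(wall_sector h s _) hh; last by rewrite star_sym.
    rewrite xE psiM (wall_sector_self psi_h) IH ys addr0 => a0'.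
    by rewrite a0' eqxx in a0.
  by rewrite -![sector v _]/(wall_sector h v _) hh.
apply: (@morph_gen_ext _ e _ m_gt1) => // v0; rewrite psi_gen.
have [x xv0] := psi_surj (gen v0); have [n xn] := sball_exists m_gt1 x.
have [v sv] : exists v, wall_sector h v (gen v0) <> 0%R.
  apply: contrapT => nv.
  have x1 : x = 1.
    apply: sector_eq0 => // v; rewrite -(secE _ _ xn) xv0.
    by apply: contrapT => ?; apply: nv; exists v.
  have := sector_gen e_irr e_sym m_gt1 v0; rewrite -xv0 x1 (morph_g1 psiM).
  by rewrite sector1// => /esym/eqP; rewrite (negbTE (oner_neq0_Zm _ _)).
move: sv; have := h1 v; rewrite /wall_sector mulg1 sectorM_gen// => ->.
rewrite add0r; case: eqP => //= vv; rewrite -{}vv.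
case: asboolP => // hv _; have := star_commute e_sym m_gt1 hv.
by move=> /commute_sym/commuteV; rewrite invgK /commute => <-; rewrite mulgK.
Qed.

(* Ping-pong: once the walls all lie on the same side of each other, the points
   on that side of every wall reduce to one point x, as phi is surjective. *)
Lemma aligned_inner phi g : conjugating phi g ->
  (forall y, exists x, phi x = y) -> (forall v, aligned g v) ->
  exists x, forall y, phi y = x * y * x^-1.
Proof.
move=> phi_g phi_surj al; have [phiM phi_gen] := phi_g.
have [x xE] := aligned_point phi_g al; exists x => y.
(* The conjugator of [gen v] may be changed by a power of [v]; this power renumbers the pieces so
   that 1 gets number 0. *)
pose h v := x^-1 * g v * vpow (wall_sector g v x).
pose psi y := x^-1 * phi y * x.
suff /(congr1 (fun f => f y)) : psi = id.
  by rewrite /psi => yE; rewrite -[X in _ = x * X * _]yE !mulgA mulgV mul1g mulgK.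
have hV v z : (h v)^-1 * z = vpow (- wall_sector g v x)%R * ((g v)^-1 * (x * z)).
  by rewrite /h !invgM invgK vpowN// !mulgA.
apply: (@normalised_id psi h).
- split=> [z z'|v]; first by rewrite /psi phiM !mulgA mulgK.
  rewrite /psi phi_gen /h.
  have := star_commute e_sym m_gt1 (@star_vpow V e m v (wall_sector g v x)).
  move: (vpow _) => p pv; rewrite -(mulgA _ p) pv !invgM !mulgA mulgK.
  by rewrite invgK.
- move=> z; have [w wE] := phi_surj (x * z * x^-1); exists w.
  by rewrite /psi wE !mulgA mulVg mul1g mulgVK.
- by move=> v; rewrite /wall_sector hV sector_vpowM// mulg1 addrC subrr.
- move=> u v uv; rewrite /wall_sector hV sector_vpowM//.
  rewrite /h !mulgA mulgK sectorM_vpow_neq//; last first.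
    by apply: contraNneq uv => ->; exact: star_self.
  by rewrite -/(wall_sector g v (g u)) -(xE u v)// addrC subrr.
Qed.

End ConjugatingAutomorphisms.

(** * Partial conjugations and alignment *)

Section PartialConjugations.
Variables (V : finType) (e : rel V) (m : V -> nat).
Hypothesis e_irr : irreflexive e.
Hypothesis e_sym : symmetric e.
Hypothesis m_gt1 : forall v, (1 < m v)%N.
Local Open Scope group_scope.

Notation W := (graph_product e m).
Notation gen := (pres_gen (graph_product_rels e m)).
Notation special := (special_subgroup e m).
Notation sector := (@sector V e m).
Notation vpow := (@vpow V e m _).
Notation star := (star e).
Implicit Types (x y : W) (u v z : V).

Definition common_link v w : {set V} := [set u | e v u && e w u].

Definition avoiding (D : {set V}) : rel V :=
  [rel a b | [&& e a b, a \notin D & b \notin D]].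

(* The full subgraph on the complement of the common link of the nonadjacent
   vertices v and w has a component, that of u, without v and w. *)
Definition separating_link v w u :=
  [/\ v != w, ~~ e v w, u \notin common_link v w,
      ~~ connect (avoiding (common_link v w)) u v &
      ~~ connect (avoiding (common_link v w)) u w].

(* The junk value is the identity, unless k is constant along the edges outside
   of star v. *)
Definition partial_conj v (k : V -> 'Z_(m v)) : W -> W :=
  xget (fun x : W => x) [set c : W -> W | {morph c : x y / x * y} /\
    forall u, c (gen u) = vpow (k u) * gen u * (vpow (k u))^-1].

(** Conjugation by powers of [v] is trivial on [star v]. Both ends of an edge meeting [star v] can
    thus be conjugated by the same power, and only the edges outside [star v] constrain [k]. *)
Lemma partial_conj_spec v (k : V -> 'Z_(m v)) :
  (forall a b, offstar e v a b -> k a = k b) ->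
  {morph partial_conj k : x y / x * y} /\
  forall u, partial_conj k (gen u) = vpow (k u) * gen u * (vpow (k u))^-1.
Proof.
move=> kE; rewrite /partial_conj; case: xgetP => [c _ //|noc]; exfalso.
have fix_star u (p : 'Z_(m v)) : u \in star v ->
    vpow p * gen u * (vpow p : W)^-1 = gen u :> W.
  move=> uv; have := star_commute_vpow e_sym m_gt1 p (@special_gen V e m _ _ uv).
  by rewrite /commute => <-; rewrite mulgK.
pose j u : W := vpow (k u) * gen u * (vpow (k u))^-1.
have jm u : j u ^+ m u = 1.
  have jX n : j u ^+ n = vpow (k u) * gen u ^+ n * (vpow (k u))^-1.
    elim: n => [|n IHn]; first by rewrite !expg0 mulg1 mulgV.
    by rewrite !expgS IHn /j !mulgA mulgVK.
  by rewrite jX gen_order mulg1 mulgV.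
have same a b (p : 'Z_(m v)) : e a b -> commute (vpow p * gen a * (vpow p : W)^-1)
    (vpow p * gen b * (vpow p)^-1).
  move=> ab; rewrite /commute !mulgA !mulgVK -(mulgA _ (gen a)).
  by rewrite gen_commute// mulgA.
have [|c [cM cg]] := @graph_product_lift _ e _ m_gt1 _ j jm; last by apply: (noc c).
move=> a b ab; have [av|av] := boolP (a \in star v).
  by rewrite /j (fix_star a)// -{1 2}(fix_star a (k b))//; exact: same.
have [bv|bv] := boolP (b \in star v).
  by rewrite /j (fix_star b)// -{1 2}(fix_star b (k a))//; exact: same.
by rewrite /j (kE a b) ?/offstar/= ?ab ?av ?bv//; exact: same.
Qed.

Lemma partial_conj_surj v (k : V -> 'Z_(m v)) :
  (forall a b, offstar e v a b -> k a = k b) ->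
  forall y, exists x, partial_conj k x = y.
Proof.
move=> kE y; have [cM cg] := partial_conj_spec kE.
pose k' u := (- k u)%R.
have k'E a b : offstar e v a b -> k' a = k' b by rewrite /k' => /kE->.
have [c'M c'g] := partial_conj_spec k'E; exists (partial_conj k' y).
have fixv (a : 'Z_(m v)) : partial_conj k (vpow a) = vpow a.
  rewrite /vpow (morph_gX cM) cg.
  have := star_commute_vpow e_sym m_gt1 (k v) (@special_gen V e m _ _ (star_self e v)).
  by rewrite /commute => <-; rewrite mulgK.
suff /(congr1 (fun f => f y)) : partial_conj k \o partial_conj k' = id by [].
apply: (@morph_gen_ext _ e _ m_gt1) => [a b|//|u]; first by rewrite /= c'M cM.
rewrite /= c'g !cM (morph_gV cM) fixv cg /k' vpowN// invgK.
by rewrite !mulgA mulVg mul1g mulgVK.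
Qed.

Hypothesis no_sep : forall v w u, ~ separating_link v w u.

(** Suppose both connections fail. The component of [u] off [star v] then avoids [star v'], since a
    neighbour of [v'] in it would lead to [v']. It does not grow when only the common link is
    deleted: an exit through another vertex of [star v] would lead to [v] off [star v']. So [v],
    [v'] and [u] form a separating link. *)
Lemma offstar_swap v v' u : v' \notin star v -> u \notin star v ->
  u \notin star v' -> ~~ connect (offstar e v) u v' ->
  connect (offstar e v') u v.
Proof.
move=> v'v uv uv' nuv'; apply/negPn/negP => nuv.
have vv' : v \notin star v' by rewrite star_sym.
have Kv z : connect (offstar e v) u z -> z \notin star v.
  move=> /connectP[p + ->]; elim/last_ind: p => [//|p z' _].
  by rewrite last_rcons rcons_path => /andP[_ /and3P[]].
have Kv' z : connect (offstar e v) u z -> z \notin star v'.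
  move=> uz; apply: contra nuv'; rewrite inE => /orP[/eqP<-//|v'z].
  apply: (connect_trans uz); apply: connect1; rewrite /offstar /= e_sym v'z v'v.
  by rewrite /= andbT; exact: Kv.
have conv' z : connect (offstar e v) u z -> connect (offstar e v') u z.
  move=> /connectP[p + ->]; elim/last_ind: p => [//|p z' IH] pz.
  rewrite last_rcons; move: (pz); rewrite rcons_path => /andP[pp pz'].
  apply: connect_trans (IH pp) _; apply: connect1.
  have up : connect (offstar e v) u (last u p) by apply/connectP; exists p.
  rewrite /offstar /= (Kv' _ up) Kv' ?andbT/=; first by have /and3P[] := pz'.
  by apply: (connect_trans up); exact: connect1.
have Kc z : connect (avoiding (common_link v v')) u z ->
    connect (offstar e v) u z.
  move=> /connectP[p + ->]; elim/last_ind: p => [//|p y IH].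
  rewrite rcons_path last_rcons => /andP[/IH uz /and3P[zy _ yN]].
  have zv := Kv _ uz; apply: (connect_trans uz); apply: connect1.
  rewrite /offstar /= zy zv /=; apply/negP => yv.
  have zu := conv' _ uz; apply: (negP nuv); apply: (connect_trans zu).
  have zv' := Kv' _ uz; have vy : e v y.
    move: yv; rewrite inE => /orP[/eqP yv|//].
    by move: zv; rewrite inE e_sym -yv zy orbT.
  have yv' : y \notin star v'.
    move: yN; rewrite !inE vy /= negb_or => ->; rewrite andbT.
    by apply: contraNneq v'v => <-; rewrite inE vy orbT.
  apply: (@connect_trans _ _ y); apply: connect1; rewrite /offstar /= ?zy ?zv' ?yv'//.
  by rewrite e_sym vy vv'.
apply: (no_sep (v := v) (w := v') (u := u)); split.
- by apply: contraNneq v'v => <-; exact: star_self.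
- by apply: contra v'v => vv''; rewrite inE vv'' orbT.
- by apply: contra uv; rewrite !inE => /andP[->]; rewrite orbT.
- by apply/negP => /Kc /Kv; rewrite star_self.
- by apply/negP => /Kc /Kv'; rewrite star_self.
Qed.

Lemma partial_conj_step (phi : W -> W) (g : V -> W) v : conjugating phi g ->
  exists k : {ffun V -> 'Z_(m v)},
    (forall y, exists x, partial_conj k x = y) /\
    exists g', [/\ conjugating (phi \o partial_conj k) g', aligned g' v &
      forall v', aligned g v' -> aligned g' v'].
Proof.
move=> phi_g; have [phiM phi_gen] := phi_g.
(* The exponent cancels the number of the piece containing the wall of [u], so that all these walls
   are moved to one piece. *)
pose k : {ffun V -> 'Z_(m v)} := [ffun u => - wall_sector g v (g u)]%R.
have kE a b : offstar e v a b -> k a = k b.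
  move=> /and3P[ab av bv]; rewrite !ffunE.
  by rewrite (wall_sector_adj e_irr e_sym m_gt1 phi_g av bv ab).
exists k; split; first exact: partial_conj_surj.
have [cM cg] := partial_conj_spec kE.
pose g' u := phi (vpow (k u)) * g u; exists g'.
have phi_g' : conjugating (phi \o partial_conj k) g'.
  split=> [x y|u] /=; first by rewrite cM phiM.
  by rewrite cg !phiM phi_gen (morph_gV phiM) /g' invgM !mulgA.
have g'E v' u : wall_sector g' v' (g' u) =
    wall_sector g v' (phi (vpow (k u - k v')%R) * g u).
  rewrite /wall_sector /g' invgM addrC vpowD// vpowN// phiM (morph_gV phiM).
  by rewrite !mulgA.
have al_v : aligned g' v.
  suff al u : u \notin star v -> wall_sector g' v (g' u) = (- k v)%R.
    by move=> u u' uv u'v; rewrite !al.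
  rewrite g'E (wall_sector_self e_irr e_sym m_gt1 phi_g) => _.
  rewrite addrAC.
  by rewrite {1}/k ffunE addNr add0r.
split=> // v' al; have [<-//|v'Nv] := eqVneq v v'.
suff al' u : u \notin star v' -> wall_sector g' v' (g' u) = wall_sector g v' (g u).
  by move=> u u' uv u'v; rewrite !al'//; exact: al.
move=> uv'; have [vv'|vNv'] := boolP (e v v').
  by rewrite g'E (wall_sector_lk e_irr e_sym m_gt1 phi_g).
have v'v : v' \notin star v by rewrite inE eq_sym (negbTE v'Nv) (negbTE vNv').
have vv' : v \notin star v' by rewrite star_sym.
have coset w a : w \notin star v' -> v \in star w ->
    wall_sector g v' (phi (vpow (a : 'Z_(m v))) * g w) = wall_sector g v' (g w).
  move=> wv' vw; apply: (wall_sector_coset e_irr e_sym m_gt1) => //.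
  by rewrite mulgA; apply: (conjugating_star e_irr e_sym m_gt1 phi_g).
have [uv|uv] := boolP (u \in star v).
  by rewrite g'E coset// star_sym.
(* Either [u] and [v'] have the same exponent and move together, or [u] is joined to [v] off
   [star v'] and its wall can be traded for that of [v], which powers of [phi (gen v)] preserve. *)
have [uv'c|uv'c] := boolP (connect (offstar e v) u v').
  suff kuv' : k u = k v' by rewrite g'E kuv' subrr vpow0 (morph_g1 phiM) mul1g.
  move: uv'c => /connectP[p + ->]; elim: p u {uv uv'} => [//|w p IH] u /=.
  by move=> /andP[/kE-> /IH].
have uvc := offstar_swap v'v uv uv' uv'c.
rewrite (wall_sector_connect e_irr e_sym m_gt1 phi_g' uvc) g'E.
rewrite coset ?star_self//.
by rewrite (wall_sector_connect e_irr e_sym m_gt1 phi_g uvc).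
Qed.

Lemma finite_partial_conj (l : seq V) : exists C : set (W -> W), finite_set C /\
  forall phi g, conjugating phi g -> exists2 c, C c &
    (forall y, exists x, c x = y) /\
    exists g', [/\ conjugating (phi \o c) g', {in l, forall v, aligned g' v} &
      forall v, aligned g v -> aligned g' v].
Proof.
elim: l => [|v l [C [finC IH]]].
  exists [set (fun x : W => x)]; split=> [|phi g phi_g]; first exact: finite_set1.
  by exists (fun x => x) => //; split; [move=> y; exists y|exists g].
exists [set @partial_conj v f \o c | f in [set: {ffun V -> 'Z_(m v)}] & c in C].
split=> [|phi g phi_g].
  by apply: finite_image2 => //; exact: finite_finset.
have [k [k_surj [g1 [phi_g1 g1v alg1]]]] := partial_conj_step v phi_g.
have [c Cc [c_surj [g2 [phi_g2 g2l alg2]]]] := IH _ _ phi_g1.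
exists (partial_conj k \o c); first by exists k => //; exists c.
split=> [y|].
  by have [z <-] := k_surj y; have [x <-] := c_surj z; exists x.
exists g2; split=> // [w|w /alg1 /alg2//].
by rewrite inE => /orP[/eqP->|/g2l//]; exact: alg2.
Qed.

Lemma conjugating_finite : exists C : set (W -> W), finite_set C /\
  forall phi g, conjugating phi g -> (forall y, exists x, phi x = y) ->
  exists2 c, C c & (forall y, exists x, c x = y) /\
    exists x, forall y, phi (c y) = x * y * x^-1.
Proof.
have [C [finC CP]] := finite_partial_conj (enum V); exists C; split=> //.
move=> phi g phi_g phi_surj; have [c Cc [c_surj [g' [phi_g' al _]]]] := CP _ _ phi_g.
exists c => //; split=> //; apply: (aligned_inner e_irr e_sym m_gt1 phi_g').
  by move=> y; have [z <-] := phi_surj y; have [x <-] := c_surj z; exists x.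
by move=> v; apply: al; rewrite mem_enum.
Qed.

End PartialConjugations.

(** * Outer automorphisms *)

Section InnerCosets.
Variable G : groupType.
Local Open Scope group_scope.

Definition inner_coset (phi : G -> G) : set (G -> G) :=
  [set phi \o iota | iota in Inn G].

Lemma inner_coset_eq (phi psi : G -> G) (q : G) :
  (forall y, phi y = psi (q * y * q^-1)) -> inner_coset phi = inner_coset psi.
Proof.
move=> phiE; apply/seteqP; split=> f [_ [g ->] <-].
  exists (fun x => (q * g) * x * (q * g)^-1); first by exists (q * g).
  by apply/funext => x /=; rewrite phiE invgM !mulgA.
exists (fun x => (q^-1 * g) * x * (q^-1 * g)^-1); first by exists (q^-1 * g).
apply/funext => x /=; rewrite phiE invgM invgK !mulgA mulgV mul1g.
by rewrite mulgK.
Qed.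

End InnerCosets.

Section OuterAutomorphisms.
Variables (V : finType) (e : rel V) (m : V -> nat).
Hypothesis e_irr : irreflexive e.
Hypothesis e_sym : symmetric e.
Hypothesis m_gt1 : forall v, (1 < m v)%N.
Local Open Scope group_scope.

Notation W := (graph_product e m).
Notation gen := (pres_gen (graph_product_rels e m)).

Hypothesis no_sep : forall v w u, ~ separating_link e v w u.

(** An outer class is encoded by finite data: representatives in [T] of the images of the
    generators, and the correcting map [c]. Composing [phi] with the inverse of a fixed automorphism
    [psi tau] of the same type gives a conjugating automorphism. *)
Lemma Out_finite (T : set W) : finite_set T ->
  (forall (x : W) n, (0 < n)%N -> x ^+ n = 1 ->
     exists t h, T t /\ x = h * t * h^-1) ->
  finite_set (Out W).
Proof.
move=> /finite_seqP[s ->{T}] torsion.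
have [C [finC CP]] := conjugating_finite e_irr e_sym m_gt1 no_sep.
pose typ (phi : W -> W) (tau : {ffun V -> 'I_(size s)}) :=
  forall v, exists h : W, phi (gen v) = h * nth 1 s (tau v) * h^-1.
pose psi tau : W -> W := xget (fun x : W => x) [set phi | Aut W phi /\ typ phi tau].
pose key tau (c : W -> W) (Q : set (W -> W)) := exists phi,
  [/\ Aut W phi, Q = inner_coset phi, Aut W (psi tau),
    (forall y, exists x, c x = y) &
    exists x, forall y, phi (c y) = psi tau (x * y * x^-1)].
apply: (@sub_finite_set _ _ [set xget set0 (key tau c) |
    tau in [set: {ffun V -> 'I_(size s)}] & c in C]); last first.
  by apply: finite_image2 => //; exact: finite_finset.
move=> _ [phi phiA <-]; rewrite -/(inner_coset phi).
have bij_surj (f : W -> W) : bijective f -> forall y, exists x, f x = y.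
  by case=> f' _ fK y; exists (f' y).
have uniq_key tau c Q Q' : key tau c Q -> key tau c Q' -> Q = Q'.
  move=> [f [_ -> [_ pM] c_surj [x fx]]] [f' [[/bij_surj f'b f'M] -> _ _ [x' fx']]].
  (* On the image of [c], which is everything, [f] is [f'] preceded by conjugation with the element
     [q] that [f'] sends to [p]. *)
  pose p := psi tau (x * x'^-1); have [q qp] := f'b p.
  apply: (@inner_coset_eq _ _ _ q) => y; have [z <-] := c_surj y.
  rewrite !f'M (morph_gV f'M) qp fx fx' /p -(morph_gV pM) -!pM.
  by rewrite invgM invgK !mulgA mulgVK mulgVK.
have [phib phiM] := phiA.
have [tau phit] : exists tau, typ phi tau.
  have h v : exists i : 'I_(size s), exists h : W,
      phi (gen v) = h * nth 1 s i * h^-1.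
    have [||t [h [st ->]]] := torsion (phi (gen v)) (m v).
    - exact: ltn_trans (m_gt1 v).
    - by rewrite -(morph_gX phiM) gen_order (morph_g1 phiM).
    - have si : (index t s < size s)%N by rewrite index_mem.
      by exists (Ordinal si), h; rewrite /= nth_index.
  have [f fP] := choice h; exists [ffun v => f v] => v.
  by rewrite ffunE; exact: fP.
have [psiA psit] : Aut W (psi tau) /\ typ (psi tau) tau.
  by rewrite /psi; case: xgetP => [f _ []//|/(_ phi) []]; split.
have [[psi' psiK psi'K] psiM] := psiA.
have psi'M : {morph psi' : x y / x * y}.
  by move=> x y; apply: (can_inj psiK); rewrite psiM !psi'K.
have [g gP] : exists g : V -> W, forall v,
    psi' (phi (gen v)) = g v * gen v * (g v)^-1.
  suff h (v : V) : exists g : W, psi' (phi (gen v)) = g * gen v * g^-1.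
    by have [g gP] := choice h; exists g.
  have [[h phiE] [k psiE]] := (phit v, psit v); exists (psi' (h * k^-1)).
  apply: (can_inj psiK); rewrite !psiM (morph_gV psiM) !psi'K phiE psiE.
  by rewrite invgM invgK !mulgA !mulgVK.
have conj_g : conjugating (psi' \o phi) g.
  by split=> // x y; rewrite /= phiM psi'M.
have [|c Cc [c_surj [x cx]]] := CP _ _ conj_g.
  move=> y; have /bij_surj/(_ (psi tau y))[z zy] := phib.
  by exists z; rewrite /= zy psiK.
exists tau => //; exists c => //; apply: (uniq_key tau c).
  apply: (@xgetPex _ set0 (key tau c)); exists (inner_coset phi); exists phi.
  by split=> //; exists x => y; rewrite -cx /= psi'K.
by exists phi; split=> //; exists x => y; rewrite -cx /= psi'K.
Qed.

End OuterAutomorphisms.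

(** * The midpoint inequality in CAT(0) spaces *)

Local Open Scope ring_scope.

Section MidpointInequality.
Variables (R : realType).

Definition row2 (a b : R) : 'rV[R]_2 := \row_(i < 2) if i == ord0 then a else b.

Lemma row2E (u : 'rV[R]_2) : u = row2 (u ord0 ord0) (u ord0 ord_max).
Proof.
apply/rowP => i; rewrite mxE; case: eqP => [->//|i0].
suff -> : i = ord_max by [].
by apply/val_inj; case: i i0 => -[|[|//]] // i2; case; apply/val_inj.
Qed.

Lemma sqr_edist2 (u v : 'rV[R]_2) : edist u v ^+ 2 =
  (u ord0 ord0 - v ord0 ord0) ^+ 2 + (u ord0 ord_max - v ord0 ord_max) ^+ 2.
Proof.
rewrite /edist sqr_sqrtr ?sumr_ge0// => [|i _]; last exact: sqr_ge0.
rewrite big_ord_recl big_ord_recl big_ord0 addr0.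
by congr (_ + (_ - _) ^+ 2); congr (_ _ _); apply/val_inj.
Qed.

Lemma edist2E (u v : 'rV[R]_2) (d : R) : 0 <= d ->
  (u ord0 ord0 - v ord0 ord0) ^+ 2 + (u ord0 ord_max - v ord0 ord_max) ^+ 2
    = d ^+ 2 -> edist u v = d.
Proof.
move=> d0; rewrite -sqr_edist2 => /eqP; rewrite eqrXn2// => [/eqP//|].
exact: sqrtr_ge0.
Qed.

Lemma edistC n (u v : 'rV[R]_n) : edist u v = edist v u.
Proof. by rewrite /edist; congr Num.sqrt; apply: eq_bigr => i _; rewrite !sqrrB; lra. Qed.

Lemma euclidean_triangle (a b c : R) : 0 <= a -> 0 <= b -> 0 <= c ->
  a <= b + c -> b <= a + c -> c <= a + b -> exists u v : R,
  u ^+ 2 + v ^+ 2 = b ^+ 2 /\ (a - u) ^+ 2 + v ^+ 2 = c ^+ 2.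
Proof.
move=> a0 b0 c0 abc bac cab; have [a00|a_neq0] := eqVneq a 0.
  have bc : b = c by lra.
  by exists b, 0; rewrite a00 bc sub0r sqrrN expr0n /= addr0.
have a_gt0 : 0 < a by rewrite lt_neqAle eq_sym a_neq0.
(* Law of cosines: the foot of the altitude on the side of length [a]. *)
pose u := (a ^+ 2 + b ^+ 2 - c ^+ 2) / (2 * a).
have ua : 2 * a * u = a ^+ 2 + b ^+ 2 - c ^+ 2.
  by rewrite /u mulrC divfK// mulf_neq0 ?pnatr_eq0.
have ub : u ^+ 2 <= b ^+ 2.
  have ub1 : u <= b.
    rewrite -(ler_pM2l (_ : 0 < 2 * a)) ?ua; last by lra.
    have : (a - b) ^+ 2 <= c ^+ 2.
      rewrite -[c ^+ 2]real_normK ?num_real// -[(_ - _) ^+ 2]real_normK ?num_real//.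
      by rewrite lerXn2r ?nnegrE// (ger0_norm c0) ler_norml; lra.
    by lra.
  have ub2 : - b <= u.
    rewrite -(ler_pM2l (_ : 0 < 2 * a)) ?ua; last by lra.
    have : c ^+ 2 <= (a + b) ^+ 2 by rewrite lerXn2r ?nnegrE; lra.
    by lra.
  by rewrite -[u ^+ 2]real_normK ?num_real// lerXn2r ?nnegrE// ler_norml ub1 ub2.
exists u, (Num.sqrt (b ^+ 2 - u ^+ 2)); rewrite sqr_sqrtr ?subr_ge0//.
by split; lra.
Qed.

Variable X : metricType R.

(** The inequality of Bruhat and Tits, read off from a comparison triangle with base on the first
    axis. Besides geodesics, it is all that later arguments take from [CAT0]. *)
Lemma midpoint_CN : CAT0 X -> forall x y : X, exists m,
  [/\ mdist x m = mdist x y / 2, mdist m y = mdist x y / 2 &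
    forall p, mdist p m ^+ 2 <=
      (mdist p x ^+ 2 + mdist p y ^+ 2) / 2 - mdist x y ^+ 2 / 4].
Proof.
move=> [geo cat] x y; have [c xyc] := geo x y; set a := mdist x y.
have a0 : 0 <= a := mdist_ge0 x y.
have a2 : 0 <= a / 2 <= a by lra.
have [cx cy cd] := xyc; exists (c (a / 2)); split.
- by rewrite -{1}cx cd ?lexx//; rewrite sub0r normrN ger0_norm; lra.
- by rewrite -{1}cy cd ?lexx ?a0//; rewrite ler0_norm; rewrite -/a; lra.
move=> p; pose P (i : 'I_3) := nth p [:: x; y] i.
have [c' c'P] := choice (fun i => geo (P i) (P (ordS i))).
pose cs i := if i == ord0 then c else c' i.
have csP : geodesic_triangle P cs.
  by move=> i; rewrite /cs; case: eqP => [->|].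
have := metric_triangle x p y; have := metric_triangle x y p.
have := metric_triangle y x p; rewrite (metric_sym y x) (metric_sym p y).
rewrite -/a => t1 t2 t3.
have [//|||//|||u [v [uv1 uv2]]] := @euclidean_triangle a (mdist x p) (mdist y p);
  rewrite ?mdist_ge0//; try lra.
pose q (i : 'I_3) := nth (row2 u v) [:: row2 0 0; row2 a 0] i.
have qP : comparison_triangle P q.
  have base (i j : 'I_3) : (i < j)%N -> edist (q i) (q j) = mdist (P i) (P j).
    case: i j => -[|[|[|//]]] i3 [[|[|[|//]]] j3] //= _;
    rewrite /q /P /=; apply: edist2E; rewrite ?mdist_ge0// !mxE /= -?/a; lra.
  move=> i j; case: (ltngtP i j) => [/base//|/base|/val_inj->].
    by rewrite edistC metric_sym.
  by rewrite mdistxx; apply: edist2E => //; rewrite !subrr; lra.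
pose i2 : 'I_3 := ord_max; pose w := row2 (a / 2) 0.
have := cat P cs q csP qP ord0 i2 (a / 2) 0 w (row2 u v).
have -> : cs ord0 (a / 2) = c (a / 2) by [].
have -> : cs i2 0 = p by rewrite /cs /=; have [] := c'P i2.
move=> /(_ a2); rewrite lexx mdist_ge0 => /(_ isT) le_e.
have {le_e} : mdist (c (a / 2)) p <= edist w (row2 u v).
  apply: le_e; split.
  - by apply: edist2E; rewrite ?divr_ge0// !mxE /=; lra.
  - exists (1 / 2); first lra.
    by rewrite [LHS]row2E [RHS]row2E !mxE /=; congr row2; lra.
  - by apply: edist2E; rewrite ?lexx// !mxE /=; lra.
  - by exists 0; rewrite ?lexx ?ler01// scale0r addr0 subr0 scale1r.
rewrite -(ler_pXn2r (_ : 0 < 2)%N) ?nnegrE ?mdist_ge0 ?sqrtr_ge0//.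
rewrite sqr_edist2 !mxE /= !(metric_sym p).
lra.
Qed.

End MidpointInequality.

(** * Flat strips and flat planes *)

Section RealFunctions.
Variable R : realType.

Lemma archi_mul_gt (d B : R) : 0 < d -> exists n : nat, B < n%:R * d.
Proof.
move=> d0; exists (Num.truncn `|B / d|).+1.
rewrite -ltr_pdivrMr//; apply: le_lt_trans (ler_norm _) _.
by rewrite truncnS_gt.
Qed.

(** If [h s > h r], midconvexity keeps the increments along the progression [s + n (s - r)] at least
    [h s - h r], so [h] is unbounded. *)
Lemma midconvex_bounded_const (h : R -> R) (B : R) :
  (forall r n, 2 * h r <= h (r - n) + h (r + n)) -> (forall r, h r <= B) ->
  forall r s, h r = h s.
Proof.
move=> hc hB; suff H r s : h s <= h r by move=> r s; apply/le_anti; rewrite !H.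
rewrite leNgt; apply/negP => rs; pose d := h s - h r; pose t := s - r.
have inc n : d <= h (s + n.+1%:R * t) - h (s + n%:R * t).
  elim: n => [|n IHn].
    have -> : s + 1%:R * t = s + t by lra.
    have -> : s + 0%:R * t = s by lra.
    have := hc s t; have -> : s - t = r by rewrite /t; lra.
    by rewrite /d; lra.
  have := hc (s + n.+1%:R * t) t.
  have -> : s + n.+1%:R * t - t = s + n%:R * t by rewrite -[n.+1%:R]natr1; lra.
  have -> : s + n.+1%:R * t + t = s + n.+2%:R * t by rewrite -[n.+2%:R]natr1; lra.
  lra.
have big n : h s + n%:R * d <= h (s + n%:R * t).
  elim: n => [|n IHn]; first by rewrite !mul0r !addr0.
  have := inc n; rewrite -[n.+1%:R]natr1; lra.
have d0 : 0 < d by rewrite subr_gt0.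
have [n nB] := archi_mul_gt (B - h s) d0.
have := hB (s + n%:R * t); have := big n; lra.
Qed.

(** The function [g x - g 1 * x] is additive and vanishes on the integers, so a bound on the unit
    interval holds everywhere and the function is constant. *)
Lemma additive_bounded_linear (g : R -> R) (C : R) :
  (forall x y, g (x + y) = g x + g y) -> (forall x, `|x| <= 1 -> g x <= C) ->
  forall x, g x = g 1 * x.
Proof.
move=> gD gC; pose h x := g x - g 1 * x.
have hD x y : h (x + y) = h x + h y by rewrite /h gD; lra.
have h1 : h 1 = 0 by rewrite /h mulr1 subrr.
have h0 : h 0 = 0 by have := hD 0 0; rewrite addr0; lra.
have hN x : h (- x) = - h x by have := hD x (- x); rewrite subrr h0; lra.
have hn (n : nat) : h n%:R = 0.
  by elim: n => [|n IHn]; rewrite ?h0// -natr1 hD IHn h1 addr0.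
have hz (z : int) : h z%:~R = 0.
  by case: z => n; [exact: hn|rewrite NegzE mulrNz hN hn oppr0].
suff hB x : h x <= C + `|g 1|.
  move=> x; have hc r n : 2 * h r <= h (r - n) + h (r + n).
    by rewrite !hD hN; lra.
  have := midconvex_bounded_const hc hB x 0.
  by rewrite h0 /h => /eqP; rewrite subr_eq0 => /eqP.
have -> : h x = h (x - (Num.floor x)%:~R) by rewrite hD hN hz oppr0 addr0.
set f := x - _; have f01 : 0 <= f <= 1.
  have /andP[f0 f1] := floor_itv x.
  by rewrite /f; move: f1; rewrite intrD; lra.
have := gC f; rewrite /h ger0_norm; last by case/andP: f01.
have /andP[f0 f1] := f01; move=> /(_ f1) gf; have := lexx (g 1).
have : `|g 1 * f| <= `|g 1| by rewrite normrM (ger0_norm f0) ler_piMr.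
rewrite ler_norml => /andP[]; lra.
Qed.

End RealFunctions.

Section MidpointGeometry.
Variables (R : realType) (X : metricType R).

Definition midpoint (x y m : X) :=
  mdist x m = mdist x y / 2 /\ mdist m y = mdist x y / 2.

Hypothesis CN : forall x y : X, exists m,
  [/\ mdist x m = mdist x y / 2, mdist m y = mdist x y / 2 &
    forall p, mdist p m ^+ 2 <=
      (mdist p x ^+ 2 + mdist p y ^+ 2) / 2 - mdist x y ^+ 2 / 4].

Lemma midpoint_ex x y : exists m, midpoint x y m.
Proof. by have [m []] := CN x y; exists m. Qed.

Lemma midpoint_sqr x y m p : midpoint x y m -> mdist p m ^+ 2 <=
  (mdist p x ^+ 2 + mdist p y ^+ 2) / 2 - mdist x y ^+ 2 / 4.
Proof.
move=> [xm my]; have [m' [xm' my' m'P]] := CN x y.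
suff -> : m = m' by [].
apply: mdist_positivity; have := m'P m; rewrite (metric_sym m x) xm my => le0.
apply/eqP; rewrite -sqrf_eq0 eq_le sqr_ge0 andbT; lra.
Qed.

Lemma midpoint_midline x y z m1 m2 : midpoint x y m1 -> midpoint x z m2 ->
  mdist m1 m2 <= mdist y z / 2.
Proof.
move=> xy xz; rewrite -(ler_pXn2r (_ : 0 < 2)%N) ?nnegrE ?divr_ge0 ?mdist_ge0//.
have := midpoint_sqr m2 xy; have := midpoint_sqr y xz; have [xm2 _] := xz.
rewrite (metric_sym m2 m1) (metric_sym m2 x) (metric_sym m2 y) xm2 (metric_sym y x).
lra.
Qed.

Lemma midpoint_sym x y m : midpoint x y m -> midpoint y x m.
Proof. by move=> [xm my]; split; rewrite metric_sym (metric_sym y x). Qed.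

Lemma midpoint_convex x y x' y' m m' : midpoint x y m -> midpoint x' y' m' ->
  2 * mdist m m' <= mdist x x' + mdist y y'.
Proof.
move=> xy xy'; have [n xny'] := midpoint_ex x y'.
have := midpoint_midline xy xny'.
have := midpoint_midline (midpoint_sym xny') (midpoint_sym xy').
have := metric_triangle m n m'; lra.
Qed.

(** The midpoint inequality for one diagonal, seen from both remaining vertices, is added up. It
    supplies the concavity in the flat strip argument. *)
Lemma quadrilateral (p q r s : X) : mdist p r ^+ 2 + mdist q s ^+ 2 <=
  mdist p q ^+ 2 + mdist q r ^+ 2 + mdist r s ^+ 2 + mdist s p ^+ 2.
Proof.
have [n pr] := midpoint_ex p r.
have := midpoint_sqr q pr; have := midpoint_sqr s pr.
rewrite (metric_sym q p) (metric_sym s r).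
have : mdist q s ^+ 2 <= (mdist q n + mdist s n) ^+ 2.
  rewrite ler_pXn2r ?nnegrE ?addr_ge0 ?mdist_ge0//.
  by rewrite (metric_sym s n) metric_triangle.
have := sqr_ge0 (mdist q n - mdist s n); lra.
Qed.

Definition line (A : R -> X) := forall r s, mdist (A r) (A s) = `|r - s|.

Lemma line_midpoint A r n : line A -> midpoint (A (r - n)) (A (r + n)) (A r).
Proof.
move=> Al; rewrite /midpoint !Al.
have -> : r - n - (r + n) = - (2 * n) by lra.
have -> : r - n - r = - n by lra.
have -> : r - (r + n) = - n by lra.
by rewrite !normrN normrM (ger0_norm (_ : 0 <= 2)) ?ler0n// mulrC mulKf ?pnatr_eq0.
Qed.

Definition parallel (A A' : R -> X) :=
  exists B, forall r, mdist (A r) (A' r) <= B.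

Lemma parallel_const A A' : line A -> line A' -> parallel A A' ->
  forall r k, mdist (A r) (A' (r + k)) = mdist (A 0) (A' k).
Proof.
move=> Al Al' [B AB] r k; rewrite -[in RHS](add0r k).
apply: (@midconvex_bounded_const R (fun r => mdist (A r) (A' (r + k))) (B + `|k|)).
  move=> s n; apply: midpoint_convex; first exact: line_midpoint.
  by rewrite !(addrAC s _ k); exact: line_midpoint.
move=> s; apply: le_trans (metric_triangle _ (A' s) _) _.
by rewrite lerD// Al' opprD addNKr normrN.
Qed.

(** [E] is midconvex by the midpoint inequality on [A'] and midconcave by the quadrilateral
    inequality. So [E - E 0] is additive, and being bounded above near 0 it is linear. *)
Lemma flat_strip A A' : line A -> line A' -> parallel A A' ->
  exists a, forall r k, mdist (A r) (A' (r + k)) ^+ 2 =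
    k ^+ 2 + a * k + mdist (A 0) (A' 0) ^+ 2.
Proof.
move=> Al Al' AA'; have pc := parallel_const Al Al' AA'.
pose D k := mdist (A 0) (A' k); pose E k := D k ^+ 2 - k ^+ 2.
have mid_le k n : E (k + n) + E (k - n) <= 2 * E k.
  have := quadrilateral (A 0) (A n) (A' (k + n)) (A' k).
  rewrite (metric_sym (A' k)) !Al !Al' -/(D _) -/(D _).
  have -> : mdist (A n) (A' k) = D (k - n) by rewrite -[k in LHS](subrK n) addrC pc.
  have -> : mdist (A n) (A' (k + n)) = D k by rewrite addrC pc.
  by rewrite !real_normK ?num_real// /E; lra.
have mid_ge k n : 2 * E k <= E (k + n) + E (k - n).
  have := midpoint_sqr (A 0) (line_midpoint k n Al').
  by rewrite -!/(D _) Al' real_normK ?num_real// /E; lra.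
have midE k n : E (k + n) + E (k - n) = 2 * E k by apply/le_anti; rewrite mid_le mid_ge.
pose g k := E k - E 0.
have gD x y : g (x + y) = g x + g y.
  have := midE ((x + y) / 2) ((x + y) / 2); have := midE ((x + y) / 2) ((x - y) / 2).
  rewrite subrr -splitr.
  have -> : (x + y) / 2 + (x - y) / 2 = x by lra.
  have -> : (x + y) / 2 - (x - y) / 2 = y by lra.
  rewrite /g; lra.
have gC x : `|x| <= 1 -> g x <= 2 * D 0 + 1.
  move=> x1; have D0 : 0 <= D 0 := mdist_ge0 _ _.
  have : D x <= D 0 + `|x|.
    by apply: le_trans (metric_triangle _ (A' 0) _) _; rewrite Al' sub0r normrN.
  have Dx : 0 <= D x := mdist_ge0 _ _.
  have x0 := normr_ge0 x; rewrite /g /E -[x ^+ 2]real_normK ?num_real//.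
  move: (D x) (D 0) `|x| x1 x0 Dx D0 => a b c; nra.
exists (g 1) => r k; rewrite pc -/(D k) -/(D 0).
have := additive_bounded_linear gD gC k; rewrite /g /E; lra.
Qed.

(** The transversals are lines too, as parallel lines keep their distance. The strip formulas in the
    two directions compute the same distance, which makes the mixed term linear in both [k] and [j]
    and independent of the base point. *)
Lemma flat_plane (A : R -> R -> X) : (forall s, line (A s)) ->
  line (A^~ 0) -> (forall s s', parallel (A s) (A s')) ->
  exists a, forall r s k j, mdist (A s r) (A (s + j) (r + k)) ^+ 2 =
    k ^+ 2 + a * k * j + j ^+ 2.
Proof.
move=> Al Ll Ap.
have [a1 a1P] := choice (fun sj => flat_strip (Al sj.1) (Al (sj.1 + sj.2))
  (Ap sj.1 (sj.1 + sj.2))).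
have Bl r : line (A^~ r).
  move=> s s'; have := parallel_const (Al s) (Al s') (Ap s s') r 0.
  by rewrite addr0 => ->; exact: Ll.
have Bp r r' : parallel (A^~ r) (A^~ r') by exists `|r - r'| => s; rewrite Al.
have [a2 a2P] := choice (fun rk => flat_strip (Bl rk.1) (Bl (rk.1 + rk.2))
  (Bp rk.1 (rk.1 + rk.2))).
have E1 r s k j : mdist (A s r) (A (s + j) (r + k)) ^+ 2 =
    k ^+ 2 + a1 (s, j) * k + j ^+ 2.
  have /= -> := a1P (s, j) r k; congr (_ + _).
  have /= -> := Ll s (s + j); rewrite real_normK ?num_real//; lra.
have E2 r s k j : mdist (A s r) (A (s + j) (r + k)) ^+ 2 =
    j ^+ 2 + a2 (r, k) * j + k ^+ 2.
  have /= -> := a2P (r, k) s j; congr (_ + _).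
  rewrite Al real_normK ?num_real//; lra.
exists (a1 (0, 1)) => r s k j; rewrite E1.
have := E1 r 0 k 1; rewrite E2 => e1; have := E1 r s k j; rewrite E2 => e2.
suff -> : a1 (s, j) * k = a1 (0, 1) * k * j by [].
have -> : a1 (s, j) * k = a2 (r, k) * j by lra.
by have -> : a2 (r, k) = a1 (0, 1) * k by lra.
Qed.

(** The numbers [a / 2] and [b] are the cosine and the sine of the angle between the two families of
    lines; [f] passes from orthonormal to oblique coordinates. *)
Lemma plane_flat (A : R -> R -> X) (a : R) : a ^+ 2 < 4 ->
  (forall r s k j, mdist (A s r) (A (s + j) (r + k)) ^+ 2 =
    k ^+ 2 + a * k * j + j ^+ 2) ->
  exists2 F, flat F & forall s r, F (A s r).
Proof.
move=> a4 AE; pose b := Num.sqrt (1 - a ^+ 2 / 4).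
have b2 : b ^+ 2 = 1 - a ^+ 2 / 4 by rewrite sqr_sqrtr; lra.
have b0 : 0 < b by rewrite sqrtr_gt0; lra.
have b_neq0 := lt0r_neq0 b0.
pose f (u : 'rV[R]_2) :=
  A (u ord0 ord_max / b) (u ord0 ord0 - a / 2 * (u ord0 ord_max / b)).
exists (range f).
  exists 2%N, f; split=> // u v; apply/esym/edist2E; first exact: mdist_ge0.
  rewrite /f; move: (u ord0 ord0) (v ord0 ord0) => u0 v0.
  have [s us] : exists s, u ord0 ord_max = b * s.
    by exists (u ord0 ord_max / b); rewrite mulrC divfK.
  have [t vt] : exists t, v ord0 ord_max = b * t.
    by exists (v ord0 ord_max / b); rewrite mulrC divfK.
  rewrite us vt ![b * _]mulrC !mulfK//.
  have := AE (u0 - a / 2 * s) s (v0 - a / 2 * t - (u0 - a / 2 * s)) (t - s).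
  rewrite (addrC s) (addrC (u0 - _)) !subrK => ->.
  have -> : (s * b - t * b) ^+ 2 = (s - t) ^+ 2 * b ^+ 2 by rewrite -mulrBl exprMn.
  rewrite b2; lra.
move=> s r; exists (row2 (r + a / 2 * s) (b * s)) => //.
by rewrite /f !mxE /= [b * s]mulrC mulfK// addrK.
Qed.

End MidpointGeometry.

(** * Geometric actions *)

Lemma infinite_injective (T : Type) (A : set T) (f : nat -> T) :
  injective f -> (forall n, A (f n)) -> ~ finite_set A.
Proof.
move=> f_inj fA finA; apply: infinite_nat.
have fin : finite_set (f @^-1` A) by apply: finite_preimage => // i j _ _ /f_inj.
by apply: sub_finite_set fin => n _; exact: fA.
Qed.

Lemma seq_min (T : eqType) (R : realType) (f : T -> R) (s : seq T) x0 :
  x0 \in s -> exists2 x, x \in s & {in s, forall y, f x <= f y}.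
Proof.
elim: s x0 => [//|x s IHs] x0 _; have [[|y s'] sE] : exists s', s = s' by exists s.
  by exists x; rewrite ?mem_head// sE => y; rewrite inE => /eqP->.
have [|z zs zmin] := IHs y; first by rewrite sE mem_head.
have [xz|zx] := leP (f x) (f z).
  exists x; rewrite ?mem_head// => w; rewrite inE => /orP[/eqP->//|ws].
  exact: le_trans xz (zmin _ ws).
exists z; rewrite ?inE ?zs ?orbT// => w; rewrite inE => /orP[/eqP->|/zmin//].
exact: ltW.
Qed.

(** * Compactness in metric spaces *)

Section CompactMetric.
Variables (R : realType) (X : metricType R).
Implicit Types (A : set X) (x y : X).

Lemma compact_balls A (r : X -> R) : compact A -> (forall x, A x -> 0 < r x) ->
  exists s : seq X, (forall x, x \in s -> A x) /\
    forall y, A y -> exists2 x, x \in s & mdist x y < r x.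
Proof.
move=> /compact_near_coveringP cA r0.
(* With lists of centres filtered by inclusion, compactness in its near-covering form yields a
   finite subcover. *)
pose F : set_system (seq X) :=
  filter_from setT (fun s : seq X => [set s' : seq X | {subset s <= s'}]).
have FF : Filter F.
  apply: filter_from_filter; first by exists [::].
  move=> s s' _ _; exists (s ++ s') => // t st.
  by split=> x xs; apply: st; rewrite mem_cat xs ?orbT.
pose P (s : seq X) y := exists2 x, x \in s /\ A x & mdist x y < r x.
have [|s _ sP] := cA _ F P FF.
  move=> x Ax; exists (ball x (r x), [set s | x \in s]) => /=; last first.
    by case=> y s /= [xy xs]; exists x => //; move: xy; rewrite ballEmdist.
  split; first exact: (nbhsx_ballx x _ (r0 _ Ax)).
  by exists [:: x] => // s /(_ x); apply; rewrite mem_head.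
exists [seq x <- s | `[< A x >]]; split=> [x|y Ay].
  by rewrite mem_filter => /andP[/asboolP].
have [x [xs Ax] xy] := sP s (fun _ => id) y Ay.
by exists x => //; rewrite mem_filter xs andbT; apply/asboolP.
Qed.

(** Without a minimum each feasible [x] has a better feasible [h x]. The ball of radius [r x] at a
    feasible [x] contains only points worse than [h x], and at an infeasible [x] only infeasible
    points. But the best of the finitely many [h x] of a subcover lies in such a ball itself. *)
Lemma compact_constrained_min A (f g : X -> R) (l : R) : compact A ->
  (forall x y, f x <= f y + 2 * mdist x y) ->
  (forall x y, g x <= g y + 2 * mdist x y) ->
  (exists2 x, A x & g x <= l) ->
  exists x, [/\ A x, g x <= l & forall y, A y -> g y <= l -> f x <= f y].
Proof.
move=> cA fL gL [x0 Ax0 gx0]; apply: contrapT => nomin.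
have low x : exists y, A x -> g x <= l -> [/\ A y, g y <= l & f y < f x].
  have [[Ax gx]|nx] := pselect (A x /\ g x <= l); last first.
    by exists x => Ax gx; case: nx.
  apply: contrapT => ny; apply: nomin; exists x; split=> // y Ay gy.
  rewrite leNgt; apply/negP => yx; apply: ny; by exists y.
have [h hP] := choice low.
pose r x := if g x <= l then (f x - f (h x)) / 2 else (g x - l) / 2.
have r0 x : A x -> 0 < r x.
  move=> Ax; rewrite /r; case: (leP (g x) l) => [gx|]; last lra.
  by have [_ _] := hP _ Ax gx; lra.
have [s [sA sc]] := compact_balls cA r0.
have cover x : A x -> g x <= l -> exists2 y, y \in [seq y <- s | g y <= l] &
    f (h y) < f x.
  move=> Ax gx; have [y ys] := sc _ Ax; rewrite /r.
  case: (leP (g y) l) => gy yx.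
    by exists y; [rewrite mem_filter gy|have := fL y x; lra].
  by have := gL y x; lra.
have [y ys _] := cover _ Ax0 gx0.
have [z zs zmin] := seq_min (f \o h) ys.
move: (zs); rewrite mem_filter => /andP[gz /sA Az].
have [Ahz ghz _] := hP _ Az gz.
have [w ws] := cover _ Ahz ghz; have := zmin _ ws; rewrite /=; lra.
Qed.

Lemma compact_cvg_seq x (y : nat -> X) :
  (forall d, 0 < d -> exists N : nat, forall n, (N <= n)%N -> mdist x (y n) < d) ->
  compact (x |` range y).
Proof.
move=> yx F FF FA; have [Fx|nFx] := pselect (cluster F x).
  by exists x; split=> //; left.
have [B [U [FB Ux BU]]] : exists B U, [/\ F B, nbhs x U & B `&` U = set0].
  move: nFx => /existsNP[B /existsNP[U /not_implyP[FB /not_implyP[Ux BU]]]].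
  by exists B, U; split=> //; apply: contrapT => /eqP/set0P.
move: Ux => /nbhs_ballP[d d0 dU]; have [N yN] := yx _ d0.
have FS : F (y @` `I_N).
  apply: filterS (filterI FA FB) => _ [[->|[n _ <-]] Bz].
    have : (B `&` U) x by split=> //; apply: dU; rewrite ballEmdist /= mdistxx.
    by rewrite BU.
  exists n => //=; rewrite ltnNge; apply/negP => /yN nd.
  have : (B `&` U) (y n) by split=> //; apply: dU; rewrite ballEmdist.
  by rewrite BU.
have cS : compact (y @` `I_N) by apply: finite_compact; exact: finite_image.
have [_ [[n _ <-] Fz]] := cS F FF FS.
by exists (y n); split=> //; right; exists n.
Qed.

End CompactMetric.

(** * Finiteness and minimal displacement for geometric actions *)

Section GeometricAction.
Variables (R : realType) (X : metricType R) (G : groupType) (act : G -> X -> X).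
Hypothesis geo : forall x y : X, exists c, geodesic x y c.
Hypothesis act1 : forall x, act 1%g x = x.
Hypothesis actM : forall g h x, act (g * h)%g x = act g (act h x).
Hypothesis act_iso : forall g x y, mdist (act g x) (act g y) = mdist x y.
Hypothesis act_pd : properly_discontinuous act.
Variable K : set X.
Hypothesis cK : compact K.
Hypothesis KX : forall x, exists h k, K k /\ x = act h k.
Implicit Types (g h : G) (x y : X).

Lemma actV g x : act g^-1%g (act g x) = x.
Proof. by rewrite -actM mulVg act1. Qed.

Lemma act_conj h g x y : mdist (act h x) (act g (act h y)) =
  mdist x (act (h^-1 * g * h)%g y).
Proof. by rewrite -(act_iso h^-1%g) actV !actM. Qed.

Lemma displacement_lipschitz g x y :
  mdist x (act g x) <= mdist y (act g y) + 2 * mdist x y.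
Proof.
have := metric_triangle x y (act g x); have := metric_triangle y (act g y) (act g x).
rewrite act_iso (metric_sym y x); lra.
Qed.

Definition moves (c : R) : set G :=
  [set g | exists x y, [/\ K x, K y & mdist x (act g y) <= c]].

(** If infinitely many distinct [g n] brought points [y n] of [K] ever closer to [x], then [K], [x]
    and the points [act (g n) (y n)] would form a compact set violating proper discontinuity. *)
Lemma moves_locally_finite x : exists2 d : R, 0 < d &
  finite_set [set g | exists2 y, K y & mdist x (act g y) < d].
Proof.
apply: contrapT => nfin.
have far (sn : seq G * nat) : exists gy : G * X,
    [/\ gy.1 \notin sn.1, K gy.2 & mdist x (act gy.1 gy.2) < sn.2.+1%:R^-1].
  apply: contrapT => ngy; apply: nfin; exists sn.2.+1%:R^-1; first by rewrite invr_gt0.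
  apply: sub_finite_set (finite_seq sn.1) => g [y Ky xy].
  by apply/negPn/negP => gs; apply: ngy; exists (g, y).
have [F FP] := choice far.
(* The elements already chosen, so that [F] has to pick a new one. *)
pose l := fix l n := if n is k.+1 then (F (l k, k)).1 :: l k else [::].
pose g n := (F (l n, n)).1; pose y n := (F (l n, n)).2.
have gl i j : (i < j)%N -> g i \in l j.
  elim: j => [//|j IHj]; rewrite ltnS leq_eqVlt => /orP[/eqP->|/IHj gj].
    by rewrite /= mem_head.
  by rewrite /= inE gj orbT.
have g_inj : injective g.
  have gneq i j : (i < j)%N -> g i <> g j.
    by move=> /gl + gij; rewrite gij; have [/negP] := FP (l j, j).
  by move=> i j gij; case: (ltngtP i j) => // /gneq; rewrite gij.
have ygx d : 0 < d -> exists N : nat, forall n, (N <= n)%N ->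
    mdist x (act (g n) (y n)) < d.
  move=> d0; have [N Nd] := archi_mul_gt 1 d0; exists N => n Nn.
  have [_ _ /lt_trans] := FP (l n, n); apply => /=.
  rewrite invf_plt ?posrE//.
  have nd : d^-1 < N%:R by rewrite -[d^-1]mul1r ltr_pdivrMr.
  by apply: (lt_le_trans nd); rewrite ler_nat ltnW.
have cK' := compactU (compact_cvg_seq ygx) cK.
apply: (infinite_injective g_inj _ (act_pd cK')) => n.
exists (act (g n) (y n)); split; last by left; right; exists n.
by exists (y n) => //; right; have [_ Ky _] := FP (l n, n).
Qed.

Lemma moves_finite0 : exists2 d : R, 0 < d & finite_set (moves d).
Proof.
have [r rP] : exists r : X -> R, forall x, 0 < r x /\
    finite_set [set g | exists2 y, K y & mdist x (act g y) < r x].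
  have h x : exists d : R, 0 < d /\
      finite_set [set g | exists2 y, K y & mdist x (act g y) < d].
    by have [d d0 fin] := moves_locally_finite x; exists d.
  by have [r rP] := choice h; exists r.
have [|s [sK sc]] := @compact_balls _ _ K (fun x => r x / 2) cK.
  by move=> x _; have [r0 _] := rP x; rewrite divr_gt0.
have [d d0 ds] : exists2 d : R, 0 < d & {in s, forall x, d <= r x / 2}.
  elim: s {sK sc} => [|x s [d d0 ds]]; first by exists 1.
  have [r0 _] := rP x; exists (Num.min d (r x / 2)).
    by rewrite lt_min d0 divr_gt0.
  move=> y; rewrite inE ge_min => /orP[/eqP->|/ds->//].
  by rewrite lexx orbT.
exists (d / 2); first by rewrite divr_gt0.
apply: (@sub_finite_set _ _ (\bigcup_(x in [set` s])
    [set g | exists2 y, K y & mdist x (act g y) < r x])); last first.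
  by apply: bigcup_finite => // x _; have [] := rP x.
move=> g [x [y [Kx Ky xy]]]; have [z zs zx] := sc _ Kx; exists z => //.
exists y => //; have := ds _ zs; have := metric_triangle z x (act g y); lra.
Qed.

(** Finiteness spreads along geodesics in steps of length [d]: an intermediate point lies in a
    translate of [K] by some [h], and [g] factors as [h] times [h^-1 * g]. *)
Lemma moves_finite c : finite_set (moves c).
Proof.
have [d d0 fin] := moves_finite0.
have finn n : finite_set (moves (n%:R * d)).
  elim: n => [|n IHn].
    apply: sub_finite_set fin => g [x [y [Kx Ky xy]]]; exists x, y; split=> //.
    by apply: le_trans xy _; rewrite mul0r ltW.
  apply: sub_finite_set (finite_image2 *%g IHn fin) => g [x [y [Kx Ky xy]]].
  suff [z [xz zy]] : exists z, mdist x z <= n%:R * d /\ mdist z (act g y) <= d.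
    have [h [k [Kk zE]]] := KX z; exists h; first by exists x, k; rewrite -zE.
    exists (h^-1 * g)%g; last by rewrite mulVKg.
    by exists k, y; split=> //; rewrite -(act_iso h) -actM mulVKg -zE.
  have [xyn|nxy] := leP (mdist x (act g y)) (n%:R * d).
    by exists (act g y); split=> //; rewrite mdistxx ltW.
  have nd0 : 0 <= n%:R * d by rewrite mulr_ge0// ltW.
  have [p [p0 p1 pd]] := geo x (act g y); exists (p (n%:R * d)); split.
    have := pd 0 (n%:R * d); rewrite p0 lexx mdist_ge0 nd0 ltW// => -> //.
    by rewrite sub0r normrN ger0_norm.
  have := pd (n%:R * d) (mdist x (act g y)).
  rewrite p1 lexx mdist_ge0 nd0 ltW// => -> //.
  by rewrite ler0_norm; move: xy; rewrite -natr1; lra.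
have [n nc] := archi_mul_gt c d0; apply: sub_finite_set (finn n) => g.
by move=> [x [y [Kx Ky xy]]]; exists x, y; split=> //; apply: le_trans xy (ltW nc).
Qed.

Lemma displacement_finite x c : finite_set [set g | mdist x (act g x) <= c].
Proof.
have [h [k [Kk xE]]] := KX x.
have fin := finite_image (fun g => h * g * h^-1)%g (moves_finite c).
apply: sub_finite_set fin => g /= gx; exists (h^-1 * g * h)%g; last first.
  by rewrite !mulgA mulgV mul1g mulgK.
by exists k, k; split=> //; rewrite -act_conj -xE.
Qed.

(** Moving the point into [K] replaces [t] and [c] by a simultaneous conjugate. Only finitely many
    such pairs have displacements bounded by [b] and [l] on [K], and each attains its constrained
    minimum there by compactness. *)
Lemma displacement_min (t c : G) (l : R) : (exists x, mdist x (act c x) <= l) ->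
  exists x, mdist x (act c x) <= l /\
    forall y, mdist y (act c y) <= l -> mdist x (act t x) <= mdist y (act t y).
Proof.
move=> [x1 x1l]; set b := mdist x1 (act t x1).
pose cand (p : G * G) := (exists h, p = (h^-1 * t * h, h^-1 * c * h)%g) /\
  exists2 k, K k & mdist k (act p.2 k) <= l.
have km p : exists k, cand p -> [/\ K k, mdist k (act p.2 k) <= l &
    forall k', K k' -> mdist k' (act p.2 k') <= l ->
      mdist k (act p.1 k) <= mdist k' (act p.1 k')].
  have [[_ pk]|np] := pselect (cand p); last by exists x1.
  have [k kP] := compact_constrained_min cK (displacement_lipschitz p.1)
    (displacement_lipschitz p.2) pk.
  by exists k.
have [kf kfP] := choice km.
have /finite_seqP[s sE] := finite_setX (moves_finite b) (moves_finite l).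
have in_s y : mdist y (act c y) <= l -> mdist y (act t y) <= b ->
    exists p, [/\ p \in s, cand p &
      mdist (kf p) (act p.1 (kf p)) <= mdist y (act t y)].
  move=> yl yb; have [h [k [Kk yE]]] := KX y.
  pose p := (h^-1 * t * h, h^-1 * c * h)%g.
  have pc : cand p.
    by split; [exists h|exists k => //; rewrite -act_conj -yE].
  exists p; split=> //.
    suff : [set` s] p by [].
    rewrite -sE; split; exists k, k; split=> //; by rewrite -act_conj -yE.
  have [_ _ kmin] := kfP _ pc; rewrite yE act_conj.
  by apply: kmin => //; rewrite -act_conj -yE.
have [p0 [p0s p0c p0b]] := in_s _ x1l (lexx _).
have p0s' : p0 \in [seq p <- s | `[< cand p >]].
  by rewrite mem_filter p0s andbT; apply/asboolP.
have [p ps pmin] := seq_min (fun p => mdist (kf p) (act p.1 (kf p))) p0s'.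
have pmin' q : q \in s -> cand q ->
    mdist (kf p) (act p.1 (kf p)) <= mdist (kf q) (act q.1 (kf q)).
  by move=> qs qc; apply: pmin; rewrite mem_filter qs andbT; apply/asboolP.
move: ps; rewrite mem_filter => /andP[/asboolP pc _].
have [[h pE] _] := pc; have [Kk kl _] := kfP _ pc.
exists (act h (kf p)); rewrite !act_conj; rewrite pE /= in kl pmin pmin' *.
split=> // y yl; have [yb|/ltW yb] := leP (mdist y (act t y)) b.
  by have [q [qs qc /(le_trans _)]] := in_s _ yl yb; apply; exact: pmin'.
by apply: le_trans yb; apply: le_trans p0b; exact: pmin'.
Qed.

End GeometricAction.

Section IntegerPowers.
Variable G : groupType.
Implicit Types (g h : G).

Definition zexp g (z : int) : G :=
  match z with Posz n => (g ^+ n)%g | Negz n => (g ^- n.+1)%g end.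

Lemma zexpS g z : zexp g (z + 1) = (zexp g z * g)%g.
Proof.
case: z => [n|[|n]].
- by rewrite -[Posz n + 1]/(Posz (n + 1)) addn1 /= expgSr.
- by rewrite -[Negz 0 + 1]/(Posz 0) /= expg0 expg1 mulVg.
- rewrite -[Negz n.+1 + 1]/(Negz (n.+1 - 1)) subSS subn0 /=.
  by rewrite (expgS g n.+1) invgM mulgVK.
Qed.

Lemma zexpD g (a b : int) : zexp g (a + b) = (zexp g a * zexp g b)%g.
Proof.
have zn (c : int) n : zexp g (c + Posz n) = (zexp g c * g ^+ n)%g.
  elim: n => [|n IHn]; first by rewrite addr0 expg0 mulg1.
  by rewrite -addn1 PoszD addrA zexpS IHn addn1 expgSr mulgA.
case: b => n; first exact: zn.
by rewrite NegzE -[in RHS](subrK (Posz n.+1) a) zn /= mulgK.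
Qed.

Lemma zexp_commute g h a : commute g h -> commute (zexp g a) h.
Proof.
move=> gh; apply: commute_sym; case: a => n /=; last apply: commuteV;
  by apply: commuteX; exact: commute_sym.
Qed.

End IntegerPowers.

(** * Translation lengths, torsion and axes *)

Section GeometricAction.
Variables (R : realType) (X : metricType R) (G : groupType) (act : G -> X -> X).
Hypothesis cat0 : CAT0 X.
Hypothesis act1 : forall x, act 1%g x = x.
Hypothesis actM : forall g h x, act (g * h)%g x = act g (act h x).
Hypothesis act_iso : forall g x y, mdist (act g x) (act g y) = mdist x y.
Hypothesis act_pd : properly_discontinuous act.
Variable K : set X.
Hypothesis cK : compact K.
Hypothesis KX : forall x, exists h k, K k /\ x = act h k.
Implicit Types (g h : G) (x y : X).

Let geo : forall x y : X, exists c, geodesic x y c. Proof. by case: cat0. Qed.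
Let CN := midpoint_CN cat0.

Lemma act_midpoint g x y m : midpoint x y m ->
  midpoint (act g x) (act g y) (act g m).
Proof. by move=> [xm my]; split; rewrite !act_iso. Qed.

(** Lower bounds double from [h] to [h * h]: [h] moves the midpoint of [y] and [act h y] at most
    half as far as [h * h] moves [y]. This settles powers of two, and the triangle inequality
    between [n] and [2 ^ n] settles the rest. *)
Lemma min_orbit (Y : set X) g (l : R) x : 0 <= l ->
  (forall y z m, Y y -> Y z -> midpoint y z m -> Y m) ->
  (forall y, Y y -> Y (act g y)) ->
  (forall y, Y y -> l <= mdist y (act g y)) ->
  Y x -> mdist x (act g x) <= l ->
  forall n, mdist x (act (g ^+ n)%g x) = n%:R * l.
Proof.
move=> l0 Ymid; have double h (r : R) : (forall y, Y y -> Y (act h y)) ->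
    (forall y, Y y -> r <= mdist y (act h y)) ->
    (forall y, Y y -> 2 * r <= mdist y (act (h * h)%g y)).
  move=> Yh Yr y Yy; have [m ym] := midpoint_ex CN y (act h y).
  have := midpoint_midline CN (midpoint_sym ym) (act_midpoint h ym).
  have := Yr m (Ymid _ _ _ Yy (Yh _ Yy) ym); rewrite actM; lra.
move=> Yg Yl Yx xl n.
have pow2 k : (forall y, Y y -> Y (act (g ^+ (2 ^ k))%g y)) /\
    forall y, Y y -> (2 ^ k)%:R * l <= mdist y (act (g ^+ (2 ^ k))%g y).
  elim: k => [|k [Yk lk]]; first by rewrite expn0 expg1 mul1r.
  rewrite expnS mul2n -addnn expgnDr natrD; split=> y Yy.
    by rewrite actM; apply/Yk/Yk.
  by have := double _ _ Yk lk y Yy; lra.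
have up i : mdist x (act (g ^+ i)%g x) <= i%:R * l.
  elim: i => [|i IHi]; first by rewrite expg0 act1 mdistxx mul0r.
  have := metric_triangle x (act g x) (act (g ^+ i.+1)%g x).
  by rewrite expgS actM act_iso -natr1; lra.
apply/le_anti; rewrite up /=; have nk : (n <= 2 ^ n)%N by rewrite ltnW// ltn_expl.
have := (pow2 n).2 x Yx; rewrite -{1 2}(subnKC nk) expgnDr natrD actM.
have := metric_triangle x (act (g ^+ n)%g x) (act (g ^+ n)%g (act (g ^+ (2 ^ n - n))%g x)).
rewrite act_iso; have := up (2 ^ n - n)%N; lra.
Qed.

Lemma not_all_fixed (f : nat -> G) x (B : R) : injective f ->
  ~ forall n, mdist x (act (f n) x) <= B.
Proof.
move=> f_inj fB; have fin := displacement_finite geo act1 actM act_iso act_pd cK KX x B.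
exact: (infinite_injective f_inj fB fin).
Qed.

Lemma min_displacement_orbit g : X -> exists x (l : R), [/\ 0 <= l,
  forall y, l <= mdist y (act g y) &
  forall n, mdist x (act (g ^+ n)%g x) = n%:R * l].
Proof.
move=> x0; have [|x [_ xmin]] := displacement_min geo act1 actM act_iso act_pd cK KX
    g (c := 1%g) (l := 0) _.
  by exists x0; rewrite act1 mdistxx.
have {}xmin y : mdist x (act g x) <= mdist y (act g y).
  by apply: xmin; rewrite act1 mdistxx.
exists x, (mdist x (act g x)); split=> //; first exact: mdist_ge0.
by apply: (@min_orbit setT); rewrite ?mdist_ge0.
Qed.

(** A torsion element has minimal displacement 0, hence fixes a point, and this point can be moved
    into [K]. *)
Lemma torsion_classes : X -> exists T : set G, finite_set T /\
  forall g n, (0 < n)%N -> (g ^+ n = 1)%g ->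
    exists t h, T t /\ g = (h * t * h^-1)%g.
Proof.
move=> x0; exists (moves act K 0).
split; first exact: (moves_finite geo actM act_iso act_pd cK KX).
move=> g n n0 gn; have [x [l [l0 _ xl]]] := min_displacement_orbit g x0.
have {}l0 : l = 0.
  have := xl n; rewrite gn act1 mdistxx => /esym/eqP.
  by rewrite mulf_eq0 pnatr_eq0 -leqn0 leqNgt n0 => /eqP.
have [h [k [Kk xE]]] := KX x; exists (h^-1 * g * h)%g, h; split; last first.
  by rewrite !mulgA mulgV mul1g mulgK.
exists k, k; split=> //; rewrite -(act_conj act1 actM act_iso) -xE.
by have := xl 1%N; rewrite l0 mulr0 expg1 => ->.
Qed.

Lemma axis g x (l : R) : 0 < l ->
  (forall n, mdist x (act (g ^+ n)%g x) = n%:R * l) ->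
  exists A : R -> X, [/\ line A, A 0 = x &
    forall z r, A (r + z%:~R * l) = act (zexp g z) (A r)].
Proof.
move=> l0 xl; have xgx : mdist x (act g x) = l by have := xl 1%N; rewrite mul1r.
have [c [c0 cl cd]] := geo x (act g x); rewrite xgx in cl cd.
pose z r := Num.floor (r / l); pose f r := r - (z r)%:~R * l.
pose A r := act (zexp g (z r)) (c (f r)); exists A.
have f0l r : 0 <= f r <= l.
  have /andP[] := floor_itv (r / l); rewrite -/(z r) ler_pdivlMr// ltr_pdivrMr//.
  by rewrite /f intrD mulrDl mul1r; lra.
have zE r : r = f r + (z r)%:~R * l by rewrite /f subrK.
have le_l r s : z r = z s -> mdist (A r) (A s) = `|r - s|.
  move=> rs; rewrite /A rs act_iso cd//.
  by have -> : f r - f s = r - s by rewrite /f rs; lra.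
have step r : mdist (A r) (act (zexp g (z r + 1)) x) = l - f r.
  rewrite zexpS actM /A act_iso -cl cd// ?lexx ?ltW//.
  by have /andP[_ fl] := f0l r; rewrite ler0_norm; lra.
have start r : mdist (act (zexp g (z r)) x) (A r) = f r.
  rewrite /A act_iso -[x in mdist x _]c0 cd// ?lexx ?ltW//.
  by have /andP[f0 _] := f0l r; rewrite sub0r normrN ger0_norm.
have orbit (a b : int) : a <= b ->
    mdist (act (zexp g a) x) (act (zexp g b) x) = (b - a)%:~R * l.
  move=> ab; rewrite -[b in LHS](subrK a) addrC zexpD actM act_iso.
  move: ab; rewrite -subr_ge0; case: (b - a) => // n _; exact: xl.
split=> [r s||n r].
- wlog rs : r s / z r <= z s.
    by move=> H; case: (leP (z r) (z s)) => [/H//|/ltW/H]; rewrite metric_sym distrC.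
  have [/le_l//|zrs] := eqVneq (z r) (z s).
  have zrs1 : z r + 1 <= z s by rewrite lezD1 lt_neqAle zrs.
  have frl := f0l r; have fsl := f0l s.
  (* [t1] and [t2] bound the distance from above along the orbit of [x]; [t3] and [t4] bound it from
     below because orbit distances are known exactly. *)
  have t1 := metric_triangle (A r) (act (zexp g (z r + 1)) x) (A s).
  have t2 := metric_triangle (act (zexp g (z r + 1)) x) (act (zexp g (z s)) x) (A s).
  have t3 := metric_triangle (act (zexp g (z r)) x) (A r) (act (zexp g (z s + 1)) x).
  have t4 := metric_triangle (A r) (A s) (act (zexp g (z s + 1)) x).
  move: t1 t2 t3 t4; rewrite !start !step !orbit//; last first.
    by apply: le_trans rs _; rewrite lerDl.
  rewrite !intrD !intrN !intrD => t1 t2 t3 t4.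
  have rE := zE r; have sE := zE s.
  have rs' : r <= s.
    have : ((z r + 1)%:~R : R) <= (z s)%:~R by rewrite ler_int.
    rewrite intrD => zz; have := ler_wpM2r (ltW l0) zz; lra.
  rewrite ler0_norm ?subr_le0//; lra.
- rewrite /A; have -> : z 0 = 0 by rewrite /z mul0r floor0.
  by rewrite /f /z mul0r floor0 mul0r subr0 c0 (_ : zexp g 0 = 1%g)// act1.
- have zn : z (r + n%:~R * l) = n + z r.
    rewrite /z mulrDl mulfK ?gt_eqF// addrC floorDzr ?intrKfloor//.
  rewrite /A zn zexpD actM; congr (act _ (act _ (c _))).
  by rewrite /f zn intrD; lra.
Qed.

Lemma periodic_parallel (A A' : R -> X) g (l : R) : 0 < l -> line A -> line A' ->
  (forall z r, A (r + z%:~R * l) = act (zexp g z) (A r)) ->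
  (forall z r, A' (r + z%:~R * l) = act (zexp g z) (A' r)) ->
  parallel A A'.
Proof.
move=> l0 Al Al' Ag Ag'; exists (2 * l + mdist (A 0) (A' 0)) => r.
pose z := Num.floor (r / l); pose f := r - z%:~R * l.
have /andP[f0 fl] : 0 <= f <= l.
  have /andP[] := floor_itv (r / l); rewrite -/z ler_pdivlMr// ltr_pdivrMr//.
  by rewrite /f intrD mulrDl mul1r; lra.
have -> : r = f + z%:~R * l by rewrite /f subrK.
rewrite Ag Ag' act_iso; have := metric_triangle (A f) (A 0) (A' f).
have := metric_triangle (A 0) (A' 0) (A' f); rewrite Al Al' subr0 sub0r normrN.
rewrite (ger0_norm f0); lra.
Qed.

End GeometricAction.

(** * Flats from commuting elements *)

(** With [N = 2 ^ k] everything is bounded by powers of 2, and only the exponents [q + n * (k + a)]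
    and [2 ^ k] are compared. *)
Lemma exp_gt_poly (q L n : nat) : exists N, (q * (2 * (N * L + 1)) ^ n < 2 ^ N)%N.
Proof.
have sq k : (4 <= k)%N -> (k * k <= 2 ^ k)%N.
  move=> k4; rewrite -(subnK k4); elim: (k - 4)%N => [//|d IH].
  by rewrite addSn expnS; nia.
pose a := (2 * L + 2)%N; pose k := (n + (q + n * a) + 4)%N; exists (2 ^ k)%N.
have big : (q + n * (k + a) < 2 ^ k)%N.
  by have := sq k; rewrite /k; nia.
apply: (@leq_ltn_trans (2 ^ (q + n * (k + a)))); last by rewrite ltn_exp2l.
rewrite expnD leq_mul//; first by rewrite ltnW// ltn_expl.
rewrite (mulnC n) expnM.
suff le2 : (2 * (2 ^ k * L + 1) <= 2 ^ (k + a))%N.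
  by case: (n) => [//|i]; rewrite leq_exp2r.
rewrite expnD; have := ltn_expl a (isT : (1 < 2)%N); have : (0 < 2 ^ k)%N by rewrite expn_gt0.
rewrite /a; nia.
Qed.

Section FlatsOfCommutingElements.
Variables (R : realType) (X : metricType R) (G : groupType) (act : G -> X -> X).
Hypothesis cat0 : CAT0 X.
Hypothesis act1 : forall x, act 1%g x = x.
Hypothesis actM : forall g h x, act (g * h)%g x = act g (act h x).
Hypothesis act_iso : forall g x y, mdist (act g x) (act g y) = mdist x y.
Hypothesis act_pd : properly_discontinuous act.
Variable K : set X.
Hypothesis cK : compact K.
Hypothesis KX : forall x, exists h k, K k /\ x = act h k.
Implicit Types (g h : G) (x y : X).

Let geo : forall x y : X, exists c, geodesic x y c. Proof. by case: cat0. Qed.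
Let CN := midpoint_CN cat0.

(** The point [x] minimises the displacement of [t] among the points of minimal displacement for
    [c]. So does every point of the axis of [c] through [x]; the axes of [t] through these points
    are parallel and sweep out a plane. *)
Lemma flat_of_commuting (t c : G) : X -> commute t c ->
  (forall i j : int, (zexp t i * zexp c j)%g = 1%g -> i = 0 /\ j = 0) ->
  exists F x (l : R), [/\ flat F, 0 < l, forall n, F (act (t ^+ n)%g x) &
    forall n, mdist x (act (t ^+ n)%g x) = n%:R * l].
Proof.
move=> x00 tc free.
have nfix := not_all_fixed cat0 act1 actM act_iso act_pd cK KX.
have [x1 [lc [lc0 lc_min x1c]]] :=
  min_displacement_orbit cat0 act1 actM act_iso act_pd cK KX c x00.
have [|x [xlc xmin]] := displacement_min geo act1 actM act_iso act_pd cK KX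
    t (c := c) (l := lc) _.
  by exists x1; have := x1c 1%N; rewrite expg1 mul1r => ->.
set lt := mdist x (act t x) in xmin; have lt0 : 0 <= lt := mdist_ge0 _ _.
pose Y := [set y | mdist y (act c y) <= lc].
have Ymid y z m : Y y -> Y z -> midpoint y z m -> Y m.
  rewrite /Y /= => yc zc yz.
  have := midpoint_convex CN yz (act_midpoint act_iso c yz); lra.
have Yt y : Y y -> Y (act t y).
  by rewrite /Y /= -actM -tc actM act_iso.
have xt : forall n, mdist x (act (t ^+ n)%g x) = n%:R * lt.
  by apply: (min_orbit cat0 act1 actM act_iso lt0 Ymid Yt).
have xc : forall n, mdist x (act (c ^+ n)%g x) = n%:R * lc.
  by apply: (@min_orbit _ _ _ _ cat0 act1 actM act_iso setT).
have t_inj : injective (fun n : nat => t ^+ n)%g.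
  move=> i j ij; have [] := free (Posz i - Posz j) 0; last by move=> /eqP; rewrite subr_eq0 => /eqP[].
  apply: (@mulIg _ (t ^+ j)%g); rewrite /= mulg1 mul1g.
  by rewrite -[(t ^+ j)%g]/(zexp t (Posz j)) -zexpD subrK.
have c_inj : injective (fun n : nat => c ^+ n)%g.
  move=> i j ij; have [] := free 0 (Posz i - Posz j); last by move=> _ /eqP; rewrite subr_eq0 => /eqP[].
  apply: (@mulIg _ (c ^+ j)%g); rewrite /= !mul1g.
  by rewrite -[(c ^+ j)%g]/(zexp c (Posz j)) -zexpD subrK.
have {}lt0 : 0 < lt.
  rewrite lt_neqAle lt0 andbT; apply/eqP => l0; apply: (nfix _ x 0 t_inj) => n.
  by rewrite xt -l0 mulr0.
have {}lc0 : 0 < lc.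
  rewrite lt_neqAle lc0 andbT; apply/eqP => l0; apply: (nfix _ x 0 c_inj) => n.
  by rewrite xc -l0 mulr0.
have [L [Ll L0 Lc]] := axis cat0 act1 actM act_iso lc0 xc.
have tLl : line (fun s => act t (L s)) by move=> r s; rewrite act_iso.
have tLc z r : act t (L (r + z%:~R * lc)) = act (zexp c z) (act t (L r)).
  by rewrite Lc -!actM zexp_commute//; exact: commute_sym.
have L_tL := periodic_parallel act_iso lc0 Ll tLl Lc tLc.
have Lt s n : mdist (L s) (act (t ^+ n)%g (L s)) = n%:R * lt.
  apply: (min_orbit cat0 act1 actM act_iso (ltW lt0) Ymid Yt xmin).
    rewrite /Y /=; have := Lc 1 s; rewrite -[zexp c 1]/(c ^+ 1)%g expg1 => <-.
    by rewrite Ll mul1r opprD addNKr normrN ger0_norm// ltW.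
  have := parallel_const CN Ll tLl L_tL s 0; rewrite addr0 => ->.
  by rewrite L0.
have [A AP] := choice (fun s => axis cat0 act1 actM act_iso lt0 (Lt s)).
have Al s : line (A s) by have [] := AP s.
have A0 s : A s 0 = L s by have [] := AP s.
have At s : forall z r, A s (r + z%:~R * lt) = act (zexp t z) (A s r).
  by have [] := AP s.
have [||a aE] := flat_plane CN Al.
- by move=> r s; rewrite !A0.
- by move=> s s'; apply: (periodic_parallel act_iso lt0).
have orbit (i j : int) : mdist x (act (zexp t i * zexp c j)%g x) ^+ 2 =
    (i%:~R * lt) ^+ 2 + a * (i%:~R * lt) * (j%:~R * lc) + (j%:~R * lc) ^+ 2.
  by rewrite -(aE 0 0) At !A0 Lc L0 actM.
have a4 : a ^+ 2 < 4.
  (* The squared distance at [k = - a / 2], [j = 1] is nonnegative, so [a] could only be 2 or -2.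
     The form is then a square, and powers of [t] nearly cancel those of [c]: infinitely many
     elements move [x] by at most [lt]. *)
  rewrite ltNge; apply/negP => a4.
  have := aE 0 0 (- a / 2) 1; have := sqr_ge0 (mdist (A 0 0) (A (0 + 1) (0 + - a / 2))).
  move=> d0 dE; have {d0 dE}a4 : a ^+ 2 = 4 by apply/le_anti; rewrite a4 andbT; lra.
  have [s [s2 as2]] : exists s : R, (s = 1 \/ s = -1) /\ a = 2 * s.
    have : (a - 2) * (a + 2) = 0 by lra.
    move/eqP; rewrite mulf_eq0 => /orP[] /eqP a2; [exists 1|exists (-1)].
      by split; [left|lra].
    by split; [right|lra].
  pose i n : int := if s == 1 then - Num.floor (n%:R * lc / lt)
    else Num.floor (n%:R * lc / lt).
  pose f (n : nat) := (zexp t (i n) * zexp c (Posz n))%g.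
  have f_inj : injective f.
    move=> n n' nn'; have [] := free (i n - i n') (Posz n - Posz n'); last first.
      by move=> _ /eqP; rewrite subr_eq0 => /eqP[].
    have cz z : commute (zexp t (i n')) (zexp c z).
      by apply: zexp_commute; apply: commute_sym; apply: zexp_commute;
        exact: commute_sym.
    apply: (@mulIg _ (zexp t (i n') * zexp c (Posz n'))%g); rewrite mul1g.
    rewrite -mulgA (mulgA (zexp c _)) -(cz (Posz n - Posz n')) -mulgA -zexpD subrK.
    by rewrite mulgA -zexpD subrK; exact: nn'.
  apply: (nfix f x lt f_inj) => n.
  rewrite -(ler_pXn2r (_ : 0 < 2)%N) ?nnegrE ?mdist_ge0 ?(ltW lt0)//.
  have /andP[] := floor_itv (n%:R * lc / lt).
  rewrite intrD ler_pdivlMr// ltr_pdivrMr// => fl1 fl2.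
  rewrite orbit as2 -[(Posz n)%:~R]/(n%:R); set w := n%:R * lc in fl1 fl2 *.
  set v := (Num.floor (w / lt))%:~R * lt in fl1 *.
  have v2 : (w - v) ^+ 2 <= lt ^+ 2.
    rewrite ler_pXn2r ?nnegrE ?(ltW lt0)//; last by lra.
    by move: fl2; rewrite mulrDl mul1r -/v; lra.
  suff -> : (i n)%:~R * lt = - s * v by case: s2 => ->; lra.
  rewrite /i -/w /v; case: s2 => ->; rewrite ?eqxx; first by rewrite intrN mulN1r mulNr.
  by case: eqP => [|_]; [lra|rewrite opprK mul1r].
have [F flatF FA] := plane_flat a4 aE.
exists F, x, lt; split=> // n.
rewrite -[(t ^+ n)%g]/(zexp t (Posz n)) -[x in act _ x]L0 -A0 -At; exact: FA.
Qed.

End FlatsOfCommutingElements.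

Definition monoid_word (G : groupType) (p q : G) (w : seq bool) : G :=
  foldr (fun b g => (if b then p else q) * g)%g 1%g w.

(** * Stabilisers of isolated flats *)

Section IsolatedFlats.
Variables (R : realType) (X : metricType R) (G : groupType) (act : G -> X -> X).
Hypothesis cat0 : CAT0 X.
Hypothesis act1 : forall x, act 1%g x = x.
Hypothesis actM : forall g h x, act (g * h)%g x = act g (act h x).
Hypothesis act_iso : forall g x y, mdist (act g x) (act g y) = mdist x y.
Hypothesis act_pd : properly_discontinuous act.
Variable K : set X.
Hypothesis cK : compact K.
Hypothesis KX : forall x, exists h k, K k /\ x = act h k.
Implicit Types (g h : G) (x y : X).

Let geo : forall x y : X, exists c, geodesic x y c. Proof. by case: cat0. Qed.

Lemma coord_le_edist n (u v : 'rV[R]_n) i : `|u ord0 i - v ord0 i| <= edist u v.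
Proof.
rewrite -sqrtr_sqr; apply: ler_wsqrtr; rewrite (bigD1 i)//= lerDl.
by apply: sumr_ge0 => j _; exact: sqr_ge0.
Qed.

Lemma edist_le_coord n (u v : 'rV[R]_n) :
  (forall i, `|u ord0 i - v ord0 i| <= 1) -> edist u v <= Num.sqrt n%:R.
Proof.
move=> uv; apply: ler_wsqrtr; rewrite -[n in leRHS]card_ord -sumr_const.
apply: ler_sum => i _; rewrite -real_normK ?num_real// exprn_ile1//.
Qed.

(* The stabiliser of a flat has polynomial growth. *)
Lemma flat_no_free_monoid n (f : 'rV[R]_n -> X) (p q : G) :
  (forall u v, mdist (f u) (f v) = edist u v) ->
  (forall u, exists v, act p (f u) = f v) ->
  (forall u, exists v, act q (f u) = f v) ->
  ~ forall w w', size w = size w' -> monoid_word p q w = monoid_word p q w' -> w = w'.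
Proof.
move=> f_iso fp fq free; pose z := f 0.
pose W w := monoid_word p q w.
have fW w : exists u, act (W w) z = f u.
  elim: w => [|b w [u wu]]; first by exists 0; rewrite act1.
  by rewrite /W /= actM -/(W w) wu; case: b.
have [u uP] := choice fW.
pose L := (Num.truncn (Num.max (mdist z (act p z)) (mdist z (act q z)))).+1.
have zW w : mdist z (act (W w) z) <= (size w * L)%:R.
  elim: w => [|b w IHw]; first by rewrite act1 mdistxx.
  rewrite /W /= -/(W w) mulSn natrD.
  have t := metric_triangle z (act (if b then p else q) z) (act ((if b then p else q) * W w)%g z).
  apply: le_trans t _; apply: lerD; last by rewrite actM act_iso.
  apply: ltW; apply: le_lt_trans (truncnS_gt (Num.max (mdist z (act p z)) (mdist z (act q z)))).
  by rewrite le_max; case: b; rewrite lexx ?orbT.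
have fin := displacement_finite geo act1 actM act_iso act_pd cK KX z (Num.sqrt n%:R).
have /finite_seqP[s sE] := fin.
have [N NP] := exp_gt_poly (size s).+1 L n.
set M := (N * L + 1)%N in NP.
have u_bound (w : N.-tuple bool) i : `|u w ord0 i| <= (N * L)%:R.
  have := coord_le_edist (u w) 0 i; rewrite mxE subr0 => /le_trans; apply.
  by rewrite edistC -f_iso -uP -{2}(size_tuple w); exact: zW.
(* Unit cubes of the flat. The shift by [M] makes the coordinates nonnegative, as they are at most
   [N * L] in absolute value. *)
pose cell (w : N.-tuple bool) : {ffun 'I_n -> 'I_(2 * M).-1.+1} :=
  [ffun i => inord (Num.truncn (u w ord0 i + M%:R))].
have M2 : (2 * M).-1.+1 = (2 * M)%N by rewrite prednK// /M; lia.
have cellE w i : (cell w i : nat) = Num.truncn (u w ord0 i + M%:R).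
  rewrite ffunE inordK// M2; have := u_bound w i; rewrite ler_norml => /andP[u1 u2].
  rewrite truncn_lt_nat//.
    by rewrite /M mulnDr natrD; move: u2; rewrite /M !natrD !natrM; lra.
  by move: u1; rewrite /M !natrD; lra.
have u_ge0 (w : N.-tuple bool) i : 0 <= u w ord0 i + M%:R.
  by have := u_bound w i; rewrite ler_norml => /andP[u1 _]; move: u1; rewrite /M natrD; lra.
have cell_close (w w' : N.-tuple bool) : cell w = cell w' ->
    ((W w)^-1 * W w')%g \in s.
  move=> ww'; suff : [set` s] ((W w)^-1 * W w')%g by [].
  rewrite -sE /= actM -(act_iso (W w)) -actM mulgV act1 uP (uP w') f_iso.
  apply: edist_le_coord => i; have ci : (cell w i : nat) = cell w' i by rewrite ww'.
  move: ci; rewrite !cellE => ci; have := truncn_itv (u_ge0 w i).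
  have := truncn_itv (u_ge0 w' i); rewrite -ci -natr1 => /andP[a1 a2] /andP[b1 b2].
  by rewrite ler_norml; lra.
pose rep (w : N.-tuple bool) := odflt w [pick w' | cell w' == cell w].
have repE w : cell (rep w) = cell w.
  by rewrite /rep; case: pickP => [w' /eqP|].
have rep_cell w w' : cell w = cell w' -> rep w = rep w'.
  move=> ww'; rewrite /rep ww'; case: pickP => // /(_ w').
  by rewrite eqxx.
(* Words in one cube differ by an element moving [z] at most by the diameter of the cube, hence by
   an element of [s]. The cube and the difference from its representative determine the word. *)
pose key w := (cell w, inord (index ((W (rep w))^-1 * W w)%g s) : 'I_(size s).+1).
have key_inj : injective key.
  move=> w w' [cw]; rewrite (rep_cell _ _ cw) => /(congr1 val).
  have ws : ((W (rep w'))^-1 * W w)%g \in s.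
    by apply: cell_close; rewrite repE cw.
  have ws' : ((W (rep w'))^-1 * W w')%g \in s by apply: cell_close; rewrite repE.
  rewrite /= !inordK ?ltnS ?index_size// => ii.
  have : ((W (rep w'))^-1 * W w)%g = ((W (rep w'))^-1 * W w')%g.
    by rewrite -(nth_index 1%g ws) -(nth_index 1%g ws') ii.
  by move=> /mulgI/free wE; apply/val_inj/wE; rewrite !size_tuple.
have := leq_card _ key_inj.
rewrite card_tuple card_bool card_prod card_ffun !card_ord M2 mulnC leqNgt.
by rewrite NP.
Qed.

(** Together with [t], the element [c] provides a flat containing the orbit of [x] under [t].
    Anything commuting with [t] moves all points of this orbit equally far. So the member [F] near
    this flat and its translate are close along an unbounded set and coincide. *)
Lemma isolated_no_free_monoid (t c p q : G) : X -> isolated_flats act ->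
  commute t c ->
  (forall i j : int, (zexp t i * zexp c j)%g = 1%g -> i = 0 /\ j = 0) ->
  commute p t -> commute q t ->
  ~ forall w w', size w = size w' -> monoid_word p q w = monoid_word p q w' -> w = w'.
Proof.
move=> x0 [FF [FF_flat FF_inv [D FD] iso]] tc free pt qt.
have [F0 [x [l [flatF0 l0 F0x xl]]]] :=
  flat_of_commuting cat0 act1 actM act_iso act_pd cK KX x0 tc free.
have [F FF_F F0F] := FD _ flatF0.
have stab g : commute g t -> act g @` F = F.
  move=> gt; apply: contrapT => gF; pose rho := `|D| + mdist x (act g x) + 1.
  have rho0 : 0 < rho by have := mdist_ge0 x (act g x); have := normr_ge0 D; rewrite /rho; lra.
  have [kappa kP] := iso rho rho0.
  have near n : (neighbourhood rho F `&` neighbourhood rho (act g @` F))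
      (act (t ^+ n)%g x).
    have [y Fy xy] := F0F _ (F0x n); have := ler_norm D.
    have := mdist_ge0 x (act g x); split; [exists y => //|exists (act g y)].
    - by apply: lt_le_trans xy _; rewrite /rho; lra.
    - by exists y.
    - have := metric_triangle (act (t ^+ n)%g x) (act g (act (t ^+ n)%g x)) (act g y).
      rewrite -[in X in _ <= X + _]actM (commuteX n gt) actM !act_iso /rho; lra.
  have [n nk] := archi_mul_gt kappa l0.
  have := kP _ _ FF_F (FF_inv g _ FF_F) (fun FE => gF (esym FE)) _ _ (near 0%N) (near n).
  by rewrite expg0 act1 xl; lra.
have [n [f [_ f_iso fE]]] := FF_flat _ FF_F.
apply: (@flat_no_free_monoid n f) => // u.
  have : (act p @` F) (act p (f u)) by exists (f u) => //; rewrite fE; exists u.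
  by rewrite stab// fE => -[v _ <-]; exists v.
have : (act q @` F) (act q (f u)) by exists (f u) => //; rewrite fE; exists u.
by rewrite stab// fE => -[v _ <-]; exists v.
Qed.

End IsolatedFlats.

Lemma has_isolated_flats_torsion (R : realType) (G : groupType) :
  has_isolated_flats R G -> exists T : set G, finite_set T /\
  forall (g : G) n, (0 < n)%N -> (g ^+ n = 1)%g ->
    exists t h, T t /\ (g = h * t * h^-1)%g.
Proof.
move=> [X [act [[x0] cat0 [[act1 actM] act_iso act_pd [K cK KX]] _]]].
apply: (torsion_classes cat0 act1 actM act_iso act_pd cK) => // x.
have : (\bigcup_g (act g @` K)) x by rewrite KX.
by case=> h _ [k Kk <-]; exists h, k.
Qed.

Lemma has_isolated_flats_no_free_monoid (R : realType) (G : groupType)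
    (t c p q : G) : has_isolated_flats R G -> commute t c ->
  (forall i j : int, (zexp t i * zexp c j)%g = 1%g -> i = 0 /\ j = 0) ->
  commute p t -> commute q t ->
  ~ forall w w', size w = size w' -> monoid_word p q w = monoid_word p q w' -> w = w'.
Proof.
move=> [X [act [[x0] cat0 [[act1 actM] act_iso act_pd [K cK KX]] iso]]].
apply: (isolated_no_free_monoid cat0 act1 actM act_iso act_pd cK) => // x.
have : (\bigcup_g (act g @` K)) x by rewrite KX.
by case=> h _ [k Kk <-]; exists h, k.
Qed.

Local Close Scope ring_scope.

(** * Ends and splittings *)

Section TwoEnds.
Variable G : groupType.
Local Open Scope group_scope.
Implicit Types (x y z : G).

(** Deleting the vertices at which [chi] changes leaves monochromatic components. Each of them meets
    the finite set [bd], so each colour has an infinite component. *)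
Lemma two_ends (chi : G -> bool) :
  (forall g, finite_set [set x | chi (x * g) != chi x]) ->
  (forall b, infinite_set [set x | chi x = b]) -> ~ one_ended G.
Proof.
move=> chi_fin chi_inf [S [finS genS]].
pose bad s := [set x | chi (x * s) != chi x].
(* The point 1 makes [K] nonempty, so every component is reached from [K]. *)
pose K := [set (1 : G)] `|` \bigcup_(s in S) bad s.
have finK : finite_set K.
  rewrite finite_setU; split; first exact: finite_set1.
  by apply: bigcup_finite => // s _; exact: chi_fin.
move=> /(_ K finK)[U [_ Uuniq]].
have adj_chi x y : ~ K x -> ~ K y -> cayley_adj S x y -> chi x = chi y.
  move=> Kx Ky [s Ss [yE|xE]]; apply: contrapT => /eqP xy.
    by apply: Kx; right; exists s => //; rewrite /bad /= -yE eq_sym.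
  by apply: Ky; right; exists s => //; rewrite /bad /= -xE.
have comp_chi z y : cayley_component S K z y -> chi z = chi y.
  by elim=> [a b [Ka Kb]|a|a b c _ -> _ ->]//; exact: adj_chi.
pose bd := [set k * s | k in K & s in S `|` [set s^-1 | s in S]].
have fin_bd : finite_set bd.
  by apply: finite_image2 => //; rewrite finite_setU; split=> //; exact: finite_image.
pose Q y := K y \/ exists z, [/\ bd z, ~ K z & cayley_component S K z y].
have Qstep y s : (S `|` [set s^-1 | s in S]) s -> Q y -> Q (y * s).
  move=> Ss Qy; have [Kys|Kys] := pselect (K (y * s)); first by left.
  right; have [Ky|Ky] := pselect (K y).
    exists (y * s); split=> //; last exact: rt_refl.
    by exists y => //; exists s.
  case: Qy => // -[z [bz Kz zy]]; exists z; split=> //.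
  apply: (rt_trans _ _ _ _ _ zy); apply: rt_step; split=> //.
  case: Ss => [Ss|[s' Ss' <-]]; first by exists s => //; left.
  by exists s' => //; right; rewrite mulgVK.
have allQ y : Q y.
  pose T := [set g | (forall y, Q y -> Q (y * g)) /\ forall y, Q y -> Q (y * g^-1)].
  have Tg : is_subgroup T.
    split=> [|a b [aQ aVQ] [bQ bVQ]|a [aQ aVQ]].
    - by split=> x; rewrite ?invg1 mulg1.
    - by split=> x Qx; rewrite ?invgM mulgA; [apply/bQ/aQ|apply/aVQ/bVQ].
    - by split=> x; [exact: aVQ|rewrite invgK; exact: aQ].
  have ST : S `<=` T.
    by move=> s Ss; split=> x; apply: Qstep; [left|right; exists s].
  have : generated S y by rewrite genS.
  move=> /(generated_min Tg ST)[/(_ 1) + _]; rewrite mul1g; apply; by left; left.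
have [U1 [U2]] : exists U1 U2 : set G, [/\
    infinite_set U1 /\ (exists2 x, ~ K x & U1 = cayley_component S K x),
    infinite_set U2 /\ (exists2 x, ~ K x & U2 = cayley_component S K x) & U1 <> U2].
  have inf_comp b : exists z,
      [/\ ~ K z, infinite_set (cayley_component S K z) & chi z = b].
    apply: contrapT => nz; apply: (chi_inf b).
    pose C z := cayley_component S K z `&` [set x | chi x = b /\ ~ K z].
    apply: (@sub_finite_set _ _ (K `|` \bigcup_(z in bd) C z)).
      move=> x xb; have [|[z [bz Kz zx]]] := allQ x; first by left.
      by right; exists z.
    rewrite finite_setU; split=> //; apply: bigcup_finite => // z bz.
    apply: contrapT => infC; apply: nz; exists z.
    have [x [zx [xb Kz]]] : C z !=set0.
      by apply/set0P/eqP => C0; apply: infC; rewrite C0; exact: finite_set0.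
    split=> //; last by rewrite (comp_chi _ _ zx).
    by apply: contra_not infC => finz; apply: sub_finite_set finz => ? [].
  have [z1 [Kz1 inf1 z1t]] := inf_comp true; have [z2 [Kz2 inf2 z2f]] := inf_comp false.
  exists (cayley_component S K z1), (cayley_component S K z2).
  split; [by split=> //; exists z1|by split=> //; exists z2|move=> E].
  have : cayley_component S K z2 z1 by rewrite -E; exact: rt_refl.
  by move=> /comp_chi; rewrite z1t z2f.
by move=> [/Uuniq <- /Uuniq <- []].
Qed.

End TwoEnds.

Section SpecialSubgroups.
Variables (V : finType) (e : rel V) (m : V -> nat).
Hypothesis e_irr : irreflexive e.
Hypothesis e_sym : symmetric e.
Hypothesis m_gt1 : forall v, (1 < m v)%N.
Local Open Scope group_scope.

Notation W := (graph_product e m).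
Notation gen := (pres_gen (graph_product_rels e m)).
Notation special := (special_subgroup e m).
Notation sector := (@sector V e m).
Notation vpow := (@vpow V e m _).
Notation star := (star e).
Implicit Types (x y z : W) (u v : V).

(** Each defining relation involves only vertices of [DA] or only vertices of [DB]. As [f] and [g]
    are multiplicative only on the subgroups, the extension is rebuilt from their values on
    generators. *)
Lemma graph_product_amalgam (DA DB : {set V}) :
  (forall v, (v \in DA) || (v \in DB)) ->
  (forall u v, e u v -> (u \in DA) && (v \in DA) || (u \in DB) && (v \in DB)) ->
  is_amalgam (special DA) (special DB) (special (DA :&: DB)).
Proof.
move=> cover edges; split; try exact: special_is_subgroup.
  by split; apply: specialS; rewrite ?subsetIl ?subsetIr.
move=> H f g fM gM fg.
pose j v := if v \in DA then f (gen v) else g (gen v).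
have jA v : v \in DA -> j v = f (gen v) by rewrite /j => ->.
have jB v : v \in DB -> j v = g (gen v).
  rewrite /j; case: ifP => // vA vB; apply: fg.
  by apply: special_gen; rewrite inE vA.
have X (k : W -> H) D v :
    (forall x y, special D x -> special D y -> k (x * y) = k x * k y) ->
    v \in D -> forall n, k (gen v ^+ n) = k (gen v) ^+ n.
  move=> kM vD; have k1 : k 1 = 1.
    by apply: (@mulgI _ (k 1)); rewrite -kM ?mulg1//; exact: special1.
  elim=> [|n IHn]; first by rewrite !expg0.
  rewrite !expgS kM ?IHn//; first exact: special_gen.
  by apply: specialX; exact: special_gen.
have jm v : j v ^+ m v = 1.
  have /orP[vD|vD] := cover v.
    rewrite (jA _ vD) -(X f DA v fM vD) gen_order.
    by have := X f DA v fM vD 0%N; rewrite !expg0.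
  rewrite (jB _ vD) -(X g DB v gM vD) gen_order.
  by have := X g DB v gM vD 0%N; rewrite !expg0.
have jC u v : e u v -> j u * j v = j v * j u.
  move=> uv; have /orP[] := edges _ _ uv => /andP[uD vD].
    rewrite !jA// -!fM; [|exact: special_gen..].
    by rewrite gen_commute.
  rewrite !jB// -!gM; [|exact: special_gen..].
  by rewrite gen_commute.
have [h [hM hg]] := graph_product_lift m_gt1 jm jC.
have ext (k : W -> H) D :
    (forall x y, special D x -> special D y -> k (x * y) = k x * k y) ->
    (forall v, v \in D -> j v = k (gen v)) -> forall x, special D x -> h x = k x.
  move=> kM jk x; elim/(@special_ind _ e _ m_gt1) => [|y v yD vD IH].
    rewrite (morph_g1 hM); apply: (@mulgI _ (k 1)).
    by rewrite -kM ?mulg1//; exact: special1.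
  rewrite hM hg IH kM ?jk//; exact: special_gen.
exists h; split; first by split=> //; [exact: ext jA|exact: ext jB].
move=> h' [h'M h'f h'g]; apply: (@morph_gen_ext _ e _ m_gt1) => // v.
rewrite hg; have /orP[vD|vD] := cover v.
  by rewrite jA// h'f//; exact: special_gen.
by rewrite jB// h'g//; exact: special_gen.
Qed.

Lemma special_proper (D D' : {set V}) v : D \subset D' -> v \in D' -> v \notin D ->
  special D `<` special D'.
Proof.
move=> DD' vD' vD; split; first exact: specialS.
move=> /(_ (gen v) (special_gen vD')) /(sector_special e_irr e_sym m_gt1 vD).
rewrite sector_gen// => /eqP; by rewrite (negbTE (oner_neq0_Zm _ _)).
Qed.

Lemma sector_alternating a b n : a \notin star b ->
  sector b ((gen a * gen b) ^+ n) = 0%R /\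
  sector a ((gen a * gen b) ^+ n) = (if n is 0 then 0 else 1)%R.
Proof.
move=> ab; have ba : b \notin star a by rewrite star_sym.
elim: n => [|n [IHb IHa]]; first by rewrite expg0 !sector1.
rewrite expgS -!mulgA; set y := gen b * _.
have by1 : sector b y = 1%R.
  by rewrite /y -(vpow1 e m_gt1) sector_vpowM// IHb addr0.
have ay0 : sector a y = 0%R.
  by apply: (sector_sep e_irr e_sym m_gt1 ba); rewrite by1 oner_neq0_Zm.
have a1 : sector a (gen a * y) = 1%R.
  by rewrite -(vpow1 e m_gt1) sector_vpowM// ay0 addr0.
by split=> //; apply: (sector_sep e_irr e_sym m_gt1 ab); rewrite a1 oner_neq0_Zm.
Qed.

Lemma alternating_order a b n : a \notin star b -> (gen a * gen b) ^+ n = 1 ->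
  n = 0%N.
Proof.
move=> ab abn; have [_] := sector_alternating n ab.
by rewrite abn sector1//; case: n {abn}.
Qed.

Lemma alternating_zorder a b (i : int) : a \notin star b ->
  zexp (gen a * gen b) i = 1 -> i = 0%R.
Proof.
move=> ab; case: i => n /=; first by move=> /(alternating_order ab) ->.
by move=> /eqP; rewrite invg_eq1 => /eqP/(alternating_order ab).
Qed.

Lemma alternating_inj a b : a \notin star b ->
  injective (fun n => (gen a * gen b) ^+ n).
Proof.
move=> ab; suff H i j : (i <= j)%N ->
    (gen a * gen b) ^+ i = (gen a * gen b) ^+ j -> i = j.
  by move=> i j ij; case: (leqP i j) => [/H->//|/ltnW/H->].
move=> ij; rewrite -{1}(subnKC ij) expgnDr -{1}[_ ^+ i]mulg1.
move=> /mulgI/esym/(alternating_order ab) => ji0.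
by apply/eqP; rewrite eqn_leq ij /= -subn_eq0 ji0.
Qed.

Lemma special_infinite (D : {set V}) a b : a \notin star b -> a \in D -> b \in D ->
  infinite_set (special D).
Proof.
move=> ab aD bD; apply: (infinite_injective (alternating_inj ab)) => n.
by apply: specialX; apply: specialM; exact: special_gen.
Qed.

(** On W(D) the sectors at the vertices of a clique [D] are homomorphisms to finite groups, and
    jointly they are injective. *)
Lemma special_clique_finite (D : {set V}) :
  (forall a b, a \in D -> b \in D -> a \in star b) -> finite_set (special D).
Proof.
move=> clique.
pose sec x : {dffun forall v, 'Z_(m v)} := [ffun v => sector v x].
apply: (@sub_finite_set _ _ [set xget 1 [set x | special D x /\ sec x = s] |
    s in [set: {dffun forall v, 'Z_(m v)}]]); last first.
  by apply: finite_image; exact: finite_finset.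
move=> x Dx; exists (sec x) => //; case: xgetP => [y _ [Dy yx]|/(_ x)[]//].
apply/esym/(@mulgI _ y^-1); rewrite mulVg; apply: (sector_eq0 e_irr e_sym m_gt1) => v.
have [vD|vD] := boolP (v \in D); last first.
  by apply: (sector_special e_irr e_sym m_gt1 vD); apply: specialM => //; exact: specialV.
have Dv : special (star v) y.
  by apply: specialS Dy; apply/fintype.subsetP => u uD; exact: clique.
rewrite sectorM_star//; last exact: specialV.
have := congr1 (fun s : {dffun forall v, 'Z_(m v)} => s v) yx; rewrite !ffunE => <-.
by rewrite sectorV_star// addNr.
Qed.

End SpecialSubgroups.

(** * Finite edge groups and ends *)

Section Splittings.
Variables (V : finType) (e : rel V) (m : V -> nat).
Hypothesis e_irr : irreflexive e.
Hypothesis e_sym : symmetric e.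
Hypothesis m_gt1 : forall v, (1 < m v)%N.
Local Open Scope group_scope.

Notation W := (graph_product e m).
Notation gen := (pres_gen (graph_product_rels e m)).
Notation special := (special_subgroup e m).
Notation sector := (@sector V e m).
Notation vpow := (@vpow V e m _).
Notation star := (star e).
Implicit Types (x y z : W) (u v a b : V).

Lemma sector_neq0_notin (D : {set V}) v x :
  v \notin D -> sector v x = 1%R -> ~ special D x.
Proof.
move=> vD vx /(sector_special e_irr e_sym m_gt1 vD) /eqP.
by rewrite vx (negbTE (oner_neq0_Zm _ _)).
Qed.

(* chi records the side of the edge W(DA :&: DB) of the Bass-Serre tree of
   W(DA) *_W(DA :&: DB) W(DB). *)
Lemma edge_side (DA DB : {set V}) :
  (forall u v, e u v -> (u \in DA) && (v \in DA) || (u \in DB) && (v \in DB)) ->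
  let C x := `[< special (DA :&: DB) x >] in
  exists chi : W -> bool, chi 1 = false /\ forall x u,
    chi (x * gen u) = chi x (+) (if u \in DA then C x (+) C (x * gen u) else false).
Proof.
move=> edges C.
(* The coboundary of the indicator of the edge group on [DA], and zero on [DB]. The two agree on the
   intersection, so each relation can be checked within one side. *)
pose d u x := if u \in DA then C x (+) C (x * gen u) else false.
have dB u x : u \in DB -> d u x = false.
  move=> uB; rewrite /d; case: ifP => // uA.
  suff -> : C (x * gen u) = C x by rewrite addbb.
  apply: asbool_equiv_eq; apply: subgroup_mulr; first exact: special_is_subgroup.
  by apply: special_gen; rewrite inE uA uB.
pose op u (s : W * bool) := (s.1 * gen u, s.2 (+) d u s.1).
have [||S [S1 SM Sg]] := @graph_product_action _ e _ m_gt1 _ op.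
- move=> u [x b]; have opn n : iter n (op u) (x, b) =
      (x * gen u ^+ n, b (+) (if u \in DA then C x (+) C (x * gen u ^+ n) else false)).
    elim: n => [|n IHn]; first by rewrite expg0 mulg1 addbb; case: ifP; rewrite addbF.
    rewrite iterS IHn /op /= /d expgSr mulgA; congr (_, _).
    by case: ifP => _; rewrite ?addbF// -!addbA (addbA (C (x * gen u ^+ n))) addbb addFb.
  by rewrite opn gen_order mulg1 addbb; case: ifP; rewrite addbF.
- move=> u w [x b] uw; rewrite /op /= -!mulgA (gen_commute _ uw).
  congr (_, _); rewrite -!addbA; congr (_ (+) _).
  have /orP[/andP[uA wA]|/andP[uB wB]] := edges _ _ uw; last by rewrite !dB.
  rewrite /d uA wA -!addbA; congr (_ (+) _); rewrite !addbA !addbb !addFb.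
  by rewrite -!mulgA (gen_commute _ uw).
have S_fst x (c : bool) : (S x (1, c)).1 = x.
  elim/(@graph_product_ind _ e _ m_gt1): x => [|x u IH]; first by rewrite S1.
  by rewrite SM Sg /= IH.
exists (fun x => (S x (1, false)).2); split=> [|x u]; first by rewrite S1.
by rewrite SM Sg /= S_fst.
Qed.

(** Powers of [gen b * gen a] leave the edge group on the side where [chi] stays false, those of
    [gen a * gen b] on the side where it turns true, and neither return. *)
Lemma one_ended_not_clique (DA DB : {set V}) a b :
  (forall u v, e u v -> (u \in DA) && (v \in DA) || (u \in DB) && (v \in DB)) ->
  (forall v, (v \in DA) || (v \in DB)) ->
  a \in DA -> a \notin DB -> b \in DB -> b \notin DA ->
  finite_set (special (DA :&: DB)) -> ~ one_ended W.
Proof.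
move=> edges cover aA aB bB bA finC.
have [chi [chi1 chiM]] := edge_side edges.
have aC : a \notin DA :&: DB by rewrite inE (negbTE aB) andbF.
have bC : b \notin DA :&: DB by rewrite inE (negbTE bA).
have ab : a \notin star b.
  rewrite inE negb_or; apply/andP; split; first by apply: contraNneq aB => ->.
  apply/negP => /edges; by rewrite (negbTE aB) (negbTE bA) andbF.
have ba : b \notin star a by rewrite star_sym.
have finite_chi g : finite_set [set x | chi (x * g) != chi x].
  elim/(@graph_product_ind _ e _ m_gt1): g => [|g u IH].
    by rewrite (_ : [set _ | _] = set0)// -subset0 => x /=; rewrite mulg1 eqxx.
  pose E := special (DA :&: DB) `|` [set x * (gen u)^-1 | x in special (DA :&: DB)].
  have finE : finite_set [set x * g^-1 | x in E].
    by apply: finite_image; rewrite finite_setU; split=> //; exact: finite_image.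
  apply: (@sub_finite_set _ _ ([set x * g^-1 | x in E] `|`
      [set x | chi (x * g) != chi x])); last by rewrite finite_setU.
  move=> x /= xgu; have [E1|nE] := pselect (E (x * g)).
    by left; exists (x * g) => //; rewrite mulgK.
  right; move: xgu; rewrite mulgA chiM; case: ifP; rewrite ?addbF// => uA.
  rewrite !asboolF ?addbF// => Cx; apply: nE; last by left.
  by right; exists (x * g * gen u) => //; rewrite mulgK.
apply: (two_ends finite_chi) => -[]; last first.
  apply: (infinite_injective (alternating_inj e_irr e_sym m_gt1 ba)) => n /=.
  elim: n => [|n IHn]; first by rewrite expg0.
  rewrite expgSr mulgA chiM aA chiM (negbTE bA) addbF IHn /= !asboolF//.
    apply: (sector_neq0_notin bC); rewrite -mulgA -expgSr.
    by have [_] := sector_alternating e_irr e_sym m_gt1 n.+1 ba.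
  apply: (sector_neq0_notin bC).
  have := (sector_alternating e_irr e_sym m_gt1 n ab).1.
  have -> : (gen b * gen a) ^+ n * gen b = gen b * (gen a * gen b) ^+ n.
    elim: n {IHn} => [|n IHn]; first by rewrite !expg0 mulg1 mul1g.
    by rewrite expgS -mulgA IHn expgS !mulgA.
  by move=> s0; rewrite -(vpow1 e m_gt1 b) sector_vpowM// vpow1// s0 addr0.
have a_b n : sector a ((gen a * gen b) ^+ n * gen a) = 1%R.
  have -> : (gen a * gen b) ^+ n * gen a = gen a * (gen b * gen a) ^+ n.
    elim: n => [|n IHn]; first by rewrite !expg0 mulg1 mul1g.
    by rewrite expgS -mulgA IHn expgS !mulgA.
  have := (sector_alternating e_irr e_sym m_gt1 n ba).1.
  by move=> s0; rewrite -(vpow1 e m_gt1 a) sector_vpowM// vpow1// s0 addr0.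
have inj : injective (fun n => (gen a * gen b) ^+ n.+1).
  by move=> i j /(alternating_inj e_irr e_sym m_gt1 ab)[].
apply: (infinite_injective inj) => n /=; elim: n => [|n IHn].
  rewrite expg1 chiM (negbTE bA) addbF -[gen a]mul1g chiM aA chi1.
  rewrite asboolT; last exact: special1.
  rewrite asboolF// mul1g; apply: (sector_neq0_notin aC).
  by have := a_b 0%N; rewrite expg0 mul1g.
rewrite expgSr mulgA chiM (negbTE bA) addbF chiM aA IHn !asboolF//.
  exact/(sector_neq0_notin aC)/a_b.
apply: (sector_neq0_notin aC).
by have [_] := sector_alternating e_irr e_sym m_gt1 n.+1 ab.
Qed.

End Splittings.

(** * Virtually abelian special subgroups *)

Lemma generated_commute (G : groupType) (S : set G) :
  (forall x y, S x -> S y -> commute x y) ->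
  forall x y, generated S x -> generated S y -> commute x y.
Proof.
move=> SC; have cent (y : G) : is_subgroup [set x : G | commute x y].
  split=> [|a b ay yb|a ay]; [exact/commute_sym/commute1| |].
    by apply/commute_sym/commuteM; exact/commute_sym.
  by apply/commute_sym/commuteV/commute_sym.
move=> x y Sx; apply: (generated_min (T := [set z | commute x z])) => [|s Ss].
  by rewrite (_ : [set _ | _] = [set z | commute z x])//; apply/seteqP; split=> z;
    exact: commute_sym.
by apply: (generated_min (cent s)) Sx => z Sz; exact: SC.
Qed.

Section SpecialSubgroups.
Variables (V : finType) (e : rel V) (m : V -> nat).
Hypothesis e_irr : irreflexive e.
Hypothesis e_sym : symmetric e.
Hypothesis m_gt1 : forall v, (1 < m v)%N.
Local Open Scope group_scope.

Notation W := (graph_product e m).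
Notation gen := (pres_gen (graph_product_rels e m)).
Notation special := (special_subgroup e m).
Notation sector := (@sector V e m).
Notation vpow := (@vpow V e m _).
Notation star := (star e).
Implicit Types (x y z : W) (u v a b : V).

(* W(D) is then a direct product of finite cyclic groups and infinite
   dihedral groups. *)
Lemma special_virtually_abelian (D : {set V}) :
  (forall a b b', a \in D -> b \in D -> b' \in D -> a \notin star b ->
     a \notin star b' -> b = b') ->
  (forall a b, a \in D -> b \in D -> a \notin star b -> m a = 2%N) ->
  virtually_abelian (special D).
Proof.
move=> uniq_nadj nadj_order.
have nadj_sym a b : (a \notin star b) = (b \notin star a) by rewrite star_sym.
have gen2 a b : a \in D -> b \in D -> a \notin star b -> gen a * gen a = 1 :> W.
  by move=> aD bD ab; have := gen_order e m a; rewrite (nadj_order a b)// expg2.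
have gen2V a b : a \in D -> b \in D -> a \notin star b -> (gen a)^-1 = gen a :> W.
  by move=> aD bD ab; apply: mulg1_eq; exact: (gen2 a b).
(* The translations of the infinite dihedral factors. They commute, and they generate a normal
   subgroup of W(D) with abelian quotient. *)
pose Z := [set x | exists a b, [/\ a \in D, b \in D, a \notin star b & x = gen a * gen b]].
have starC a b : a \in star b -> commute (gen a : W) (gen b).
  by move=> ab; apply: (star_commute e_sym m_gt1); exact: special_gen.
have ZC : forall x y, Z x -> Z y -> commute x y.
  move=> _ _ [a [b [aD bD ab ->]]] [a' [b' [a'D b'D ab' ->]]].
  have ba : b \notin star a by rewrite nadj_sym.
  have ba' : b' \notin star a' by rewrite nadj_sym.
  have [aa'|aa'] := eqVneq a a'.
    by rewrite -aa' in ab' *; rewrite (uniq_nadj a b b')//; exact: commute_refl.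
  (* If [b = a'] then [b' = a], and the two products of involutions are inverse to each other. *)
  have [ba'E|ba'E] := eqVneq b a'.
    rewrite -ba'E in ab' *; rewrite -(uniq_nadj b a b')//.
    rewrite /commute -!mulgA (mulgA (gen b) (gen b)) (gen2 b a)// mul1g.
    rewrite (gen2 a b)// (mulgA (gen a) (gen a)) (gen2 a b)// mul1g.
    by rewrite (gen2 b a).
  have ab'E : a != b' by apply: contraNneq ba'E => E; rewrite (uniq_nadj a b a')// E.
  have bb'E : b != b' by apply: contraNneq aa' => E; rewrite (uniq_nadj b a a')// E.
  have adj c d : c \in [:: a; b] -> d \in [:: a'; b'] -> commute (gen d : W) (gen c).
    rewrite !inE => cab dab; apply: starC; apply/negPn/negP => dc.
    have cd : c \notin star d by rewrite nadj_sym.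
    case/orP: cab => /eqP cE; subst c; case/orP: dab => /eqP dE; subst d.
    - by move: ba'E; rewrite (uniq_nadj a b a')// eqxx.
    - by move: bb'E; rewrite (uniq_nadj a b b')// eqxx.
    - by move: aa'; rewrite (uniq_nadj b a a')// eqxx.
    - by move: ab'E; rewrite (uniq_nadj b a b')// eqxx.
  by apply: commuteM; apply: commute_sym; apply: commuteM; apply: adj;
    rewrite !inE eqxx ?orbT.
pose B := generated Z; have Bg : is_subgroup B := generated_subgroup Z.
have [B1 BM BV] := Bg.
have Bz a b : a \in D -> b \in D -> a \notin star b -> B (gen a * gen b).
  by move=> aD bD ab; apply: sub_generated; exists a, b.
have Zconj s : s \in D -> forall x, Z x ->
    B ((gen s)^-1 * x * gen s) /\ B (gen s * x * (gen s)^-1).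
  move=> sD _ [a [b [aD bD ab ->]]]; have ba : b \notin star a by rewrite nadj_sym.
  have [->|sa] := eqVneq s a.
    rewrite (gen2V a b)// !mulgA (gen2 a b)// mul1g; split; exact: Bz.
  have [->|sb] := eqVneq s b.
    rewrite (gen2V b a)//= -!mulgA (gen2 b a)// mulg1; split; exact: Bz.
  have adj c : c \in [:: a; b] -> commute (gen s : W) (gen c).
    rewrite !inE => cab; apply: starC; apply/negPn/negP => sc.
    have cs : c \notin star s by rewrite nadj_sym.
    case/orP: cab => /eqP cE; subst c.
      by move: sb; rewrite (uniq_nadj a s b)// eqxx.
    by move: sa; rewrite (uniq_nadj b s a)// eqxx.
  have sab : commute (gen s : W) (gen a * gen b).
    by apply: commuteM; apply: adj; rewrite !inE eqxx ?orbT.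
  have E : (gen s)^-1 * (gen a * gen b) * gen s = gen a * gen b :> W.
    by rewrite -mulgA -sab mulKg.
  rewrite E; have -> : gen s * (gen a * gen b) * (gen s)^-1 = gen a * gen b :> W.
    by rewrite sab mulgK.
  by split; exact: Bz.
have Bconj s : s \in D -> forall x, B x -> B ((gen s)^-1 * x * gen s).
  move=> sD; apply: (@generated_min _ _ [set x | B ((gen s)^-1 * x * gen s)]).
    split=> [|x y Bx By|x Bx] /=; first by rewrite mulg1 mulVg.
      by have := BM _ _ Bx By; rewrite !mulgA mulgK.
    by have := BV _ Bx; rewrite !invgM invgK mulgA.
  by move=> x /(Zconj s sD)[].
have gens_comm u s : u \in D -> s \in D -> B ((gen u)^-1 * (gen s)^-1 * gen u * gen s).
  move=> uD sD; have [us|us] := boolP (u \in star s).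
    by rewrite -!mulgA (starC _ _ us) (mulgA _ (gen s) (gen u)) mulVg mul1g mulVg.
  have su : s \notin star u by rewrite nadj_sym.
  rewrite (gen2V u s)// (gen2V s u)// -mulgA; apply: BM; exact: Bz.
have comm s x : s \in D -> special D x -> B ((gen s * x)^-1 * (x * gen s)).
  move=> sD; elim/(@special_ind _ e _ m_gt1) => [|y u _ uD IH].
    by rewrite mulg1 mul1g mulVg.
  have -> : (gen s * (y * gen u))^-1 * (y * gen u * gen s) =
      ((gen u)^-1 * ((gen s * y)^-1 * (y * gen s)) * gen u) *
      ((gen u)^-1 * (gen s)^-1 * gen u * gen s).
    by rewrite !invgM !mulgA !mulgK.
  by apply: BM; [exact: Bconj|exact: gens_comm].
(* Modulo [B] the generators commute, so each coset contains a product with one power of each vertex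
   in a fixed order. *)
pose reps := foldr (fun s (T : set W) => [set vpow k * r | k in [set: 'Z_(m s)] & r in T])
  [set 1].
have finreps l : finite_set (reps l).
  elim: l => [|s l IHl]; first exact: finite_set1.
  by apply: finite_image2 => //; exact: finite_finset.
have sub_l (l : seq V) : {subset l <= D} -> special [set v in l]%SET `<=` special D.
  by move=> lD; apply: specialS; apply/fintype.subsetP => v; rewrite inE; exact: lD.
have repsP l : {subset l <= D} -> forall x, special [set v in l]%SET x ->
    exists2 r, reps l r & B (r^-1 * x).
  elim: l => [|s l IHl] lD.
    move=> x; elim/(@special_ind _ e _ m_gt1) => [|y v _]; last by rewrite !inE.
    by exists 1 => //; rewrite mulg1 invg1.
  have sD : s \in D by apply: lD; rewrite mem_head.
  have l'D : {subset l <= D} by move=> v vl; apply: lD; rewrite inE vl orbT.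
  suff split x : special [set v in s :: l]%SET x ->
      exists (k : 'Z_(m s)) (y : W), special [set v in l]%SET y /\
        B ((vpow k * y)^-1 * x).
    move=> x /split[k [y [/(IHl l'D)[r lr ry] yx]]]; exists (vpow k * r).
      by exists k => //; exists r.
    have -> : (vpow k * r)^-1 * x = (r^-1 * y) * ((vpow k * y)^-1 * x).
      by rewrite !invgM !mulgA mulgK.
    exact: BM.
  elim/(@special_ind _ e _ m_gt1) => [|y u _]; last rewrite !inE.
    by exists 0%R, 1; split; [exact: special1|rewrite vpow0 !mulg1 invg1].
  move=> us [k [z [lz zy]]]; have uD : u \in D by apply: lD; rewrite inE.
  have [ul|ul] := boolP (u \in l).
    exists k, (z * gen u); split.
      by apply: specialM => //; apply: special_gen; rewrite inE.
    have -> : (vpow k * (z * gen u))^-1 * (y * gen u) =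
        (gen u)^-1 * ((vpow k * z)^-1 * y) * gen u by rewrite !invgM !mulgA.
    exact: Bconj.
  move: us uD; rewrite (negbTE ul) orbF => /eqP-> _.
  exists (k + 1)%R, z; split=> //; rewrite vpowD// vpow1//.
  have -> : (vpow k * gen s * z)^-1 * (y * gen s) =
      ((gen s * z)^-1 * (z * gen s)) * ((gen s)^-1 * ((vpow k * z)^-1 * y) * gen s).
    by rewrite !invgM !mulgA !(mulgK, mulgVK).
  by apply: BM; [apply: comm => //; exact: sub_l lz|exact: Bconj].
exists B; split=> //.
- apply: generated_min; first exact: special_is_subgroup.
  by move=> _ [a [b [aD bD _ ->]]]; apply: specialM; exact: special_gen.
- exact: generated_commute.
- apply: (@sub_finite_set _ _ [set left_coset r B | r in reps (enum D)]).
    move=> _ [x Dx <-]; have [||r rr rx] := @repsP (enum D) _ x.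
    + by move=> v; rewrite mem_enum.
    + by apply: specialS Dx; apply/fintype.subsetP => v; rewrite inE mem_enum.
    exists r => //; apply/seteqP; split=> _ [b Bb <-].
      exists ((r^-1 * x)^-1 * b); first by apply: BM => //; exact: BV.
      by rewrite invgM invgK !mulgA mulgV mul1g.
    by exists (r^-1 * x * b); [exact: BM|rewrite !mulgA mulgV mul1g].
  exact: finite_image.
Qed.

End SpecialSubgroups.

(** * Free monoids of rank two *)

Section FreeMonoids.
Variables (V : finType) (e : rel V) (m : V -> nat).
Hypothesis e_irr : irreflexive e.
Hypothesis e_sym : symmetric e.
Hypothesis m_gt1 : forall v, (1 < m v)%N.
Local Open Scope group_scope.

Notation W := (graph_product e m).
Notation gen := (pres_gen (graph_product_rels e m)).
Notation special := (special_subgroup e m).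
Notation sector := (@sector V e m).
Notation vpow := (@vpow V e m _).
Notation star := (star e).
Implicit Types (x y z : W) (u v a b : V).

Lemma sector_genM v x : sector v (gen v * x) = (1 + sector v x)%R.
Proof. by rewrite -(vpow1 e m_gt1 v) sector_vpowM. Qed.

Lemma monoid_word_inj (p q : W) :
  (forall w w', p * monoid_word p q w <> q * monoid_word p q w') ->
  forall w w', size w = size w' -> monoid_word p q w = monoid_word p q w' -> w = w'.
Proof.
move=> pq; elim=> [|b w IH] [|b' w']//= [sz].
case: b b' => -[] => [/mulgI/(IH _ sz)->//|/pq//|/esym/pq//|/mulgI/(IH _ sz)->//].
Qed.

(** As [m a] exceeds 2, both 1 and 2 are nonzero modulo [m a]. Hence all words have sector 0 at [b],
    and the sector at [a] of a nonempty word is its leading exponent. *)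
Lemma free_monoid_power a b : a \notin star b -> m a <> 2%N ->
  forall w w', size w = size w' ->
  monoid_word (gen a * gen b) (gen a ^+ 2 * gen b) w =
  monoid_word (gen a * gen b) (gen a ^+ 2 * gen b) w' -> w = w'.
Proof.
move=> ab ma; have ba : b \notin star a by rewrite star_sym.
have ma2 : (2 < m a)%N by rewrite ltn_neqAle m_gt1 andbT; apply/eqP => /esym.
have two0 : (2%:R : 'Z_(m a))%R != 0%R.
  by apply/eqP => E; have := val_Zp_nat (m_gt1 a) 2; rewrite E modn_small.
have step (k : 'Z_(m a)) x : (k != 0)%R -> sector b x = 0%R ->
    sector a (vpow k * (gen b * x)) = k /\ sector b (vpow k * (gen b * x)) = 0%R.
  move=> k0 bx; have b1 : sector b (gen b * x) = 1%R by rewrite sector_genM bx addr0.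
  have a0 : sector a (gen b * x) = 0%R.
    by apply: (sector_sep e_irr e_sym m_gt1 ba); rewrite b1 oner_neq0_Zm.
  have ak : sector a (vpow k * (gen b * x)) = k by rewrite sector_vpowM// a0 addr0.
  by split=> //; apply: (sector_sep e_irr e_sym m_gt1 ab); rewrite ak.
have one0 := oner_neq0_Zm m a.
have gen1 : gen a = vpow (1%R : 'Z_(m a)) :> W by rewrite vpow1.
have genn2 : gen a ^+ 2 = vpow (2%:R%R : 'Z_(m a)) :> W by rewrite vpow_nat.
rewrite genn2 gen1; set M := monoid_word _ _.
have bM w : sector b (M w) = 0%R.
  elim: w => [|c w IH]; first by rewrite /M /= sector1.
  rewrite /M /= -/(M w); case: c; rewrite -mulgA; first by have [] := step _ _ one0 IH.
  by have [] := step _ _ two0 IH.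
apply: monoid_word_inj => w w'; rewrite -/(M w) -/(M w') -!mulgA => /(congr1 (sector a)).
have [-> _] := step _ _ one0 (bM w); have [-> _] := step _ _ two0 (bM w').
rewrite -[2%:R%R]/(1 + 1)%R => /eqP; rewrite -{1}[1%R]addr0 => /eqP/addrI/esym/eqP.
by rewrite (negbTE one0).
Qed.

(** After cancelling [gen a], the sector at [b] is 1 for a leading [gen b] and 0 for a leading
    [gen b'], whether or not [b] and [b'] are adjacent. *)
Lemma free_monoid_pair a b b' : a \notin star b -> a \notin star b' -> b != b' ->
  forall w w', size w = size w' ->
  monoid_word (gen a * gen b) (gen a * gen b') w =
  monoid_word (gen a * gen b) (gen a * gen b') w' -> w = w'.
Proof.
move=> ab ab' bb'; set M := monoid_word _ _.
have step c x : a \notin star c -> sector c x = 0%R ->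
    sector c (gen c * x) = 1%R /\ sector a (gen a * (gen c * x)) = 1%R.
  move=> ac cx; have ca : c \notin star a by rewrite star_sym.
  have c1 : sector c (gen c * x) = 1%R by rewrite sector_genM cx addr0.
  split=> //; rewrite sector_genM (sector_sep e_irr e_sym m_gt1 ca) ?addr0//.
  by rewrite c1 oner_neq0_Zm.
have M0 w : sector b (M w) = 0%R /\ sector b' (M w) = 0%R.
  elim: w => [|c w [IHb IHb']]; first by rewrite /M /= !sector1.
  have a1 : sector a (M (c :: w)) = 1%R.
    rewrite /M /= -/(M w); case: c; rewrite -mulgA; first by have [] := step b _ ab IHb.
    by have [] := step b' _ ab' IHb'.
  split; [apply: (sector_sep e_irr e_sym m_gt1 ab)|
    apply: (sector_sep e_irr e_sym m_gt1 ab')]; by rewrite a1 oner_neq0_Zm.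
apply: monoid_word_inj => w w'; rewrite -/(M w) -/(M w') -!mulgA => /mulgI E.
have [wb _] := M0 w; have [w'b w'b'] := M0 w'.
have [b1 _] := step b _ ab wb; have [b'1 _] := step b' _ ab' w'b'.
have /eqP := b1; rewrite E; suff -> : sector b (gen b' * M w') = 0%R.
  by rewrite eq_sym (negbTE (oner_neq0_Zm _ _)).
have [adj|nadj] := boolP (e b' b); first by rewrite sector_lkM.
apply: (@sector_sep _ _ _ e_irr e_sym m_gt1 b'); last by rewrite b'1 oner_neq0_Zm.
by rewrite inE eq_sym (negbTE bb') e_sym.
Qed.

(** The retraction to the subgroup of [v] and [w] kills [gen a] and [gen b], which separates the two
    exponents. *)
Lemma alternating_pairs_free v w a b (i j : int) :
  v \notin star w -> a \notin star b -> a \in common_link e v w ->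
  b \in common_link e v w ->
  commute (gen v * gen w : W) (gen a * gen b) /\
  (zexp (gen v * gen w : W) i * zexp (gen a * gen b) j = 1 -> i = 0%R /\ j = 0%R).
Proof.
move=> vw ab; rewrite !inE => /andP[va wa] /andP[vb wb]; split.
  by apply: commuteM; apply: commute_sym; apply: commuteM; apply: gen_commute;
    rewrite e_sym.
have [r [rM rin rout _ rid]] := @retraction V e m m_gt1 [set v; w].
have rZ x k : r (zexp x k) = zexp (r x) k.
  case: k => n /=; first exact: morph_gX.
  by rewrite morph_gV// morph_gX.
have notin c : e v c -> e w c -> c \notin [set v; w]%SET.
  move=> vc wc; rewrite !inE negb_or; apply/andP; split.
    by apply: contraTneq vc => ->; rewrite e_irr.
  by apply: contraTneq wc => ->; rewrite e_irr.
have z1 k : zexp (1 : W) k = 1.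
  by case: k => n /=; rewrite expg1n ?invg1.
move=> E; have i0 : i = 0%R.
  have := congr1 r E; rewrite rM !rZ !rM (rout a) ?(rout b) ?notin//.
  rewrite !rin ?inE ?eqxx ?orbT// mulg1 z1 mulg1 (morph_g1 rM).
  exact: (alternating_zorder e_irr e_sym m_gt1 vw).
split=> //; move: E; rewrite i0 mul1g.
exact: (alternating_zorder e_irr e_sym m_gt1 ab).
Qed.

(* A vertex a of the common link violating the description of virtually
   abelian special subgroups yields a free monoid commuting with gen v gen w. *)
Lemma common_link_virtually_abelian (R : realType) v w : v \notin star w ->
  has_isolated_flats R W -> virtually_abelian (special (common_link e v w)).
Proof.
move=> vw flats; set D := common_link e v w.
have commD x : special D x -> commute x (gen v * gen w).
  move=> Dx; apply: (@special_commute _ e _ m_gt1 D [set v; w]) => //.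
    move=> u u'; rewrite !inE => /andP[vu wu] /orP[]/eqP->; by rewrite e_sym ?vu ?wu.
  by apply: specialM; apply: special_gen; rewrite !inE eqxx ?orbT.
have nofree p q a b : a \in D -> b \in D -> a \notin star b -> special D p -> special D q ->
    ~ forall s s', size s = size s' -> monoid_word p q s = monoid_word p q s' -> s = s'.
  move=> aD bD ab Dp Dq.
  apply: (has_isolated_flats_no_free_monoid (t := gen v * gen w) (c := gen a * gen b) flats).
  - by have [] := alternating_pairs_free 0 0 vw ab aD bD.
  - by move=> i j; have [_] := alternating_pairs_free i j vw ab aD bD.
  - exact: commD.
  - exact: commD.
apply: (special_virtually_abelian e_sym m_gt1) => [a b b' aD bD b'D ab ab'|a b aD bD ab].
  apply: contrapT => /eqP bb'; apply: (nofree _ _ a b aD bD ab _ _ (free_monoid_pair ab ab' bb')).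
    by apply: specialM; exact: special_gen.
  by apply: specialM; exact: special_gen.
apply: contrapT => ma; apply: (nofree _ _ a b aD bD ab _ _ (free_monoid_power ab ma)).
  by apply: specialM; exact: special_gen.
by apply: specialM; [apply: specialX|]; exact: special_gen.
Qed.

End FreeMonoids.

Theorem corollary8p4 (R : realType) (V : finType) (e : rel V) (m : V -> nat)
  (e_irr : irreflexive e) (e_sym : symmetric e) (V_gt0 : (0 < #|V|)%N)
  (m_pp : forall v, prime_power (m v)) :
  one_ended (graph_product e m) ->
  has_isolated_flats R (graph_product e m) ->
  infinite_set (Out (graph_product e m)) ->
  exists DA DB DC : {set V},
    [/\ splits_as (special_subgroup e m DA) (special_subgroup e m DB)
          (special_subgroup e m DC),
        infinite_set (special_subgroup e m DC) &
        virtually_abelian (special_subgroup e m DC)].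
Proof.
move=> ends flats outs.
have m_gt1 v : (1 < m v)%N.
  by have [p [k [p_pr k0 ->]]] := m_pp v; rewrite -(exp1n k) ltn_exp2r// prime_gt1.
have [v [w [u [vw nvw uC uv uw]]]] : exists v w u, separating_link e v w u.
  apply: contrapT => nsep; apply: outs.
  have [T [finT torsion]] := has_isolated_flats_torsion flats.
  apply: (Out_finite e_irr e_sym m_gt1 _ finT torsion) => v w u sep.
  by apply: nsep; exists v, w, u.
set C := common_link e v w in uC uv uw.
(* Edges leave the component [K] only towards [C], so [C :|: K] and [~: K] cover all edges and meet
   in [C]; [u] and [v] witness that both are larger than [C]. *)
pose K : {set V} := [set z | connect (avoiding e C) u z]%SET.
have uK : u \in K by rewrite inE.
have KC z : z \in K -> z \notin C.
  rewrite inE => /connectP[p + ->]; elim/last_ind: p => [//|p z' _].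
  by rewrite last_rcons rcons_path => /andP[_ /and3P[]].
have vstarw : v \notin star e w by rewrite inE (negbTE vw) e_sym.
have vC : v \notin C by rewrite inE e_irr.
have DC : (C :|: K) :&: ~: K = C.
  apply/setP => z; rewrite !inE; have [zK|zK] := boolP (connect _ u z).
    by have := KC z; rewrite !inE zK => /(_ isT) /negbTE->; rewrite andbF.
  by rewrite orbF andbT.
have cover z : (z \in C :|: K) || (z \in ~: K).
  by rewrite finset.in_setU finset.in_setC -orbA orbN orbT.
have edgeK x y : e x y -> x \in K -> y \in C :|: K.
  move=> xy xK; rewrite finset.in_setU; have [//|yC] := boolP (y \in C); rewrite /=.
  move: (xK); rewrite !inE => ux; apply: (connect_trans ux); apply: connect1.
  by rewrite /avoiding /= xy yC KC.
have edges x y : e x y ->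
    (x \in C :|: K) && (y \in C :|: K) || (x \in ~: K) && (y \in ~: K).
  move=> xy; have [xK|xK] := boolP (x \in K).
    by rewrite (edgeK _ _ xy xK) finset.in_setU xK orbT.
  have [yK|yK] := boolP (y \in K).
    by rewrite (edgeK y x) ?(e_sym y)// finset.in_setU yK orbT.
  by rewrite !finset.in_setC xK yK orbT.
have uA : u \in C :|: K by rewrite finset.in_setU uK orbT.
have uB : u \notin ~: K by rewrite finset.in_setC uK.
have vB : v \in ~: K by rewrite finset.in_setC inE.
have vA : v \notin C :|: K by rewrite finset.in_setU negb_or vC -finset.in_setC.
have [a [b [aC bC ab]]] : exists a b, [/\ a \in C, b \in C & a \notin star e b].
  apply: contrapT => clique.
  apply: (one_ended_not_clique e_irr e_sym m_gt1 edges cover uA uB vB vA _ ends).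
  rewrite DC; apply: (special_clique_finite e_irr e_sym m_gt1) => a b aC bC.
  by apply/negPn/negP => ab; apply: clique; exists a, b.
exists (C :|: K), (~: K), C; split.
- split.
  + by have := graph_product_amalgam m_gt1 cover edges; rewrite DC.
  + by apply: (special_proper e_irr e_sym m_gt1 _ uA) => //; exact: finset.subsetUl.
  + apply: (special_proper e_irr e_sym m_gt1 _ vB vC).
    by apply/fintype.subsetP => z zC; rewrite finset.in_setC; exact: contraL (KC z) zC.
- exact: (special_infinite e_irr e_sym m_gt1 ab aC bC).
- exact: (common_link_virtually_abelian e_irr e_sym m_gt1 vstarw flats).
Qed.
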